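(* Let $\Omega$ be a bounded domain in $\mathbb C^n$ and $E$ a measurable relatively compact subset of $\Omega$. Set $d:=d(E,\partial\Omega)$, the Euclidean distance from $E$ to $\partial\Omega$. Then: (1) For $0<p<\infty$, one has $$s_p(E,\Omega)\le\frac{128/\lambda_1(\Omega)}{128/\lambda_1(\Omega)+d^2},$$ where $\lambda_1(\Omega)$ is the first eigenvalue of the Laplacian on $\Omega$. (2) For $1<p<\infty$, one has $$s_p(E,\Omega)\le\frac{C_{n,p}(\Omega)}{C_{n,p}(\Omega)+d^{\,p/\tilde p}},$$ where $\tilde p$ stands for the largest integer smaller than $p$ and $C_{n,p}(\Omega)>0$ is a constant depending only on $n$, $p$ and $\Omega$.
   Context: All integrals are with respect to Lebesgue measure. $A^p(\Omega)=\{f\in\mathcal O(\Omega):\int_\Omega|f|^p<\infty\}$. For a measurable subset $E\subset\Omega$ and $0<p<\infty$, the $p$-Schwarz content of $E$ relative to $\Omega$ is $$s_p(E,\Omega):=\sup\left\{\frac{\int_E|f|^p}{\int_\Omega|f|^p}: f\in A^p(\Omega)\setminus\{0\}\right\}.$$ The first eigenvalue is $\lambda_1(\Omega):=\inf\left\{\frac{\int_\Omega|\nabla\phi|^2}{\int_\Omega\phi^2}:\phi\in W_0^{1,2}(\Omega)\setminus\{0\}\right\}$. ''Largest integer smaller than $p$'' is strict, i.e. $\tilde p<p$. *)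

(* Defs.v *)
From HB Require Import structures.
From mathcomp Require Import all_boot all_order all_algebra.
From mathcomp Require Import complex.
From mathcomp Require Import all_classical all_reals all_analysis.

Set Implicit Arguments.
Unset Strict Implicit.
Unset Printing Implicit Defensive.

Import Order.TTheory GRing.Theory Num.Theory.
Import numFieldNormedType.Exports.
Import ComplexField.Normc.

Local Open Scope classical_set_scope.
Local Open Scope ring_scope.

(* The Borel sigma-algebra of R^N, generated by the coordinates. *)
Section borel_rV.
Context (R : realType) (N : nat).

Let coord (i : 'I_N) (x : 'rV[R]_N) : measurableTypeR R := x 0 i.

Let borel0 : g_sigma_preimage coord set0.
Proof. exact: sigma_algebra0. Qed.

Let borelC A : g_sigma_preimage coord A -> g_sigma_preimage coord (~` A).
Proof. exact: sigma_algebraC. Qed.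

Let borel_bigcup (F : _^nat) : (forall i, g_sigma_preimage coord (F i)) ->
  g_sigma_preimage coord (\bigcup_i (F i)).
Proof. exact: sigma_algebra_bigcup. Qed.

HB.instance Definition _ := @isMeasurable.Build default_measure_display
  'rV[R]_N (g_sigma_preimage coord) borel0 borelC borel_bigcup.

Lemma measurable_coord (i : 'I_N) :
  measurable_fun [set: 'rV[R]_N]
    (fun x : 'rV[R]_N => x 0 i : measurableTypeR R).
Proof.
move=> _ Y mY; rewrite setTI; apply: sub_sigma_algebra => /=.
rewrite -bigcup_seq/=; exists i => /=; first by rewrite mem_index_enum.
by exists Y => //; rewrite setTI.
Qed.

Lemma measurable_to_rV d (T : measurableType d) (f : T -> 'rV[R]_N) :
  (forall i, measurable_fun [set: T] (fun t => f t 0 i : measurableTypeR R)) ->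
  measurable_fun [set: T] f.
Proof.
move=> mf _ A mA; rewrite setTI.
suff : g_sigma_preimage coord `<=` [set B | measurable (f @^-1` B)] by apply.
apply: smallest_sub.
  split => /=.
  - by rewrite preimage_set0.
  - by move=> B mB; rewrite setTD preimage_setC; exact: measurableC.
  - by move=> F mF; rewrite preimage_bigcup; exact: bigcup_measurable.
move=> B; rewrite -bigcup_seq/= => -[i _] [C mC <-].
by rewrite setTI /=; have := mf i measurableT _ mC; rewrite setTI.
Qed.

End borel_rV.

Section product_lebesgue.
Context (R : realType).

Definition cons_rV N (p : measurableTypeR R * 'rV[R]_N) : 'rV[R]_N.+1 :=
  row_mx (p.1%:M : 'rV[R]_1) p.2 : 'rV[R]_(1 + N).

Definition uncons_rV N (x : 'rV[R]_N.+1) : measurableTypeR R * 'rV[R]_N :=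
  (x 0 0, rsubmx (x : 'rV[R]_(1 + N))).

Lemma cons_rVK N : cancel (@cons_rV N) (@uncons_rV N).
Proof.
move=> [a x]; rewrite /uncons_rV /cons_rV (@row_mxKr _ 1 1 N).
have -> : (0 : 'I_N.+1) = lshift N (0 : 'I_1) by exact/val_inj.
by rewrite (@row_mxEl _ 1 1 N) mxE eqxx mulr1n.
Qed.

Lemma measurable_cons_rV N : measurable_fun setT (@cons_rV N).
Proof.
apply: measurable_to_rV => i.
case: (@split_ordP 1 N i) => j ->.
  under eq_fun do rewrite /cons_rV (@row_mxEl _ 1 1 N) (ord1 j) mxE eqxx mulr1n.
  exact: measurable_fst.
under eq_fun do rewrite /cons_rV (@row_mxEr _ 1 1 N).
exact: measurableT_comp (measurable_coord j) measurable_snd.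
Qed.

Lemma measurable_uncons_rV N : measurable_fun setT (@uncons_rV N).
Proof.
apply/measurable_fun_pair; first exact: measurable_coord.
apply: measurable_to_rV => i; under eq_fun do rewrite /= mxE.
exact: measurable_coord.
Qed.

HB.instance Definition _ N :=
  isMeasurableFun.Build _ _ _ _ (@cons_rV N) (@measurable_cons_rV N).

Section step.
Context (N : nat) (mu : {sigma_finite_measure set 'rV[R]_N -> \bar R}).

Definition lebesgue_step : set 'rV[R]_N.+1 -> \bar R :=
  pushforward (@lebesgue_measure R \x mu)%E (@cons_rV N).

Let lebesgue_step0 : lebesgue_step set0 = 0%E.
Proof. exact: measure0. Qed.

Let lebesgue_step_ge0 A : (0 <= lebesgue_step A)%E.
Proof. exact: measure_ge0. Qed.

Let lebesgue_step_sigma_additive : semi_sigma_additive lebesgue_step.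
Proof. exact: measure_semi_sigma_additive. Qed.

HB.instance Definition _ := isMeasure.Build _ _ _ lebesgue_step
  lebesgue_step0 lebesgue_step_ge0 lebesgue_step_sigma_additive.

Lemma lebesgue_step_sigma_finite : sigma_finite setT lebesgue_step.
Proof.
have /sigma_finiteP[F [TF ndF Foo]] := sigma_finiteT (@lebesgue_measure R).
have /sigma_finiteP[G [TG ndG Goo]] := sigma_finiteT mu.
have FGT : \bigcup_k (F k `*` G k) = setT.
  rewrite -setXTT TF TG predeqE => -[x y]; split.
    by move=> [n _ []/= ? ?]; split; exists n.
  move=> [/= [n _ Fnx] [k _ Gky]]; exists (maxn n k) => //; split.
  - by move: x Fnx; exact/subsetPset/ndF/leq_maxl.
  - by move: y Gky; exact/subsetPset/ndG/leq_maxr.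
exists (fun k => @uncons_rV N @^-1` (F k `*` G k)).
  by rewrite -preimage_bigcup FGT preimage_setT.
move=> k; have [mF Fk] := Foo k; have [mG Gk] := Goo k; split.
  rewrite -[X in measurable X]setTI; apply: measurable_uncons_rV => //.
  exact: measurableX.
rewrite /lebesgue_step /pushforward -comp_preimage.
rewrite (_ : _ \o _ = id); last by apply/funext => p; exact: cons_rVK.
rewrite preimage_id product_measure1E//.
by rewrite lte_mul_pinfty// ge0_fin_numE.
Qed.

HB.instance Definition _ :=
  Measure_isSigmaFinite.Build _ _ _ lebesgue_step lebesgue_step_sigma_finite.

End step.

Fixpoint borel_lebesgue N : {sigma_finite_measure set 'rV[R]_N -> \bar R} :=
  match N with
  | 0 => \d_ (0 : 'rV[R]_0)
  | N'.+1 => lebesgue_step (borel_lebesgue N')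
  end.

End product_lebesgue.

(* R^N with the sigma-algebra of Lebesgue measurable sets: the domain of the
   completion of the N-fold product of the Lebesgue measure of R. *)
Definition lebesgueType (R : realType) (N : nat) :=
  caratheodory_type (mu_ext (borel_lebesgue R N)).

HB.instance Definition _ R N := Measurable.on (lebesgueType R N).

Definition lebesgue_rV (R : realType) (N : nat) :
    {measure set (lebesgueType R N) -> \bar R} :=
  @completed_measure_extension _ _ _ (borel_lebesgue R N).

Section euclidean.
Context (R : realType) (N : nat).
Local Notation E := 'rV[R]_N.
Local Notation lambda := (lebesgue_rV R N).
Implicit Types (Omega : set E) (phi g : E -> R) (G : 'I_N -> E -> R).

Definition enorm (x : E) : R := Num.sqrt (\sum_(j < N) x 0 j ^+ 2).

(* The norm topology of 'rV[R]_N is that of the max norm, which is the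
   Euclidean topology. *)
Definition bounded_domain Omega : Prop :=
  [/\ open Omega, connected Omega, Omega !=set0 & bounded_set Omega].

Definition boundary Omega : set E := closure Omega `\` interior Omega.

Definition relatively_compact (A Omega : set E) : Prop :=
  compact (closure A) /\ closure A `<=` Omega.

Definition Lebesgue_measurable (A : set E) : Prop :=
  measurable (A : set (lebesgueType R N)).

(* Valued in \bar R: the distance is +oo when one of the sets is empty. *)
Definition eucl_dist (A B : set E) : \bar R :=
  ereal_inf [set (enorm (x - y))%:E | x in A & y in B].

Definition partial (j : 'I_N) phi : E -> R :=
  fun x => 'D_(delta_mx 0 j : E) phi x.

Definition smooth phi : Prop :=
  forall (s : seq 'I_N) (x : E), differentiable (foldr partial phi s) x.

(* C_c^oo(Omega), its elements being extended by zero outside Omega. *)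
Definition test_function Omega phi : Prop :=
  [/\ smooth phi, compact (closure [set x | phi x != 0])
    & closure [set x | phi x != 0] `<=` Omega].

Definition L2 Omega phi : Prop :=
  measurable_fun (Omega : set (lebesgueType R N))
    (phi : lebesgueType R N -> R) /\
  (\int[lambda]_(x in Omega) (phi x ^+ 2)%:E < +oo)%E.

Definition weak_partial Omega (j : 'I_N) phi g : Prop :=
  forall psi, test_function Omega psi ->
    (\int[lambda]_(x in Omega) (phi x * partial j psi x)%:E =
     - \int[lambda]_(x in Omega) (g x * psi x)%:E)%E.

(* phi belongs to W^{1,2}(Omega) and G is its weak gradient. *)
Definition sobolev12 Omega phi G : Prop :=
  L2 Omega phi /\
  forall j, L2 Omega (G j) /\ weak_partial Omega j phi (G j).

(* W_0^{1,2}(Omega) is the closure of C_c^oo(Omega) in W^{1,2}(Omega). *)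
Definition sobolev12_0 Omega phi G : Prop :=
  sobolev12 Omega phi G /\
  forall e : R, 0 < e -> exists2 psi, test_function Omega psi &
    (\int[lambda]_(x in Omega) ((psi x - phi x) ^+ 2 +
       \sum_(j < N) (partial j psi x - G j x) ^+ 2)%:E < e%:E)%E.

(* Elements of W_0^{1,2}(Omega) are identified when equal almost everywhere. *)
Definition ae_zero Omega phi : Prop :=
  {ae lambda, forall x, Omega x -> phi x = 0}.

Definition lambda1 Omega : \bar R :=
  ereal_inf [set q | exists phi G,
    [/\ sobolev12_0 Omega phi G, ~ ae_zero Omega phi &
      q = (\int[lambda]_(x in Omega) (\sum_(j < N) G j x ^+ 2)%:E /
           \int[lambda]_(x in Omega) (phi x ^+ 2)%:E)%E]].

End euclidean.

(* C^n is identified with R^(n + n) through z_j = x_j + i y_j, where x_j and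
   y_j are the entries lshift n j and rshift n j of the row vector z. *)
Section several_complex_variables.
Context (R : realType) (n : nat).
Local Notation Cn := 'rV[R]_(n + n).
Local Notation lambda := (lebesgue_rV R (n + n)).
Implicit Types (Omega : set Cn) (f : Cn -> R[i]).

(* C^1 solutions of the Cauchy-Riemann equations; the values of f outside
   Omega are irrelevant. *)
Definition holomorphic Omega f : Prop :=
  let u := fun z => complex.Re (f z) in
  let v := fun z => complex.Im (f z) in
  forall z, Omega z ->
    [/\ differentiable u z, differentiable v z,
        (forall k : 'I_(n + n), {for z, continuous (partial k u)} /\
                                {for z, continuous (partial k v)}) &
        forall j : 'I_n,
          partial (lshift n j) u z = partial (rshift n j) v z /\
          partial (rshift n j) u z = - partial (lshift n j) v z].

Definition pmass (p : R) (A : set Cn) f : \bar R :=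
  (\int[lambda]_(z in A) (normc (f z) `^ p)%:E)%E.

Definition bergman (p : R) Omega : set (Cn -> R[i]) :=
  [set f | holomorphic Omega f /\ (pmass p Omega f < +oo)%E].

Definition schwarz_content (p : R) (A Omega : set Cn) : \bar R :=
  ereal_sup [set (pmass p A f / pmass p Omega f)%E | f in
    [set f | bergman p Omega f /\ exists2 z, Omega z & f z != 0]].

End several_complex_variables.

Definition largest_int_below (R : realType) (p : R) (m : int) : Prop :=
  m%:~R < p /\ forall k : int, k%:~R < p -> k <= m.

(* Main.v *)
From HB Require Import structures.
Require Import Defs.
From mathcomp Require Import all_boot all_order all_algebra.
From mathcomp Require Import complex ring lra.
From mathcomp Require Import all_classical all_reals all_analysis.
From mathcomp Require Import measurable_realfun.

Set Implicit Arguments.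
Unset Strict Implicit.
Unset Printing Implicit Defensive.

Import Order.TTheory GRing.Theory Num.Theory.
Import numFieldNormedType.Exports.
Import ComplexField.Normc.

Local Open Scope classical_set_scope.
Local Open Scope ring_scope.

(** Let E have distance d from the boundary of Omega, let f be in the Bergman
    space, and let m and r be the masses of |f|^p on E and on its complement in
    Omega. The ratio m / (m + r) is at most k / (k + D) as soon as m D <= k r
    (ratio_le), so each half of the theorem is an inequality between m and r.
    Both of them use a smooth cutoff chi that is 1 near E, is supported in
    Omega and has a gradient of size 1 / d, carried by Omega minus E
    (domain_cutoff).

    For the first half, |f|^(p/2) is subharmonic. The Caccioppoli estimate says
    that for a subharmonic u >= 0 the Dirichlet integral of chi u is at most the
    integral of u^2 |grad chi|^2 (caccioppoli): the difference is a divergence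
    plus a term of the right sign. With u = |f|^(p/2), the definition of the
    first eigenvalue bounds lambda1 m from above by the Dirichlet integral of
    chi u, which is at most r times the maximum of |grad chi|^2
    (eigenvalue_mass). As |f|^(p/2) is not smooth at the zeros of f, and chi u
    has to be a test function, the argument is run with (|g|^2 + e)^(p/4), where
    g is a mollification of f; g is again holomorphic near the support of chi,
    as convolution commutes with derivatives. Then e and the radius of the
    mollifier tend to 0 (eigenvalue_inequality). The quotient by lambda1 is
    meaningful because lambda1 > 0, by the Poincare inequality (lambda1_gt0).

    For the second half, f is replaced by h = f^a with a the largest integer
    below p, which turns |f|^p into |h|^q with q = p / a > 1. The function chi h
    has compact support and its d-bar derivative is h times that of chi. On a
    complex line the Cauchy-Pompeiu formula in polar coordinates reads
    2 pi g(z) = - int int 2 e^(-it) (d-bar g)(z + r e^(it)) dt dr, in which the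
    Jacobian r has cancelled the Cauchy kernel. It follows from the fundamental
    theorem of calculus along rays and circles (cauchy_pompeiu). So g is
    dominated by an average of translates of |d-bar g|, and Jensen's inequality
    and Tonelli's theorem bound the L^q norm of g by that of d-bar g
    (cauchy_transform_powR). For g = chi h this is m <= C d^(-q) r (dbar_mass).

    The positivity of d, and the fact that the points closer than d to E are in
    Omega, come from compactness and from a segment argument
    (eucl_dist_boundary). *)

(** * Borel sets of R^N *)

Section borel.
Context (R : realType) (N : nat).

Lemma mx_norm_ltP (x : 'rV[R]_N) (r : R) : 0 < r ->
  `|x| < r <-> forall j, `|x 0 j| < r.
Proof.
move=> r0; rewrite /Num.norm/= mx_normrE; split.
  move=> /bigmax_ltP[_ h] j; exact: (h (0, j)).
by move=> h; apply/bigmax_ltP; split=> // -[i j] _ /=; rewrite (ord1 i); exact: h.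
Qed.

Lemma mx_norm_leP (x : 'rV[R]_N) (r : R) : 0 <= r ->
  `|x| <= r <-> forall j, `|x 0 j| <= r.
Proof.
move=> r0; rewrite /Num.norm/= mx_normrE; split.
  move=> /bigmax_leP[_ h] j; exact: (h (0, j)).
by move=> h; apply/bigmax_leP; split=> // -[i j] _ /=; rewrite (ord1 i); exact: h.
Qed.

Lemma coord_le_norm (x : 'rV[R]_N) j : `|x 0 j| <= `|x|.
Proof. by have /mx_norm_leP := lexx `|x|; apply. Qed.

Lemma measurable_box (a : 'rV[R]_N) (r : R) :
  measurable [set x : 'rV[R]_N | forall j, `|x 0 j - a 0 j| < r].
Proof.
have -> : [set x : 'rV[R]_N | forall j, `|x 0 j - a 0 j| < r] =
    \bigcap_(j in [set: 'I_N]) ((fun x : 'rV[R]_N => x 0 j) @^-1` ball (a 0 j) r).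
  apply/seteqP; split => x /= h j => [_|]; rewrite /ball/= distrC//; exact: h.
apply: fin_bigcap_measurable => [|j _]; first exact: finite_finset.
rewrite -[X in measurable X]setTI; apply: (measurable_coord j) => //.
exact: measurable_ball.
Qed.

(** The measurable structure of R^N is generated by the coordinates only. An open
    set is a union of rational boxes, and there are countably many of those. *)
Lemma open_measurable_rV (U : set 'rV[R]_N) : open U -> measurable U.
Proof.
move=> oU.
pose B (qr : 'rV[rat]_N * rat) : set 'rV[R]_N :=
  [set x | forall j, `|x 0 j - ratr (qr.1 0 j)| < ratr qr.2].
pose C (k : nat) : set 'rV[R]_N :=
  if unpickle k is Some qr then
    if `[< B qr `<=` U >] then B qr else set0 else set0.
suff -> : U = \bigcup_k C k.
  apply: bigcupT_measurable => k; rewrite /C.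
  case: unpickle => [qr|]; last exact: measurable0.
  case: asboolP => _; last exact: measurable0.
  rewrite /B; have := @measurable_box (\row_j ratr (qr.1 0 j)) (ratr qr.2).
  by under eq_set do under eq_forall do rewrite mxE.
apply/seteqP; split => x; last first.
  move=> [k _]; rewrite /C; case: unpickle => [qr|//].
  by case: asboolP => // BU; exact: BU.
move=> Ux; have /nbhs_ballP[e /= e0 eU] := open_nbhs_nbhs (conj oU Ux).
have [r /andP[r0 re]] : exists r : rat, (0 < ratr r :> R) && (ratr r < e / 2 :> R).
  have /rat_in_itvoo[r] : (0 : R) < e / 2 by rewrite divr_gt0.
  by rewrite in_itv/=; exists r.
have hq j : exists q : rat, `|x 0 j - ratr q| < ratr r :> R.
  have /rat_in_itvoo[q] : x 0 j - ratr r < x 0 j + ratr r :> R by lra.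
  by rewrite in_itv/= => /andP[h1 h2]; exists q; rewrite ltr_norml; apply/andP; split; lra.
pose q := \row_j projT1 (cid (hq j)).
exists (pickle (q, r)) => //; rewrite /C pickleK.
have Bx : B (q, r) x by move=> j; rewrite /= mxE; case: cid.
case: asboolP => // nB; exfalso; apply: nB => y By; apply: eU.
rewrite -ball_normE /ball_/=; apply/mx_norm_ltP => // j; rewrite !mxE.
have := By j; have := Bx j; rewrite /= mxE !ltr_norml => /andP[h1 h2] /andP[h3 h4].
by apply/andP; split; lra.
Qed.

Lemma continuous_measurable_rV (f : 'rV[R]_N -> R) :
  continuous f -> measurable_fun [set: 'rV[R]_N] (f : 'rV[R]_N -> measurableTypeR R).
Proof.
move=> /continuousP cf.
move=> mT; apply: (measurability _ (RGenOInfty.measurableE R)) => //.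
move=> _ [_ [a ->] <-]; rewrite setTI; apply: open_measurable_rV.
by apply: cf; exact: interval_open.
Qed.

End borel.

(** * Translation invariance of the Lebesgue measure *)

Section translation.
Context (R : realType).
Local Notation mR := (measurableTypeR R).
Local Notation mu := (@lebesgue_measure R).

Let shift (a : R) : mR -> mR := fun t => t + a.

Let measurable_shift a : measurable_fun [set: mR] (shift a).
Proof. by apply: measurable_funD => //; exact: measurable_cst. Qed.

HB.instance Definition _ a :=
  isMeasurableFun.Build _ _ mR mR (shift a) (measurable_shift a).

(** Both measures agree on half-open intervals, which determine them. *)
Lemma lebesgue_measure_shift (a : R) (A : set mR) :
  measurable A -> mu A = mu [set t | A (t + a)].
Proof.
move=> mA.
have E : mu A = pushforward mu (shift a) A.
  apply: (@lebesgue_measure_unique R (pushforward mu (shift a))) => //.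
  move=> X [[x y] _ <-]; rewrite /= /pushforward.
  have -> : shift a @^-1` `]x, y] = [set` `]x - a, y - a]].
    apply/seteqP; split => t /=; rewrite !in_itv/= /shift => /andP[h1 h2];
      by apply/andP; split; lra.
  rewrite !lebesgue_measure_itv/= !lte_fin ltrD2r.
  by case: ifP => // _; rewrite -!EFinB; congr EFin; ring.
by rewrite E.
Qed.

Lemma ge0_integral_lebesgue_shift (a : R) (f : mR -> \bar R) :
  measurable_fun [set: mR] f -> (forall x, 0 <= f x)%E ->
  (\int[mu]_t f (t + a)%R = \int[mu]_t f t)%E.
Proof.
move=> mf f0.
have -> : (\int[mu]_t f t = \int[pushforward mu (shift a)]_t f t)%E.
  by apply: eq_measure_integral => A mA _; exact: lebesgue_measure_shift.
by rewrite ge0_integral_pushforward.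
Qed.

Lemma add_cons_rV N t (y : 'rV[R]_N) (a : 'rV[R]_N.+1) :
  cons_rV (t, y) + a = cons_rV (t + a 0 0, y + rsubmx (a : 'rV_(1 + N))).
Proof.
apply/rowP => i; rewrite mxE /cons_rV.
case: (@split_ordP 1 N i) => j ->.
  rewrite !(@row_mxEl _ 1 1 N) (ord1 j) !mxE eqxx !mulr1n.
  by congr (_ + a _ _); exact/val_inj.
by rewrite !(@row_mxEr _ 1 1 N) !mxE.
Qed.

(** A section of a translated set is a translated section, so the invariance on R
    and the induction hypothesis apply one after the other. *)
Lemma borel_lebesgue_shift N (a : 'rV[R]_N) (A : set 'rV[R]_N) :
  measurable A -> borel_lebesgue R N [set x | A (x + a)] = borel_lebesgue R N A.
Proof.
elim: N a A => [|N IH] a A mA.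
  congr (_ _); apply/seteqP; split => x /=; by rewrite (_ : x + a = x)//; apply/rowP; case.
have mcA : measurable (@cons_rV R N @^-1` A).
  by rewrite -[X in measurable X]setTI; exact: measurable_cons_rV.
rewrite /= /lebesgue_step /pushforward /product_measure1.
pose g := borel_lebesgue R N \o xsection (@cons_rV R N @^-1` A).
transitivity (\int[mu]_t g (t + a 0 0)%R)%E; last first.
  by apply: ge0_integral_lebesgue_shift => //; exact: measurable_fun_xsection.
apply: eq_integral => t _; rewrite /g /=.
have mx : measurable (xsection (@cons_rV R N @^-1` A) (t + a 0 0)).
  exact: measurable_xsection.
rewrite -(IH (rsubmx (a : 'rV_(1 + N))) _ mx).
congr (borel_lebesgue R N _); apply/seteqP.
by split => y /=; rewrite /xsection/= !inE/= add_cons_rV.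
Qed.
End translation.

Section integral_lebesgue_rV.
Context (R : realType) (N : nat).
Local Notation V := 'rV[R]_N.
Local Notation lambda := (lebesgue_rV R N).
Local Notation bl := (borel_lebesgue R N).

Lemma borel_Lebesgue_measurable (A : set V) : measurable A -> Lebesgue_measurable A.
Proof. exact: caratheodory_measurable_mu_ext. Qed.

Lemma lebesgue_rVE (A : set V) : measurable A -> lambda A = bl A.
Proof. by move=> mA; rewrite /lebesgue_rV /= /completed_measure_extension measurable_mu_extE. Qed.

Lemma borel_Lebesgue_measurable_fun d (T : measurableType d) (f : V -> T) :
  measurable_fun [set: V] f ->
  measurable_fun [set: lebesgueType R N] (f : lebesgueType R N -> T).
Proof.
move=> mf _ Y mY; apply: borel_Lebesgue_measurable.
exact: mf.
Qed.

Lemma continuous_Lebesgue_measurable_fun (f : V -> R) : continuous f ->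
  measurable_fun [set: lebesgueType R N] (f : lebesgueType R N -> measurableTypeR R).
Proof.
move=> cf; apply: (borel_Lebesgue_measurable_fun (T := measurableTypeR R)).
exact: continuous_measurable_rV.
Qed.

Let lid : lebesgueType R N -> V := id.
Let measurable_lid : measurable_fun setT lid.
Proof. by apply: (borel_Lebesgue_measurable_fun (f := @id V)); exact: measurable_id. Qed.
HB.instance Definition _ := isMeasurableFun.Build _ _ _ _ lid measurable_lid.

Let vshift (a : V) : V -> V := fun x => x + a.
Let measurable_vshift a : measurable_fun setT (vshift a).
Proof.
apply: measurable_to_rV => j; under eq_fun do rewrite mxE.
by apply: measurable_funD; [exact: measurable_coord|exact: measurable_cst].
Qed.
HB.instance Definition _ a := isMeasurableFun.Build _ _ _ _ (vshift a) (measurable_vshift a).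

(** Transfer from the completed measure to the product measure, for which Fubini's
    theorem is available: the latter is the image of the former by the identity. *)
Lemma ge0_integral_lebesgue_rVE (f : V -> \bar R) :
  measurable_fun [set: V] f -> (forall x, 0 <= f x)%E ->
  (\int[lambda]_x f x = \int[bl]_x f x)%E.
Proof.
move=> mf f0.
have -> : (\int[bl]_x f x = \int[pushforward lambda lid]_x f x)%E.
  by apply: eq_measure_integral => A mA _; exact/esym/lebesgue_rVE.
by rewrite ge0_integral_pushforward.
Qed.

Lemma ge0_integral_lebesgue_rV_shift (a : V) (f : V -> \bar R) :
  measurable_fun [set: V] f -> (forall x, 0 <= f x)%E ->
  (\int[lambda]_x f (x + a)%R = \int[lambda]_x f x)%E.
Proof.
move=> mf f0.
rewrite !ge0_integral_lebesgue_rVE//; last first.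
  by apply: (measurableT_comp mf); exact: measurable_vshift.
have -> : (\int[bl]_x f x = \int[pushforward bl (vshift a)]_x f x)%E.
  by apply: eq_measure_integral => A mA _; exact/esym/borel_lebesgue_shift.
by rewrite ge0_integral_pushforward.
Qed.

End integral_lebesgue_rV.

(** * Volumes of balls *)

Section box_measure.
Context (R : realType).

Lemma cons_rV_box N t (y : 'rV[R]_N) (a : 'rV[R]_N.+1) (r : R) :
  (forall j, `|cons_rV (t, y) 0 j - a 0 j| < r) <->
  `|t - a 0 0| < r /\ forall j, `|y 0 j - rsubmx (a : 'rV_(1 + N)) 0 j| < r.
Proof.
have E0 : (0 : 'I_N.+1) = lshift N (0 : 'I_1) by exact/val_inj.
split=> [h|[h0 h] i].
  split; first by have := h 0; rewrite {1}E0 /cons_rV (@row_mxEl _ 1 1 N) mxE eqxx mulr1n.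
  by move=> j; have := h (rshift 1 j); rewrite /cons_rV (@row_mxEr _ 1 1 N) mxE.
rewrite /cons_rV; case: (@split_ordP 1 N i) => j ->.
  by rewrite (@row_mxEl _ 1 1 N) mxE (ord1 j) eqxx mulr1n -E0.
by rewrite (@row_mxEr _ 1 1 N); have := h j; rewrite mxE.
Qed.

(** Finite and positive volumes make bounded functions integrable and smooth bumps
    normalisable. *)
Lemma borel_lebesgue_box N (a : 'rV[R]_N) (r : R) : 0 < r ->
  (0 < borel_lebesgue R N [set x | forall j, (`|x 0 j - a 0 j| < r)%R] < +oo)%E.
Proof.
move=> r0; elim: N a => [|N IH] a.
  rewrite /= diracE mem_set ?lte01 ?ltry//=.
  by case.
rewrite /= /lebesgue_step /pushforward.
pose B : set 'rV[R]_N := [set y | forall j, `|y 0 j - rsubmx (a : 'rV_(1 + N)) 0 j| < r].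
have -> : (@cons_rV R N) @^-1` [set x | forall j, `|x 0 j - a 0 j| < r] =
    (ball (a 0 0) r : set (measurableTypeR R)) `*` B.
  apply/seteqP; split => -[t y] /=.
    by move=> /cons_rV_box[h1 h2]; split => //=; rewrite /ball/= distrC.
  by move=> [h1 h2]; apply/cons_rV_box; split => //; rewrite distrC.
rewrite product_measure1E; [|exact: measurable_ball|exact: measurable_box].
rewrite [X in (X * _)%E](_ : _ = (r *+ 2)%:E); last exact: (lebesgue_measure_ball _ (ltW r0)).
have /andP[h1 h2] := IH (rsubmx (a : 'rV_(1 + N))).
rewrite mule_gt0//= ?lte_fin ?mulrn_wgt0//.
by rewrite lte_mul_pinfty// ?lee_fin ?mulrn_wge0 ?ltW// h2.
Qed.

Lemma lebesgue_rV_ball N (a : 'rV[R]_N) (r : R) : 0 < r ->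
  (0 < lebesgue_rV R N (ball a r) < +oo)%E.
Proof.
move=> r0.
have -> : ball a r = [set x | forall j, `|x 0 j - a 0 j| < r].
  apply/seteqP; split => x; rewrite -ball_normE /ball_/=.
    by move=> /mx_norm_ltP - /(_ r0) h j; have := h j; rewrite !mxE distrC.
  by move=> h; apply/mx_norm_ltP => // j; rewrite !mxE distrC.
rewrite lebesgue_rVE; first exact: borel_lebesgue_box.
exact: measurable_box.
Qed.

End box_measure.

(** * Compactly supported functions and their integrals *)

Section compact_support.
Context (R : realType) (N : nat).
Local Notation V := 'rV[R]_N.
Local Notation lambda := (lebesgue_rV R N).
Implicit Types (F G : V -> R) (a x h : V).

Definition bounded_support F := exists B : R, forall x, B < `|x| -> F x = 0.

Definition Cc F := continuous F /\ bounded_support F.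

Definition C1c F := [/\ forall x, differentiable F x,
  forall k, continuous (partial k F) & bounded_support F].

Definition integral_rV F : R := \int[lambda]_x F x.

Lemma bounded_supportW F : bounded_support F ->
  exists2 B : R, 0 < B & forall x, B < `|x| -> F x = 0.
Proof.
move=> [B hB]; exists (`|B| + 1); first by rewrite ltr_wpDl.
move=> x hx; apply: hB; apply: le_lt_trans hx.
by rewrite (le_trans (ler_norm _))// lerDl.
Qed.

Lemma bounded_supportM F G : bounded_support F -> bounded_support (fun x => F x * G x).
Proof. by move=> [B hB]; exists B => x /hB ->; rewrite mul0r. Qed.

Lemma bounded_supportMr F G : bounded_support F -> bounded_support (fun x => G x * F x).
Proof. by move=> [B hB]; exists B => x /hB ->; rewrite mulr0. Qed.

Lemma bounded_supportD F G : bounded_support F -> bounded_support G ->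
  bounded_support (fun x => F x + G x).
Proof.
move=> /bounded_supportW[A A0 hA] /bounded_supportW[B B0 hB]; exists (A + B) => x hx.
by rewrite hA ?hB ?addr0//; lra.
Qed.

Lemma Cc_bounded F : Cc F -> exists2 M : R, 0 < M & forall x, `|F x| <= M.
Proof.
move=> [cF /bounded_supportW[B B0 hB]].
have cA : compact [set x : V | `|x| <= B].
  apply: bounded_closed_compact.
    by exists B; split; [exact: num_real|move=> M BM x /= /le_trans; apply; exact: ltW].
  have -> : [set x : V | `|x| <= B] = (fun x : V => `|x|) @^-1` [set t | t <= B] by [].
  by apply: preimage_closed; [move=> y _; exact: norm_continuous|exact: closed_le].
have A0 : [set x : V | `|x| <= B] !=set0 by exists 0; rewrite /= normr0 ltW.
have cnF : {within [set x : V | `|x| <= B], continuous (fun x => `|F x|)}.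
  apply: continuous_subspaceT => x.
  by apply: continuous_comp; [exact: cF|exact: norm_continuous].
have [c _ hc] := EVT_max_rV A0 cA cnF.
exists (`|F c| + 1); first by rewrite ltr_wpDl.
move=> x; have [xB|Bx] := leP `|x| B.
  by rewrite (le_trans (hc x _)) ?lerDl// inE.
by rewrite hB// normr0 addr_ge0.
Qed.

Lemma Lebesgue_measurable_ball (a : V) (r : R) : Lebesgue_measurable (ball a r).
Proof. by apply: borel_Lebesgue_measurable; apply: open_measurable_rV; exact: ball_open. Qed.

Lemma bounded_integrable F (M B : R) : 0 < B ->
  measurable_fun [set: lebesgueType R N] (F : lebesgueType R N -> measurableTypeR R) ->
  (forall x, `|F x| <= M) -> (forall x, B < `|x| -> F x = 0) ->
  lambda.-integrable setT (EFin \o F).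
Proof.
move=> B0 mF FM FB.
have mb := Lebesgue_measurable_ball (0 : V) (B + 1).
have ig : lambda.-integrable setT
    (fun x : lebesgueType R N => M%:E * (\1_(ball (0 : V) (B + 1)) x)%:E)%E.
  apply: integrableZl => //.
  apply/integrableP; split; first by apply/measurable_EFinP; exact: measurable_indic.
  under eq_integral do rewrite gee0_abs ?lee_fin//.
  rewrite integral_indic// setIT.
  by have /andP[] := @lebesgue_rV_ball R N 0 (B + 1) (ltr_wpDl (ltW B0) ltr01).
apply: (le_integrable measurableT _ _ ig); first exact/measurable_EFinP.
move=> x _; rewrite /= lee_fin indicE.
have [xb|xb] := boolP (x \in _).
  by rewrite mulr1 (le_trans (FM x))// ler_norm.
rewrite mulr0 normr0 FB ?normr0//.
move: xb; rewrite notin_setE /= -ball_normE /ball_/= sub0r normrN => /negP.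
by rewrite -leNgt; apply: lt_le_trans; rewrite ltrDl.
Qed.

Lemma Cc_integrable F : Cc F -> lambda.-integrable setT (EFin \o F).
Proof.
move=> cF; have [M _ FM] := Cc_bounded cF; have [B B0 FB] := bounded_supportW cF.2.
by apply: (bounded_integrable B0 _ FM FB); apply: continuous_Lebesgue_measurable_fun; case: cF.
Qed.

Lemma Cc_integralE F : Cc F -> (\int[lambda]_x (F x)%:E = (integral_rV F)%:E)%E.
Proof. by move=> /Cc_integrable iF; rewrite /integral_rV fineK//; exact: integrable_fin_num. Qed.

Lemma CcD F G : Cc F -> Cc G -> Cc (fun x => F x + G x).
Proof.
move=> [cF bF] [cG bG]; split; last exact: bounded_supportD.
by move=> x; apply: continuousD; [exact: cF|exact: cG].
Qed.

Lemma CcMl F G : continuous G -> Cc F -> Cc (fun x => G x * F x).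
Proof.
move=> cG [cF bF]; split; last exact: bounded_supportMr.
by move=> x; apply: continuousM; [exact: cG|exact: cF].
Qed.

Lemma CcMr F G : continuous G -> Cc F -> Cc (fun x => F x * G x).
Proof.
move=> cG [cF bF]; split; last exact: bounded_supportM.
by move=> x; apply: continuousM; [exact: cF|exact: cG].
Qed.

Lemma CcZ F (c : R) : Cc F -> Cc (fun x => c * F x).
Proof. by apply: CcMl => x; exact: cst_continuous. Qed.

Lemma CcN F : Cc F -> Cc (fun x => - F x).
Proof. by move=> /(CcZ (-1)); under eq_fun do rewrite mulN1r. Qed.

Lemma CcB F G : Cc F -> Cc G -> Cc (fun x => F x - G x).
Proof. by move=> cF /CcN; exact: CcD. Qed.

Lemma Cc0 : Cc (fun=> 0).
Proof. by split; [move=> x; exact: cst_continuous|exists 0]. Qed.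

Lemma Cc_sum (I : Type) (s : seq I) (P : pred I) (F : I -> V -> R) :
  (forall i, P i -> Cc (F i)) -> Cc (fun x => \sum_(i <- s | P i) F i x).
Proof.
move=> h; elim: s => [|i s IH].
  by under eq_fun do rewrite big_nil; exact: Cc0.
under eq_fun do rewrite big_cons.
case Pi : (P i) => //; exact: CcD (h _ Pi) IH.
Qed.

Lemma Cc_norm F : Cc F -> Cc (fun x => `|F x|).
Proof.
move=> [cF [B hB]]; split.
  by move=> x; apply: continuous_comp; [exact: cF|exact: norm_continuous].
by exists B => x /hB ->; rewrite normr0.
Qed.

Lemma continuous_shift (a : V) : continuous (fun x : V => x + a).
Proof. by move=> x; apply: continuousD; [exact: id|exact: cst_continuous]. Qed.

Lemma Cc_shift F (a : V) : Cc F -> Cc (fun x => F (x + a)).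
Proof.
move=> [cF [B hB]]; split.
  by move=> x; apply: (continuous_comp (@continuous_shift a x)); exact: cF.
exists (B + `|a|) => x hx; apply: hB.
have := ler_normD (x + a) (- a); rewrite addrK normrN; lra.
Qed.

Lemma integral_rVD F G : Cc F -> Cc G ->
  integral_rV (fun x => F x + G x) = integral_rV F + integral_rV G.
Proof. by move=> cF cG; rewrite /integral_rV RintegralD//; exact: Cc_integrable. Qed.

Lemma integral_rVZ F (c : R) : Cc F -> integral_rV (fun x => c * F x) = c * integral_rV F.
Proof. by move=> cF; rewrite /integral_rV RintegralZl//; exact: Cc_integrable. Qed.

Lemma integral_rVN F : Cc F -> integral_rV (fun x => - F x) = - integral_rV F.
Proof. by move=> cF; rewrite -[RHS]mulN1r -integral_rVZ//; under [in RHS]eq_fun do rewrite mulN1r. Qed.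

Lemma integral_rVB F G : Cc F -> Cc G ->
  integral_rV (fun x => F x - G x) = integral_rV F - integral_rV G.
Proof. by move=> cF cG; rewrite integral_rVD ?integral_rVN//; exact: CcN. Qed.

Lemma integral_rV0 : integral_rV (fun=> 0) = 0.
Proof. by rewrite /integral_rV /Rintegral integral0. Qed.

Lemma integral_rV_sum (I : Type) (s : seq I) (P : pred I) (F : I -> V -> R) :
  (forall i, P i -> Cc (F i)) ->
  integral_rV (fun x => \sum_(i <- s | P i) F i x) = \sum_(i <- s | P i) integral_rV (F i).
Proof.
move=> h; elim: s => [|i s IH].
  by under eq_fun do rewrite big_nil; rewrite big_nil integral_rV0.
under eq_fun do rewrite big_cons; rewrite big_cons.
case Pi : (P i) => //; rewrite integral_rVD ?IH//; [exact: h|exact: Cc_sum].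
Qed.

Lemma le_integral_rV F G : Cc F -> Cc G -> (forall x, F x <= G x) ->
  integral_rV F <= integral_rV G.
Proof.
move=> cF cG FG; rewrite /integral_rV.
by apply: le_Rintegral => //; exact: Cc_integrable.
Qed.

Lemma integral_rV_ge0 F : (forall x, 0 <= F x) -> 0 <= integral_rV F.
Proof. by move=> F0; apply: Rintegral_ge0. Qed.

Lemma norm_integral_rV F : Cc F -> `|integral_rV F| <= integral_rV (fun x => `|F x|).
Proof. by move=> cF; apply: le_normr_Rintegral => //; exact: Cc_integrable. Qed.

Lemma integral_rV_shift F a : Cc F -> integral_rV (fun x => F (x + a)) = integral_rV F.
Proof.
move=> [cF bF]; rewrite /integral_rV /Rintegral; congr fine.
have mF : measurable_fun [set: V] (EFin \o F).
  by apply/measurable_EFinP; exact: continuous_measurable_rV.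
rewrite integralE [RHS]integralE; congr (_ - _)%E.
  rewrite -[RHS](ge0_integral_lebesgue_rV_shift a (f := funepos (EFin \o F))).
  - by apply: eq_integral => x _; rewrite !funeposE.
  - exact: (measurable_funepos mF).
  - by move=> x; exact: funepos_ge0.
rewrite -[RHS](ge0_integral_lebesgue_rV_shift a (f := funeneg (EFin \o F))).
- by apply: eq_integral => x _; rewrite !funenegE.
- exact: (measurable_funeneg mF).
- by move=> x; exact: funeneg_ge0.
Qed.

(** Dominated convergence, where the bound is a multiple of the indicator of a ball. *)
Lemma integral_rV_cvg (f : nat -> V -> R) F (M B : R) : 0 < B ->
  (forall n, continuous (f n)) -> continuous F ->
  (forall n x, `|f n x| <= M) -> (forall n x, B < `|x| -> f n x = 0) ->
  (forall x, f ^~ x @ \oo --> F x) ->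
  (fun n => integral_rV (f n)) @ \oo --> integral_rV F.
Proof.
move=> B0 cf cF fM fB fF.
have mb := Lebesgue_measurable_ball (0 : V) (B + 1).
pose g : V -> R := fun x => M * \1_(ball (0 : V) (B + 1)) x.
have fg n x : `|f n x| <= g x.
  rewrite /g indicE; have [xb|xb] := boolP (x \in _); first by rewrite mulr1.
  rewrite mulr0 fB ?normr0//.
  move: xb; rewrite notin_setE /= -ball_normE /ball_/= sub0r normrN => /negP.
  by rewrite -leNgt; apply: lt_le_trans; rewrite ltrDl.
have M0 : 0 <= M by exact: le_trans (fM 0%N 0).
have ig : lambda.-integrable setT (EFin \o g).
  apply: (@bounded_integrable g M (B + 1)).
  - by rewrite addr_gt0.
  - by apply: measurable_funM => //; exact: measurable_indic.
  - by move=> x; rewrite /g indicE; case: (_ \in _); rewrite ?mulr1 ?mulr0 ?normr0// ger0_norm.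
  - move=> x hx; rewrite /g indicE memNset ?mulr0//= -ball_normE /ball_/= sub0r normrN.
    by move=> /(lt_trans hx); rewrite ltxx.
have mE (G : V -> R) (cG : continuous G) :
    measurable_fun [set: lebesgueType R N] (fun x : lebesgueType R N => (G x)%:E).
  by apply/measurable_EFinP; exact: continuous_Lebesgue_measurable_fun.
have fF' : {ae lambda, forall x, setT x -> (f n x)%:E @[n --> \oo] --> (F x)%:E}.
  by apply: aeW => x _; apply: cvg_EFin; [exact: nearW|exact: fF].
have fg' : {ae lambda, forall x n, setT x -> (`|(f n x)%:E| <= (EFin \o g) x)%E}.
  by apply: aeW => x n _; rewrite lee_fin.
have [_ _] := @dominated_convergence _ _ _ lambda _ measurableT
  (fun n x => (f n x)%:E) (EFin \o F) (EFin \o g)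
  (fun n => mE _ (cf n)) (mE _ cF) fF' ig fg'.
have cF' : Cc F.
  split => //; exists B => x hx; apply: (cvg_unique _ (fF x)); first exact: norm_hausdorff.
  by rewrite /= (_ : f ^~ x = cst 0); [exact: cvg_cst|apply/funext => n; exact: fB].
rewrite /= (Cc_integralE cF') => /fine_cvg.
exact.
Qed.

Lemma is_derive_line F x h (t : R) : (forall y, differentiable F y) ->
  is_derive t 1 (fun s => F (x + s *: h)) (\sum_k h 0 k * partial k F (x + t *: h)).
Proof.
move=> dF.
have dl : is_diff t (fun s : R => x + s *: h) (fun s : R => 0 + s *: h).
  exact: is_diffD.
have dc := is_diff_comp dl (differentiableP (dF (x + t *: h))).
have dd : differentiable (fun s : R => F (x + s *: h)) t by case: dc.
apply: DeriveDef; first by apply: diff_derivable.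
case: (dc) => _ dv; rewrite deriveE// dv /= scale1r add0r.
rewrite [X in 'd _ _ X](row_sum_delta h) linear_sum; apply: eq_bigr => k _.
by rewrite linearZ /partial /= deriveE.
Qed.

Lemma mean_value_rV F x h : (forall y, differentiable F y) ->
  exists2 t : R, 0 <= t <= 1 & F (x + h) - F x = \sum_k h 0 k * partial k F (x + t *: h).
Proof.
move=> dF.
have [|||c] := @MVT_segment R (fun s => F (x + s *: h))
   (fun t => \sum_k h 0 k * partial k F (x + t *: h)) 0 1 => //.
- by move=> t _; exact: is_derive_line.
- apply: continuous_subspaceT => t; apply: differentiable_continuous.
  by apply/derivable1_diffP; apply: ex_derive; exact: is_derive_line.
rewrite in_itv/= scale1r scale0r addr0 subr0 mulr1 => hc ->.
by exists c.
Qed.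

Lemma lipschitz_partial F (C : R) x h : (forall y, differentiable F y) ->
  (forall k y, `|partial k F y| <= C) -> `|F (x + h) - F x| <= C * \sum_k `|h 0 k|.
Proof.
move=> dF bC; have [t _ ->] := mean_value_rV x h dF.
rewrite (le_trans (ler_norm_sum _ _ _))// mulr_sumr; apply: ler_sum => k _.
by rewrite normrM mulrC ler_wpM2r.
Qed.

Lemma partial_support F k (B : R) : (forall x, B < `|x| -> F x = 0) ->
  forall x, B < `|x| -> partial k F x = 0.
Proof.
move=> hB x Bx; rewrite /partial.
have -> : 'D_(delta_mx 0 k) F x = 'D_(delta_mx 0 k) (cst 0) x.
  apply: near_eq_derive.
  have : nbhs x [set y : V | B < `|y|].
    apply: open_nbhs_nbhs; split => //.
    have -> : [set y : V | B < `|y|] = (fun y : V => `|y|) @^-1` [set t | B < t] by [].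
    by apply: open_comp; [move=> y _; exact: norm_continuous|exact: open_gt].
  by apply: filterS => y /hB.
exact: derive_cst.
Qed.

Lemma C1c_Cc F : C1c F -> Cc F.
Proof. by move=> [dF _ bF]; split => // x; exact: differentiable_continuous. Qed.

Lemma C1c_partial F k : C1c F -> Cc (partial k F).
Proof.
move=> [dF cF [B hB]]; split; first exact: cF.
by exists B; exact: partial_support.
Qed.

Lemma C1c_bound F : C1c F -> exists2 C : R, 0 < C & forall k x, `|partial k F x| <= C.
Proof.
move=> c1F.
have hM k := Cc_bounded (C1c_partial k c1F).
pose C k := projT1 (cid2 (hM k)).
have hC k : 0 < C k /\ forall x, `|partial k F x| <= C k by rewrite /C; case: cid2.
exists (1 + \sum_k C k).
  by rewrite ltr_pwDl// sumr_ge0// => k _; apply: ltW; exact: (hC k).1.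
move=> k x; rewrite (le_trans ((hC k).2 x))// (bigD1 k)//= addrCA lerDl addr_ge0//.
by rewrite sumr_ge0// => i _; apply: ltW; exact: (hC i).1.
Qed.

(** The difference quotients of F integrate to zero by translation invariance,
    and they converge boundedly to the partial derivative. *)
Lemma integral_partial F k : C1c F -> integral_rV (partial k F) = 0.
Proof.
move=> c1F; have [dF cF bF] := c1F.
have [C C0 hC] := C1c_bound c1F; have [B B0 hB] := bounded_supportW bF.
pose e : V := delta_mx 0 k.
pose h n : R := n.+1%:R^-1.
have h0 n : 0 < h n by rewrite invr_gt0.
have h1 n : h n <= 1 by rewrite invf_le1// ler1n.
have ne (t : R) : `|t *: e| <= `|t|.
  apply/mx_norm_leP => // j; rewrite !mxE /=.
  by case: (_ == _); rewrite ?mulr1 ?mulr0 ?normr0.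
pose D n x := (h n)^-1 * (F (x + h n *: e) - F x).
have CD n : Cc (D n).
  by apply/CcZ/CcB; [apply: Cc_shift|]; exact: C1c_Cc.
have lim : (fun n => integral_rV (D n)) @ \oo --> integral_rV (partial k F).
  apply: (@integral_rV_cvg _ _ C (B + 1)).
  - by rewrite addr_gt0.
  - by move=> n; case: (CD n).
  - exact: cF.
  - move=> n x; rewrite /D normrM ger0_norm ?invr_ge0 ?(ltW (h0 n))//.
    rewrite ler_pdivrMl// mulrC.
    rewrite (le_trans (lipschitz_partial _ _ dF hC))// ler_pM2l//.
    rewrite (bigD1 k)//= big1 => [|j /negPf jk]; rewrite !mxE /= ?eqxx ?jk ?mulr1 ?mulr0 ?normr0//.
    by rewrite addr0 ger0_norm// ltW.
  - move=> n x Bx; rewrite /D !hB ?subrr ?mulr0//; first by lra.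
    have := ler_normD (x + h n *: e) (- (h n *: e)); rewrite addrK normrN.
    have := ne (h n); have := h1 n; rewrite (ger0_norm (ltW (h0 n))); lra.
  - move=> x; have := @diff_derivable _ _ _ _ _ e (dF x); rewrite /derivable => /cvg_ex[l].
    move=> hl; have -> : partial k F x = l by rewrite /partial; exact: cvg_lim.
    have /cvg_at_rightP := cvg_dnbhs_at_right hl.
    move=> H; have {H} := H h (conj h0 (@cvg_harmonic R)).
    apply: cvg_trans; apply: near_eq_cvg; apply: nearW => n.
    by rewrite /D /= [h n *: e + x]addrC.
have I0 n : integral_rV (D n) = 0.
  rewrite /D integral_rVZ; last by apply: CcB; [apply: Cc_shift|]; exact: C1c_Cc.
  rewrite integral_rVB ?integral_rV_shift ?subrr ?mulr0//; [|apply: Cc_shift|];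
    exact: C1c_Cc.
apply: (cvg_unique _ lim) => //.
by rewrite /= (_ : (fun n => _) = cst 0); [exact: cvg_cst|exact/funext].
Qed.

End compact_support.

(** * Calculus of smooth functions *)

Section smooth_calculus.
Context (R : realType) (N : nat).
Local Notation V := 'rV[R]_N.
Implicit Types (F G : V -> R) (x h : V).

(** Smoothness truncated at order m: the rules of calculus follow by induction
    on m, since they express derivatives of order m + 1 by those of order m. *)
Definition Csm (m : nat) F : Prop :=
  forall (s : seq 'I_N) (x : V), (size s <= m)%N -> differentiable (foldr (@partial R N) F s) x.

Lemma smooth_Csm F : smooth F <-> forall m, Csm m F.
Proof. by split=> [sF m s x _|h s x]; [exact: sF|exact: (h (size s))]. Qed.

Lemma Csm0 F : Csm 0 F <-> forall x, differentiable F x.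
Proof. by split => [h x|h [|//] x _]; [exact: (h [::])|exact: h]. Qed.

Lemma CsmS m F : Csm m.+1 F <->
  (forall x, differentiable F x) /\ forall j, Csm m (partial j F).
Proof.
split=> [h|[h0 h] s x].
  split => [x|j s x sm]; first exact: (h [::]).
  by have := h (rcons s j) x; rewrite foldr_rcons size_rcons; exact.
case/lastP: s => [_|s j]; first exact: h0.
by rewrite size_rcons foldr_rcons => sm; exact: h.
Qed.

Lemma CsmW m F : Csm m.+1 F -> Csm m F.
Proof. by move=> h s x sm; apply: h; exact: leqW. Qed.

Lemma partialD j F G : (forall x, differentiable F x) -> (forall x, differentiable G x) ->
  partial j (fun x => F x + G x) = fun x => partial j F x + partial j G x.
Proof.
by move=> dF dG; apply/funext => x; rewrite /partial deriveD//; exact: diff_derivable.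
Qed.

Lemma partialN j F : (forall x, differentiable F x) ->
  partial j (fun x => - F x) = fun x => - partial j F x.
Proof.
by move=> dF; apply/funext => x; rewrite /partial deriveN//; exact: diff_derivable.
Qed.

Lemma partialM_pt j F G x : differentiable F x -> differentiable G x ->
  partial j (fun x => F x * G x) x = partial j F x * G x + F x * partial j G x.
Proof.
move=> dF dG; rewrite /partial deriveM; [|exact: diff_derivable..].
by rewrite addrC /GRing.scale/= [G x * _]mulrC.
Qed.

Lemma partialM j F G : (forall x, differentiable F x) -> (forall x, differentiable G x) ->
  partial j (fun x => F x * G x) = fun x => partial j F x * G x + F x * partial j G x.
Proof. by move=> dF dG; apply/funext => x; exact: partialM_pt. Qed.

Lemma partial_cst j (c : R) : partial j (cst c : V -> R) = (fun=> 0).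
Proof. by apply/funext => x; rewrite /partial derive_cst. Qed.

Lemma differentiable_comp1 F (g : R -> R) (d : R) x : differentiable F x ->
  is_derive (F x) 1 g d -> differentiable (fun x => g (F x)) x.
Proof.
move=> dF [dg1 dg2].
by apply: (@differentiable_comp _ _ _ _ F g) => //; exact/derivable1_diffP.
Qed.

Lemma partial_comp j F (g dg : R -> R) x : differentiable F x ->
  is_derive (F x) 1 g (dg (F x)) ->
  differentiable (fun x => g (F x)) x /\
  partial j (fun x => g (F x)) x = dg (F x) * partial j F x.
Proof.
move=> dF [dg1 dg2].
have dgx : differentiable g (F x) by exact/derivable1_diffP.
split; first exact: (@differentiable_comp _ _ _ _ F g).
rewrite /partial deriveE; last exact: (@differentiable_comp _ _ _ _ F g).
rewrite (@diff_comp _ _ _ _ F g)//= deriv1E// deriveE//.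
by rewrite derive1E dg2 /GRing.scale/= mulrC.
Qed.

Lemma Csm_cst m (c : R) : Csm m (fun=> c).
Proof.
elim: m c => [|m IH] c; first by apply/Csm0 => x; exact: differentiable_cst.
apply/CsmS; split => [x|j]; first exact: differentiable_cst.
by rewrite partial_cst; exact: IH.
Qed.

Lemma CsmD m F G : Csm m F -> Csm m G -> Csm m (fun x => F x + G x).
Proof.
elim: m F G => [|m IH] F G.
  by move=> /Csm0 dF /Csm0 dG; apply/Csm0 => x; exact: differentiableD.
move=> /CsmS[dF hF] /CsmS[dG hG]; apply/CsmS; split => [x|j].
  exact: differentiableD.
by rewrite partialD//; exact: IH.
Qed.

Lemma CsmM m F G : Csm m F -> Csm m G -> Csm m (fun x => F x * G x).
Proof.
elim: m F G => [|m IH] F G.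
  by move=> /Csm0 dF /Csm0 dG; apply/Csm0 => x; exact: differentiableM.
move=> cF cG; have /CsmS[dF hF] := cF; have /CsmS[dG hG] := cG.
apply/CsmS; split => [x|j]; first exact: differentiableM.
by rewrite partialM//; apply: CsmD; apply: IH => //; exact: CsmW.
Qed.

(** The functions g n are the successive derivatives of g 0, so that the chain rule
    does not leave the family. *)
Lemma Csm_comp m F (g : nat -> R -> R) (D : set R) : (forall x, D (F x)) ->
  (forall n t, D t -> is_derive t 1 (g n) (g n.+1 t)) ->
  Csm m F -> forall n, Csm m (fun x => g n (F x)).
Proof.
move=> FD gD; elim: m => [|m IH] cF n.
  move/Csm0 : cF => dF; apply/Csm0 => x.
  exact: differentiable_comp1 (dF x) (gD n _ (FD x)).
have /CsmS[dF hF] := cF.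
have E j x := @partial_comp j F (g n) (g n.+1) x (dF x) (gD n _ (FD x)).
apply/CsmS; split => [x|j].
  exact: differentiable_comp1 (dF x) (gD n _ (FD x)).
rewrite (_ : partial j _ = fun x => g n.+1 (F x) * partial j F x).
  by apply: CsmM => //; apply: IH; exact: CsmW.
by apply/funext => x; have [] := E j x.
Qed.

Lemma Csm_powR m F (a : R) : (forall x, 0 < F x) -> Csm m F ->
  Csm m (fun x => F x `^ a).
Proof.
move=> F0 cF.
pose c n := \prod_(i < n) (a - i%:R).
have := @Csm_comp m F (fun n t => c n * t `^ (a - n%:R)) [set t | 0 < t] F0 _ cF 0%N.
rewrite /c big_ord0 /= subr0; under eq_fun do rewrite mul1r; apply.
move=> n t /= t0.
have dt : is_derive t 1 (fun t => t `^ (a - n%:R)) ((a - n%:R) * t `^ (a - n%:R - 1)).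
  apply: DeriveDef; first by apply: derivable_powR; rewrite in_itv/= t0.
  by rewrite -derive1E powR_derive1// in_itv/= t0.
have := @is_deriveZ _ _ _ _ (c n) _ _ _ dt.
rewrite /GRing.scale/= /c big_ord_recr/= -mulrA -natr1 opprD addrA.
exact.
Qed.

Lemma partial_coord k j (x : V) :
  partial k (fun x : V => x 0 j) x = (delta_mx 0 k : V) 0 j.
Proof.
rewrite /partial /derive; apply: cvg_lim => //; apply: cvg_near_cst; near=> t.
have t0 : t != 0 by near: t; exact: nbhs_dnbhs_neq.
by rewrite /= ![fun_of_matrix _ _ _]mxE addrK /GRing.scale/= mulKf.
Unshelve. all: by end_near.
Qed.

Lemma Csm_coord m j : Csm m (fun x : V => x 0 j).
Proof.
have dc x : differentiable (fun x : V => x 0 j) x by exact: differentiable_coord.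
case: m => [|m]; first exact/Csm0.
apply/CsmS; split => // k.
rewrite (_ : partial k _ = fun=> (delta_mx 0 k : V) 0 j); first exact: Csm_cst.
by apply/funext => x; exact: partial_coord.
Qed.

Lemma Csm_sum m (I : Type) (s : seq I) (f : I -> V -> R) :
  (forall i, Csm m (f i)) -> Csm m (fun x => \sum_(i <- s) f i x).
Proof.
move=> h; elim: s => [|i s IH].
  by under eq_fun do rewrite big_nil; exact: Csm_cst.
by under eq_fun do rewrite big_cons; exact: CsmD.
Qed.

Lemma smooth_partial F j : smooth F -> smooth (partial j F).
Proof. by move=> /smooth_Csm h; apply/smooth_Csm => m; have /CsmS[_] := h m.+1; exact. Qed.

Lemma smoothM F G : smooth F -> smooth G -> smooth (fun x => F x * G x).
Proof. by move=> /smooth_Csm hF /smooth_Csm hG; apply/smooth_Csm => m; exact: CsmM. Qed.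

Lemma smoothD F G : smooth F -> smooth G -> smooth (fun x => F x + G x).
Proof. by move=> /smooth_Csm hF /smooth_Csm hG; apply/smooth_Csm => m; exact: CsmD. Qed.

Lemma smooth_cst (c : R) : smooth (cst c : V -> R).
Proof. by apply/smooth_Csm => m; exact: Csm_cst. Qed.

Lemma smooth_powR F a : (forall x, 0 < F x) -> smooth F -> smooth (fun x => F x `^ a).
Proof. by move=> F0 /smooth_Csm hF; apply/smooth_Csm => m; exact: Csm_powR. Qed.

Lemma smooth_differentiable F x : smooth F -> differentiable F x.
Proof. by move=> /(_ [::]). Qed.

Lemma smooth_continuous F : smooth F -> continuous F.
Proof. by move=> sF x; apply: differentiable_continuous; exact: smooth_differentiable. Qed.

Lemma smooth_C1c F : smooth F -> bounded_support F -> C1c F.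
Proof.
move=> sF bF; split => // [x|k]; first exact: smooth_differentiable.
exact/smooth_continuous/smooth_partial.
Qed.

Lemma bounded_support_partial F k : bounded_support F -> bounded_support (partial k F).
Proof. by move=> [B hB]; exists B; exact: partial_support. Qed.

End smooth_calculus.

(** * The flat function exp (- 1 / t) *)

Section flat_function.
Context (R : realType).
Implicit Types (P : {poly R}) (t u : R).

Lemma exprn_expRN_bound m : exists C : R, forall u, 0 <= u -> u ^+ m * expR (- u) <= C.
Proof.
case: m => [|m].
  by exists 1 => u u0; rewrite expr0 mul1r -expR0 ler_expR oppr_le0.
exists (m.+1%:R ^+ m.+1) => u u0.
have h : (u / m.+1%:R) ^+ m.+1 <= expR u.
  have -> : expR u = expR (u / m.+1%:R) ^+ m.+1.
    by rewrite -expRM_natl mulrC divfK.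
  rewrite lerXn2r ?nnegrE ?divr_ge0 ?expR_ge0//.
  by apply: le_trans (expR_ge1Dx _); rewrite lerDr.
rewrite expRN ler_pdivrMr ?expR_gt0//.
move: h; rewrite expr_div_n ler_pdivrMr ?exprn_gt0// mulrC.
by [].
Qed.

(** With u = 1 / t, this is the flatness at 0 of P (1 / t) exp (- 1 / t). *)
Lemma poly_expRN_bound P m : exists C : R,
  forall u, 0 <= u -> `|u ^+ m * P.[u] * expR (- u)| <= C.
Proof.
elim/poly_ind: P m => [|P c IH] m.
  by exists 0 => u _; rewrite horner0 mulr0 mul0r normr0.
have [C hC] := IH m.+1; have [D hD] := exprn_expRN_bound m.
exists (C + `|c| * D) => u u0.
rewrite hornerMXaddC.
have -> : u ^+ m * (P.[u] * u + c) * expR (- u) =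
  u ^+ m.+1 * P.[u] * expR (- u) + c * (u ^+ m * expR (- u)) by rewrite exprS; ring.
rewrite (le_trans (ler_normD _ _))// lerD ?hC// normrM ler_wpM2l//.
by rewrite ger0_norm ?hD// mulr_ge0 ?exprn_ge0 ?expR_ge0.
Qed.

(** The derivatives of t |-> exp (- 1 / t), extended by 0, are all of this form. *)
Definition flat P t : R := if 0 < t then P.[t^-1] * expR (- t^-1) else 0.

Lemma is_derive_flat P t : is_derive t 1 (flat P) (flat ('X^2 * (P - P^`())) t).
Proof.
case: (ltgtP t 0) => [t0|t0|->].
- have -> : flat ('X^2 * (P - P^`())) t = 0 by rewrite /flat ltNge ltW.
  have d0 : is_derive t (1 : R) (cst (0 : R) : R -> R) 0 by exact: is_derive_cst.
  apply: near_eq_is_derive d0; near=> s; rewrite /flat ltNge (_ : s <= 0)//.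
  by apply: ltW; near: s; exact: lt_nbhsl.
- have tn0 : t != 0 by rewrite gt_eqF.
  suff d0 : is_derive t (1 : R) (fun s => P.[s^-1] * expR (- s^-1))
      (flat ('X^2 * (P - P^`())) t).
    apply: near_eq_is_derive d0; near=> s; rewrite /flat (_ : 0 < s)//.
    near: s; exact: lt_nbhsr.
  rewrite /flat t0 !hornerE.
  have dV : is_derive t 1 (fun s : R => s^-1) (- t ^- 2).
    have := @is_deriveV R id t 1 1 tn0 (is_derive_id _ _).
    by rewrite /GRing.scale/= mulr1.
  have dP : is_derive (t^-1) 1 (horner P) P^`().[t^-1] by exact: is_derive_poly.
  have dPV := is_derive1_comp dP dV.
  have dN := is_deriveN dV.
  have dE := @is_derive1_comp R expR (- [eta GRing.inv]) t _ _ (is_derive_expR (- t^-1)) dN.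
  have dM := is_deriveM dPV dE.
  refine (@is_derive_eq _ _ _ _ _ _ _ _ dM _).
  rewrite /GRing.scale/= opprK exprVn. ring.
(* At 0, the bound with m = 2 makes the difference quotient O (h). *)
- rewrite {2}/flat ltxx.
  have [C hC] := poly_expRN_bound P 2.
  have flat_le s : `|flat P s| <= C * s ^+ 2.
    rewrite /flat; case: ifP => [s0|_]; last first.
      rewrite normr0 mulr_ge0 ?sqr_ge0//.
      exact: le_trans (hC 0 (lexx 0)).
    have := hC s^-1; rewrite invr_ge0 => /(_ (ltW s0)) h.
    rewrite -ler_pdivrMr ?exprn_gt0//; apply: le_trans h.
    rewrite -mulrA [leRHS]normrM mulrC exprVn.
    by rewrite (ger0_norm (_ : 0 <= s ^- 2))// invr_ge0 sqr_ge0.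
  have C0 : 0 <= C by apply: le_trans (hC 0 (lexx 0)).
  have f0 : flat P 0 = 0 by rewrite /flat ltxx.
  have lim : (fun h => h^-1 *: ((flat P \o shift (0 : R)) (h *: (1 : R)) - flat P 0)) @ (0 : R)^' --> (0 : R).
    apply/cvgr0Pnorm_le => e e0; near=> h.
    have hn0 : h != 0 by near: h; exact: nbhs_dnbhs_neq.
    rewrite f0 subr0 /= addr0 /GRing.scale/= mulr1 normrM normfV ler_pdivrMl ?normr_gt0//.
    rewrite (le_trans (flat_le h))// -real_normK ?num_real// expr2 mulrA mulrC ler_wpM2l//.
    have : `|h| <= e / (C + 1).
      near: h; apply: dnbhs0_le; rewrite divr_gt0// ltr_wpDl//.
    rewrite ler_pdivlMr ?ltr_wpDl//; apply: le_trans.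
    by rewrite mulrC ler_wpM2l// lerDl.
  by apply: DeriveDef; [apply/cvg_ex; exists 0|exact: cvg_lim].
Unshelve. all: by end_near.
Qed.

End flat_function.

(** * Continuity of pointwise operations *)

Section pointwise_continuity.
Context (R : realType) (T : topologicalType).
Implicit Types (F G : T -> R).

Lemma continuous_add F G : continuous F -> continuous G -> continuous (fun x => F x + G x).
Proof. by move=> cF cG x; apply: continuousD; [exact: cF|exact: cG]. Qed.

Lemma continuous_mul F G : continuous F -> continuous G -> continuous (fun x => F x * G x).
Proof. by move=> cF cG x; apply: continuousM; [exact: cF|exact: cG]. Qed.

Lemma continuous_const (c : R) : continuous (fun _ : T => c).
Proof. by move=> x; exact: cst_continuous. Qed.

Lemma continuous_opp F : continuous F -> continuous (fun x => - F x).
Proof. by move=> cF x; apply: continuousN; exact: cF. Qed.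

Lemma continuous_subf F G : continuous F -> continuous G -> continuous (fun x => F x - G x).
Proof. by move=> cF cG; apply: continuous_add => //; exact: continuous_opp. Qed.

Lemma continuous_sum (I : Type) (s : seq I) (f : I -> T -> R) :
  (forall i, continuous (f i)) -> continuous (fun x => \sum_(i <- s) f i x).
Proof.
move=> h; elim: s => [|i s IH].
  by under eq_fun do rewrite big_nil; exact: continuous_const.
by under eq_fun do rewrite big_cons; exact: continuous_add.
Qed.

End pointwise_continuity.

(** * The Euclidean norm *)

Section euclidean_norm.
Context (R : realType) (N : nat).
Local Notation V := 'rV[R]_N.
Implicit Types (x y z h : V).

Lemma enorm_ge0 x : 0 <= enorm x.
Proof. exact: sqrtr_ge0. Qed.

Lemma sum_sqr_ge0 (a : 'I_N -> R) : 0 <= \sum_j a j ^+ 2.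
Proof. by apply: sumr_ge0 => j _; exact: sqr_ge0. Qed.

Lemma sqr_enorm x : enorm x ^+ 2 = \sum_j x 0 j ^+ 2.
Proof. by rewrite sqr_sqrtr// sum_sqr_ge0. Qed.

Lemma sum_sqr_lin (a b : 'I_N -> R) (B C : R) :
  \sum_j (B * a j - C * b j) ^+ 2 =
  B ^+ 2 * (\sum_j a j ^+ 2) - 2 * B * C * (\sum_j a j * b j) + C ^+ 2 * (\sum_j b j ^+ 2).
Proof. by rewrite !mulr_sumr -sumrB -big_split/=; apply: eq_bigr => j _; ring. Qed.

(** Expand the nonnegative sum of the squares of B a_j - C b_j. *)
Lemma cauchy_schwarz (a b : 'I_N -> R) :
  (\sum_j a j * b j) ^+ 2 <= (\sum_j a j ^+ 2) * (\sum_j b j ^+ 2).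
Proof.
set A := \sum_j a j ^+ 2; set B := \sum_j b j ^+ 2; set C := \sum_j _.
have B0 : 0 <= B by exact: sum_sqr_ge0.
have : 0 <= \sum_j (B * a j - C * b j) ^+ 2 by exact: sum_sqr_ge0.
rewrite sum_sqr_lin -/A -/B -/C.
have -> : B ^+ 2 * A - 2 * B * C * C + C ^+ 2 * B = B * (A * B - C ^+ 2) by ring.
have [B00|Bn0] := eqVneq B 0; last first.
  by rewrite pmulr_rge0 ?lt0r ?Bn0// subr_ge0.
have /eqP := B00; rewrite psumr_eq0 => [/allP b0 _|j _]; last exact: sqr_ge0.
suff -> : C = 0 by rewrite B00 expr0n mulr0.
rewrite /C big1// => j _.
by have := b0 j (mem_index_enum j); rewrite /= sqrf_eq0 => /eqP ->; rewrite mulr0.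
Qed.

Lemma enorm_le_sum x : enorm x <= \sum_j `|x 0 j|.
Proof.
rewrite -(@ler_pXn2r _ 2)// ?nnegrE ?enorm_ge0 ?sumr_ge0// sqr_enorm.
rewrite expr2 mulr_suml; apply: ler_sum => j _.
rewrite -real_normK ?num_real// expr2 ler_wpM2l//.
by rewrite (bigD1 j)//= lerDl sumr_ge0.
Qed.

Lemma coord_le_enorm x j : `|x 0 j| <= enorm x.
Proof.
rewrite -(@ler_pXn2r _ 2)// ?nnegrE ?enorm_ge0// sqr_enorm real_normK ?num_real//.
by rewrite (bigD1 j)//= lerDl sumr_ge0// => i _; exact: sqr_ge0.
Qed.

Lemma norm_le_enorm x : `|x| <= enorm x.
Proof. by apply/mx_norm_leP => [|j]; [exact: enorm_ge0|exact: coord_le_enorm]. Qed.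

Lemma enorm_le_norm x : enorm x <= N%:R * `|x|.
Proof.
rewrite (le_trans (enorm_le_sum x))//.
rewrite (le_trans (ler_sum _ (fun j _ => coord_le_norm x j)))//.
by rewrite sumr_const card_ord mulr_natl.
Qed.

Lemma enorm0 : enorm (0 : V) = 0.
Proof.
by apply/eqP; rewrite eq_le enorm_ge0 andbT (le_trans (enorm_le_norm _))// normr0 mulr0.
Qed.

Lemma enormZ (t : R) x : enorm (t *: x) = `|t| * enorm x.
Proof.
rewrite /enorm -sqrtr_sqr -sqrtrM ?sqr_ge0// mulr_sumr; congr Num.sqrt.
by apply: eq_bigr => j _; rewrite mxE exprMn.
Qed.

Lemma enormN x : enorm (- x) = enorm x.
Proof. by rewrite -scaleN1r enormZ normrN1 mul1r. Qed.

Lemma enormB x y : enorm (x - y) = enorm (y - x).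
Proof. by rewrite -enormN opprB. Qed.

Lemma ler_enormD x y : enorm (x + y) <= enorm x + enorm y.
Proof.
rewrite -(@ler_pXn2r _ 2)// ?nnegrE ?addr_ge0 ?enorm_ge0// sqrrD !sqr_enorm.
have h : \sum_j x 0 j * y 0 j <= enorm x * enorm y.
  apply: le_trans (ler_norm _) _.
  rewrite -(@ler_pXn2r _ 2)// ?nnegrE ?mulr_ge0 ?enorm_ge0// exprMn !sqr_enorm.
  by rewrite real_normK ?num_real// cauchy_schwarz.
have -> : \sum_j (x + y) 0 j ^+ 2 =
    \sum_j x 0 j ^+ 2 + 2 * (\sum_j x 0 j * y 0 j) + \sum_j y 0 j ^+ 2.
  by rewrite mulr_sumr -!big_split/=; apply: eq_bigr => j _; rewrite mxE; ring.
by rewrite lerD2r lerD2l -[leRHS]mulr_natl ler_wpM2l.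
Qed.

Lemma enorm_continuous : continuous (@enorm R N).
Proof.
move=> x; apply: (continuous_comp (f := fun x : V => \sum_j x 0 j ^+ 2)).
  apply: continuous_sum => j y.
  apply: (@continuous_comp _ _ _ (fun x : V => x 0 j) (fun t : R => t ^+ 2)); first exact: coord_continuous.
  exact: exprn_continuous.
exact: sqrt_continuous.
Qed.

End euclidean_norm.

(** * Convolution *)

Section convolution.
Context (R : realType) (N : nat).
Local Notation V := 'rV[R]_N.
Implicit Types (F G rho : V -> R) (x y h : V).

Definition convol F rho x : R := integral_rV (fun y => F y * rho (x - y)).

Lemma continuous_sub x : continuous (fun y : V => x - y).
Proof. by move=> y; apply: continuousB; [exact: cst_continuous|exact: id]. Qed.

Lemma continuous_compsub F x : continuous F -> continuous (fun y => F (x - y)).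
Proof. by move=> cF y; apply: (continuous_comp (@continuous_sub x y)); exact: cF. Qed.

Lemma bounded_support_sub F x : bounded_support F -> bounded_support (fun y => F (x - y)).
Proof.
move=> [B hB]; exists (B + `|x|) => y hy; apply: hB.
have := ler_normB x (x - y); rewrite subKr; lra.
Qed.

Lemma Cc_sub F x : Cc F -> Cc (fun y => F (x - y)).
Proof.
by move=> [cF bF]; split; [exact: continuous_compsub|exact: bounded_support_sub].
Qed.

Lemma C1cN F : C1c F -> C1c (fun x => - F x).
Proof.
move=> [dF cF [B hB]]; split => [x|k|]; first exact: differentiableN.
  by rewrite partialN//; exact: continuous_opp.
by exists B => x /hB ->; rewrite oppr0.
Qed.

Lemma convol_integrand_Cc F rho x : Cc F -> continuous rho -> Cc (fun y => F y * rho (x - y)).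
Proof. by move=> cF crho; apply: CcMr => //; exact: continuous_compsub. Qed.

Lemma taylor1 F (C : R) x h : (forall y, differentiable F y) ->
  (forall k y, differentiable (partial k F) y) ->
  (forall j k y, `|partial j (partial k F) y| <= C) ->
  `|F (x + h) - F x - \sum_k h 0 k * partial k F x| <= C * (\sum_k `|h 0 k|) ^+ 2.
Proof.
move=> dF ddF hC; have [t /andP[t0 t1] ->] := mean_value_rV x h dF.
rewrite -sumrB (le_trans (ler_norm_sum _ _ _))// expr2 mulrA mulr_sumr.
apply: ler_sum => k _; rewrite -mulrBr normrM mulrC ler_wpM2r//.
rewrite (le_trans (@lipschitz_partial _ _ _ C _ _ (ddF k) _))//.
have C0 : 0 <= C by exact: le_trans (normr_ge0 _) (hC k k x).
rewrite ler_wpM2l//; apply: ler_sum => j _.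
by rewrite mxE normrM ger0_norm// ler_piMl.
Qed.

Let dotp (c h : V) : R := \sum_k h 0 k * c 0 k.

Let dotp_linear c : linear (dotp c).
Proof.
move=> a u v; rewrite /dotp /GRing.scale/= mulr_sumr -big_split/=.
by apply: eq_bigr => k _; rewrite !mxE mulrDl mulrA.
Qed.

HB.instance Definition _ c := GRing.isLinear.Build R V R *:%R (dotp c) (dotp_linear c).

Let dotp_continuous c : continuous (dotp c).
Proof.
apply: continuous_sum => k.
by apply: continuous_mul; [move=> ?; exact: coord_continuous|exact: continuous_const].
Qed.

Lemma quadratic_differentiable F (c : V) (C : R) x : (forall h,
    `|F (x + h) - F x - \sum_k h 0 k * c 0 k| <= C * `|h| ^+ 2) ->
  differentiable F x /\ forall k, partial k F x = c 0 k.
Proof.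
move=> hF.
have C0 : 0 <= `|C| by [].
have near0 (e : R) : 0 < e -> \forall h \near nbhs (0 : V), `|h| <= e / (`|C| + 1).
  move=> e0; apply/nbhs_ballP; exists (e / (`|C| + 1)) => /=.
    by rewrite divr_gt0// ltr_wpDl.
  by move=> h; rewrite -ball_normE /ball_/= sub0r normrN => /ltW.
have ho : F \o shift x = cst (F x) + dotp c +o_ (0 : V) id.
  apply/eqaddoP => e e0; near=> h.
  rewrite [X in `|X|](_ : _ = F (x + h) - F x - \sum_k h 0 k * c 0 k); last first.
    by rewrite -[x + h]addrC -[RHS]addrA -opprD.
  apply: le_trans (hF h) _; rewrite expr2 mulrA ler_wpM2r//.
  have : `|h| <= e / (`|C| + 1).
    by near: h; exact: near0.
  rewrite ler_pdivlMr ?ltr_wpDl//; apply: le_trans; rewrite mulrC ler_wpM2l//.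
  by rewrite (le_trans (ler_norm C))// lerDl.
have dE := diff_unique (@dotp_continuous c) ho.
have dF : differentiable F x.
  apply/diff_locallyP; rewrite dE; split => //; exact: dotp_continuous.
split=> // k; rewrite /partial deriveE// dE /= /dotp (bigD1 k)//= big1 => [|j jk].
  by rewrite mxE !eqxx mul1r addr0.
by rewrite mxE (negPf jk) andbF mul0r.
Unshelve. all: by end_near.
Qed.

(** The Taylor remainder of the kernel is quadratic, uniformly in the base point.
    Its integral against F is then quadratic too, which gives the differential of
    the convolution without differentiating under the integral sign. *)
Lemma convol_differentiable F rho : Cc F -> C1c rho -> (forall k, C1c (partial k rho)) ->
  (forall x, differentiable (convol F rho) x) /\
  forall k, partial k (convol F rho) = convol F (partial k rho).
Proof.
move=> cF c1 c2.
have dr : forall y, differentiable rho y by case: c1.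
have ddr k : forall y, differentiable (partial k rho) y by case: (c2 k).
have [C C_ge0 hC] : exists2 C : R, 0 <= C & forall j k y, `|partial j (partial k rho) y| <= C.
  have h k := C1c_bound (c2 k).
  pose C k := projT1 (cid2 (h k)).
  have hC k : 0 < C k /\ forall j x, `|partial j (partial k rho) x| <= C k.
    by rewrite /C; case: cid2.
  exists (\sum_k C k); first by rewrite sumr_ge0// => k _; rewrite ltW// (hC k).1.
  move=> j k y; rewrite (le_trans ((hC k).2 j y))// (bigD1 k)//= lerDl.
  by rewrite sumr_ge0// => i _; rewrite ltW// (hC i).1.
have crho : continuous rho by case: (C1c_Cc c1).
have cpr k : continuous (partial k rho) by case: (C1c_Cc (c2 k)).
have key x h : `|convol F rho (x + h) - convol F rho x -
    \sum_k h 0 k * (\row_k convol F (partial k rho) x) 0 k| <=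
    (integral_rV (fun y => `|F y|) * C * N%:R ^+ 2) * `|h| ^+ 2.
  have -> : convol F rho (x + h) - convol F rho x -
      \sum_k h 0 k * (\row_k convol F (partial k rho) x) 0 k =
    integral_rV (fun y => F y * (rho (x - y + h) - rho (x - y) -
       \sum_k h 0 k * partial k rho (x - y))).
    have -> : \sum_k h 0 k * (\row_k convol F (partial k rho) x) 0 k =
        integral_rV (fun y => \sum_k h 0 k * (F y * partial k rho (x - y))).
      rewrite integral_rV_sum => [|k _]; last by apply: CcZ; exact: convol_integrand_Cc.
      by apply: eq_bigr => k _; rewrite mxE /convol integral_rVZ//; exact: convol_integrand_Cc.
    rewrite /convol -integral_rVB; [|exact: convol_integrand_Cc..].
    rewrite -integral_rVB; last 2 first.
    - by apply: CcB; exact: convol_integrand_Cc.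
    - by apply: Cc_sum => k _; apply: CcZ; exact: convol_integrand_Cc.
    congr integral_rV; apply/funext => y.
    rewrite !mulrBr mulr_sumr [x + h - y]addrAC; congr (_ - _).
    by apply: eq_bigr => k _; rewrite mulrCA.
  have -> : integral_rV (fun y => `|F y|) * C * N%:R ^+ 2 * `|h| ^+ 2 =
      integral_rV (fun y => (C * N%:R ^+ 2 * `|h| ^+ 2) * `|F y|).
    by rewrite integral_rVZ; [ring|exact: Cc_norm].
  have cc : Cc (fun y => F y * (rho (x - y + h) - rho (x - y) -
       \sum_k h 0 k * partial k rho (x - y))).
    apply: CcMr => //.
    have cc1 : continuous (fun y => rho (x - y + h)).
      have := @continuous_compsub rho (x + h) crho.
      by under eq_fun do rewrite addrAC.
    apply: continuous_subf; first by apply: continuous_subf => //; exact: continuous_compsub.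
    apply: continuous_sum => k; apply: continuous_mul; first exact: continuous_const.
    exact: continuous_compsub.
  apply: le_trans (norm_integral_rV cc) _.
  apply: le_integral_rV; [exact: Cc_norm|by apply: CcZ; exact: Cc_norm|move=> y].
  rewrite normrM [leRHS]mulrC ler_wpM2l//.
  apply: le_trans (taylor1 _ _ dr ddr hC) _; rewrite -mulrA ler_wpM2l//.
  rewrite -exprMn lerXn2r ?nnegrE ?sumr_ge0 ?mulr_ge0//.
  rewrite (le_trans (ler_sum _ (fun j _ => coord_le_norm h j)))//.
  by rewrite sumr_const card_ord mulr_natl.
split=> [x|k]; first by have [] := quadratic_differentiable (key x).
by apply/funext => x; have [_ ->] := quadratic_differentiable (key x); rewrite mxE.
Qed.

Lemma smooth_convol F rho : Cc F -> smooth rho -> bounded_support rho -> smooth (convol F rho).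
Proof.
move=> cF sr br s x.
have [rho' [sr' br' ->]] : exists rho', [/\ smooth rho', bounded_support rho' &
    foldr (@partial R N) (convol F rho) s = convol F rho'].
  elim: s => [|k s [rho' [sr' br' /= ->]]]; first by exists rho.
  exists (partial k rho'); split; [exact: smooth_partial|exact: bounded_support_partial|].
  have [|_ ->//] := @convol_differentiable F rho' cF (smooth_C1c sr' br').
  by move=> j; apply: smooth_C1c; [exact: smooth_partial|exact: bounded_support_partial].
have [|+ _] := @convol_differentiable F rho' cF (smooth_C1c sr' br'); last exact.
by move=> j; apply: smooth_C1c; [exact: smooth_partial|exact: bounded_support_partial].
Qed.

Lemma partial_convolr F rho k : Cc F -> smooth rho -> bounded_support rho ->
  partial k (convol F rho) = convol F (partial k rho).
Proof.
move=> cF sr br; have [|_ ->//] := @convol_differentiable F rho cF (smooth_C1c sr br).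
by move=> j; apply: smooth_C1c; [exact: smooth_partial|exact: bounded_support_partial].
Qed.

Lemma partial_compsub F k x y : differentiable F (x - y) ->
  differentiable (fun y => F (x - y)) y /\
  partial k (fun y => F (x - y)) y = - partial k F (x - y).
Proof.
move=> dF.
have d1 : is_diff y (fun y : V => x - y) (fun h : V => 0 - h).
  exact: is_diffB.
have dc := is_diff_comp d1 (differentiableP dF).
have dd : differentiable (fun y => F (x - y)) y by case: dc.
split => //; case: (dc) => _ dv; rewrite /partial.
rewrite [RHS](_ : _ = 'd F (x - y) (- delta_mx 0 k)).
  rewrite [LHS](deriveE _ dd).
  rewrite [LHS](congr1 (fun f : V -> R => f (delta_mx 0 k)) dv) /=.
  by rewrite sub0r.
by rewrite linearN (deriveE _ dF).
Qed.

(** Integration by parts moves the derivative from the kernel to F. *)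
Lemma partial_convoll F rho k : C1c F -> smooth rho -> bounded_support rho ->
  partial k (convol F rho) = convol (partial k F) rho.
Proof.
move=> c1F sr br; have cF := C1c_Cc c1F; have [dF cpF bF] := c1F.
rewrite partial_convolr//; apply/funext => x.
have dr y : differentiable rho y by exact: smooth_differentiable.
have ds y := (partial_compsub k (dr (x - y))).
have E : partial k (fun y => F y * rho (x - y)) =
    fun y => partial k F y * rho (x - y) - F y * partial k rho (x - y).
  by rewrite partialM => [|//|y]; [apply/funext => y; rewrite (ds y).2 mulrN|exact: (ds y).1].
have cr : continuous rho by exact: smooth_continuous.
have cpr : continuous (partial k rho) by exact/smooth_continuous/smooth_partial.
have c1 : C1c (fun y => F y * rho (x - y)).
  split; last exact: bounded_supportM.
  - by move=> y; apply: differentiableM => //; have [] := partial_compsub k (dr (x - y)).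
  - move=> j; rewrite partialM => [|//|y]; last by have [] := partial_compsub k (dr (x - y)).
    rewrite (_ : (fun x0 => _) = fun y => partial j F y * rho (x - y) - F y * partial j rho (x - y)).
      apply: continuous_subf; apply: continuous_mul.
      + exact: cpF.
      + exact: continuous_compsub.
      + exact: (cF.1).
      + by apply: continuous_compsub; exact/smooth_continuous/smooth_partial.
    by apply/funext => y; rewrite (partial_compsub j (dr (x - y))).2 mulrN.
have := integral_partial k c1; rewrite E integral_rVB; last 2 first.
- by apply: convol_integrand_Cc => //; exact: C1c_partial.
- exact: convol_integrand_Cc.
by move/eqP; rewrite subr_eq0 => /eqP.
Qed.

Lemma convol_lipschitz F rho (M : R) x a : Cc F -> Cc rho -> (forall y, 0 <= rho y) ->
  (forall y, `|F (y + a) - F y| <= M) ->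
  `|convol F rho (x + a) - convol F rho x| <= M * integral_rV (fun y => rho (x - y)).
Proof.
move=> cF cr r0 hM.
have -> : convol F rho (x + a) = integral_rV (fun y => F (y + a) * rho (x - y)).
  rewrite -(integral_rV_shift (- a) (F := fun y => F (y + a) * rho (x - y))).
    congr integral_rV; apply/funext => y; rewrite subrK; congr (_ * rho _).
    by rewrite opprB addrA addrAC.
  by apply: CcMr; [exact: continuous_compsub cr.1|exact: Cc_shift].
have c1 : Cc (fun y => F (y + a) * rho (x - y)).
  by apply: CcMr; [exact: continuous_compsub cr.1|exact: Cc_shift].
have c2 := convol_integrand_Cc x cF cr.1.
rewrite /convol -integral_rVB//.
apply: le_trans (norm_integral_rV (CcB c1 c2)) _.
rewrite -integral_rVZ; last exact: Cc_sub.
apply: le_integral_rV => [||y].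
- exact/Cc_norm/CcB.
- exact/CcZ/Cc_sub.
- by rewrite -mulrBl normrM (ger0_norm (r0 _)) ler_wpM2r.
Qed.

Lemma convol_near F rho (c M : R) x : Cc F -> Cc rho -> (forall y, 0 <= rho y) ->
  (forall y, rho (x - y) != 0 -> `|F y - c| <= M) ->
  `|convol F rho x - c * integral_rV (fun y => rho (x - y))| <=
    M * integral_rV (fun y => rho (x - y)).
Proof.
move=> cF cr r0 hM.
have cs := Cc_sub x cr; have c1 := convol_integrand_Cc x cF cr.1.
rewrite -!integral_rVZ//.
rewrite -integral_rVB//; last exact: CcZ.
apply: le_trans (norm_integral_rV (CcB c1 (CcZ c cs))) _.
apply: le_integral_rV => [||y].
- exact/Cc_norm/CcB/CcZ.
- exact/CcZ.
- rewrite -mulrBl normrM (ger0_norm (r0 _)).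
  by have [->|/hM] := eqVneq (rho (x - y)) 0; [rewrite !mulr0|exact: ler_wpM2r].
Qed.

End convolution.

(** * Mollifiers *)

Section mollifier.
Context (R : realType) (N : nat).
Local Notation V := 'rV[R]_N.
Implicit Types (F G rho : V -> R) (x y h : V).

Definition flat_poly (n : nat) : {poly R} := iter n (fun P => 'X^2 * (P - P^`())) 1.

Definition bump (d : R) : V -> R := fun x => flat 1 (d ^+ 2 - \sum_j x 0 j ^+ 2).

Lemma smooth_bump d : smooth (bump d).
Proof.
apply/smooth_Csm => m.
apply: (@Csm_comp _ _ m _ (fun n => flat (flat_poly n)) setT _ _ _ 0%N) => //.
  by move=> n t _; exact: is_derive_flat.
under eq_fun do rewrite -mulN1r.
apply: CsmD; first exact: Csm_cst.
apply: CsmM; first exact: Csm_cst.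
apply: Csm_sum => j; under eq_fun do rewrite expr2.
by apply: CsmM; exact: Csm_coord.
Qed.

Lemma bump_ge0 d x : 0 <= bump d x.
Proof.
by rewrite /bump /flat; case: ifP => // _; rewrite hornerC mul1r expR_ge0.
Qed.

Lemma bump_support d x : 0 < d -> bump d x != 0 -> enorm x < d.
Proof.
move=> d0; rewrite /bump /flat; case: ifP => [h _|]; last by rewrite eqxx.
rewrite -(@ltr_pXn2r _ 2)// ?nnegrE ?enorm_ge0 ?ltW//.
by rewrite sqr_enorm -subr_gt0.
Qed.

Lemma bounded_support_enorm F d : (forall x, F x != 0 -> enorm x <= d) -> bounded_support F.
Proof.
move=> h; exists d => x dx; apply/eqP; apply: contraT => /h.
by move=> /(le_trans (norm_le_enorm x)); rewrite leNgt dx.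
Qed.

Lemma bump_Cc d : 0 < d -> Cc (bump d).
Proof.
move=> d0; split; first exact/smooth_continuous/smooth_bump.
by apply: (@bounded_support_enorm _ d) => x /(bump_support d0)/ltW.
Qed.

Lemma integral_rV_sub F x : Cc F ->
  integral_rV (fun y => F (x - y)) = integral_rV (fun y => F (- y)).
Proof.
move=> cF; rewrite -(integral_rV_shift x (F := fun y => F (x - y))); last exact: Cc_sub.
by congr integral_rV; apply/funext => y; rewrite opprD addrCA subrr addr0.
Qed.

Lemma integral_rV_gt0 F x : Cc F -> (forall y, 0 <= F y) -> 0 < F x -> 0 < integral_rV F.
Proof.
move=> cF F0 Fx.
have : \forall y \near x, F x / 2 < F y.
  have := cF.1 x => /cvgr_gt; apply; lra.
move=> /nbhs_ballP[r /= r0 hr].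
have mb := @Lebesgue_measurable_ball R N x r.
have /andP[b0 boo] := lebesgue_rV_ball x r0.
rewrite -lte_fin -Cc_integralE//.
pose B : set (lebesgueType R N) := ball x r.
have mF : measurable_fun [set: lebesgueType R N] (fun y : lebesgueType R N => (F y)%:E).
  by apply/measurable_EFinP; apply: continuous_Lebesgue_measurable_fun; exact: cF.1.
apply: (@lt_le_trans _ _ (\int[lebesgue_rV R N]_(y in B) (F y)%:E)%E); last first.
  by apply: ge0_subset_integral => // y _; rewrite lee_fin.
apply: (@lt_le_trans _ _ (\int[lebesgue_rV R N]_(y in B) (F x / 2)%:E)%E).
  by rewrite (integral_cst _ mb) mule_gt0// lte_fin divr_gt0.
apply: ge0_le_integral.
- exact: mb.
- by move=> y _; rewrite lee_fin divr_ge0// ltW.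
- exact: measurable_cst.
- exact: measurable_funTS mF.
- by move=> y By; rewrite lee_fin ltW//; exact: hr.
Qed.

(** The smooth function exp (- 1 / (d^2 - |x|^2)), divided by its integral. *)
Lemma mollifier (d : R) : 0 < d -> exists rho : V -> R,
  [/\ smooth rho, bounded_support rho, forall x, 0 <= rho x,
     forall x, rho x != 0 -> enorm x < d &
     forall x, integral_rV (fun y => rho (x - y)) = 1].
Proof.
move=> d0; have cb := bump_Cc d0.
pose Z := integral_rV (fun y => bump d (- y)).
have cN : Cc (fun y => bump d (- y)).
  by have := Cc_sub 0 cb; under eq_fun do rewrite sub0r.
have Z0 : 0 < Z.
  apply: (@integral_rV_gt0 _ 0) => // [y|]; first exact: bump_ge0.
  rewrite oppr0 /bump /flat big1 => [|j _]; last by rewrite mxE expr0n.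
  by rewrite subr0 exprn_gt0// hornerC mul1r expR_gt0.
exists (fun x => Z^-1 * bump d x); split.
- by apply: smoothM; [exact: smooth_cst|exact: smooth_bump].
- by apply: bounded_supportMr; exact: cb.2.
- by move=> x; rewrite mulr_ge0 ?bump_ge0// invr_ge0 ltW.
- by move=> x; rewrite mulf_eq0 negb_or => /andP[_]; exact: bump_support.
- move=> x; rewrite integral_rVZ ?integral_rV_sub ?mulVf ?gt_eqF//.
  exact: Cc_sub.
Qed.

End mollifier.

(** * Distance functions and cutoffs *)

Section distance.
Context (R : realType) (N : nat).
Local Notation V := 'rV[R]_N.
Implicit Types (x y z h : V) (E : set V).

(** Real valued, unlike eucl_dist: its Lipschitz continuity is what matters. *)
Definition sdist E x : R := inf [set enorm (x - y) | y in E].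

Lemma sdist_has_inf E x : E !=set0 -> has_inf [set enorm (x - y) | y in E].
Proof.
move=> [y Ey]; split; first by exists (enorm (x - y)); exists y.
by exists 0 => _ [z _ <-]; exact: enorm_ge0.
Qed.

Lemma sdist_ge0 E x : E !=set0 -> 0 <= sdist E x.
Proof.
move=> E0; apply: lb_le_inf; first by have [] := sdist_has_inf x E0.
by move=> _ [z _ <-]; exact: enorm_ge0.
Qed.

Lemma sdist_le E x y : E y -> sdist E x <= enorm (x - y).
Proof.
move=> Ey; apply: ge_inf; last by exists y.
by exists 0 => _ [z _ <-]; exact: enorm_ge0.
Qed.

Lemma sdist_lt E x r : E !=set0 -> sdist E x < r -> exists2 y, E y & enorm (x - y) < r.
Proof. by move=> E0 /(inf_lt (sdist_has_inf x E0).1)[_ [y Ey <-] yr]; exists y. Qed.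

Lemma sdist_self E x : E x -> sdist E x = 0.
Proof.
move=> Ex; apply/eqP; rewrite eq_le sdist_ge0 ?andbT; last by exists x.
by have := sdist_le x Ex; rewrite subrr enorm0.
Qed.

Lemma sdist_triangle E x z : E !=set0 -> sdist E x <= sdist E z + enorm (x - z).
Proof.
move=> E0; rewrite -lerBlDr; apply: lb_le_inf; first by have [] := sdist_has_inf z E0.
move=> _ [y Ey <-]; rewrite lerBlDr (le_trans (sdist_le x Ey))//.
by have := ler_enormD (z - y) (x - z); rewrite [z - y + _]addrC addrA subrK.
Qed.

Lemma lipschitz_continuous (F : V -> R) (L : R) :
  (forall x y, `|F x - F y| <= L * enorm (x - y)) -> continuous F.
Proof.
move=> hL x; apply/(@cvgrPdist_le _ _ _ _ (nbhs_filter x)) => e e0.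
have /(@cvgr_dist_le _ _ _ _ (nbhs_filter (0 : V))) : enorm y @[y --> (0 : V)] --> (0 : R).
  by rewrite -(enorm0 R N); exact: enorm_continuous.
have d0 : 0 < e / (`|L| + 1) by rewrite divr_gt0// ltr_wpDl.
move=> /(_ _ d0) /nbhs_ballP[r /= r0 hr].
apply/nbhs_ballP; exists r => //= y; rewrite -ball_normE /ball_/= => xy.
have : `|0 - enorm (x - y)| <= e / (`|L| + 1).
  by apply: hr; rewrite -ball_normE /ball_/= sub0r normrN.
rewrite sub0r normrN (ger0_norm (enorm_ge0 _)) ler_pdivlMr ?ltr_wpDl// => h.
apply: le_trans (hL x y) _; apply: le_trans h; rewrite mulrC ler_wpM2l ?enorm_ge0//.
by rewrite (le_trans (ler_norm L))// lerDl.
Qed.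

Lemma sdist_lipschitz E x z : E !=set0 -> `|sdist E x - sdist E z| <= enorm (x - z).
Proof.
move=> E0; have h1 := sdist_triangle x z E0; have h2 := sdist_triangle z x E0.
by rewrite (enormB z x) in h2; rewrite ler_norml; apply/andP; split; lra.
Qed.

Lemma sdist_continuous E : E !=set0 -> continuous (sdist E).
Proof.
by move=> E0; apply: (@lipschitz_continuous _ 1) => x y; rewrite mul1r sdist_lipschitz.
Qed.

Lemma bounded_enorm E : bounded_set E -> exists2 B : R, 0 < B & forall y, E y -> enorm y <= B.
Proof.
move=> [M [_ hM]]; exists (N%:R * (`|M| + 1) + 1).
  by rewrite ltr_wpDl// mulr_ge0// addr_ge0.
move=> y Ey; rewrite (le_trans (enorm_le_norm y))//.
apply: (@le_trans _ _ (N%:R * (`|M| + 1))); last by rewrite lerDl.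
rewrite ler_wpM2l//; apply: (hM (`|M| + 1)) => //.
by rewrite (le_lt_trans (ler_norm M))// ltrDl.
Qed.

Lemma sdist_bounded E t : E !=set0 -> bounded_set E ->
  exists B : R, forall x, sdist E x < t -> enorm x <= B.
Proof.
move=> E0 /bounded_enorm[B B0 hB]; exists (B + t) => x /(sdist_lt E0)[y Ey xy].
have := ler_enormD y (x - y); rewrite addrCA subrr addr0 => h.
by have := hB _ Ey; lra.
Qed.

(** Differentiate in the direction of the gradient. *)
Lemma gradient_le_lipschitz (F : V -> R) (L : R) x : 0 <= L ->
  (forall y, differentiable F y) ->
  (forall h, `|F (x + h) - F x| <= L * enorm h) ->
  \sum_k partial k F x ^+ 2 <= L ^+ 2.
Proof.
move=> L0 dF hL; set S := \sum_k _.
have S0 : 0 <= S by exact: sum_sqr_ge0.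
pose h : V := \row_k partial k F x.
have Eh : enorm h ^+ 2 = S by rewrite sqr_enorm; apply: eq_bigr => k _; rewrite mxE.
have : S <= L * enorm h.
  have [d1 d2] := is_derive_line x h 0 dF.
  have -> : S = 'D_1 (fun s : R => F (x + s *: h)) 0.
    by rewrite d2 scale0r addr0; apply: eq_bigr => k _; rewrite mxE expr2.
  rewrite /derive; apply: limr_le; first exact: d1.
  near=> t; have t0 : t != 0 by near: t; exact: nbhs_dnbhs_neq.
  apply: le_trans (ler_norm _) _.
  rewrite /= addr0 scale0r addr0 normrM normfV ler_pdivrMl ?normr_gt0//.
  apply: le_trans (hL _) _.
  by rewrite enormZ /GRing.scale/= mulr1 mulrCA.
rewrite -Eh; have := enorm_ge0 h; move: (enorm h) => a a0.
rewrite expr2 => aL; have [->|an0] := eqVneq a 0; first by rewrite mulr0 sqr_ge0.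
have {}aL : a <= L by rewrite -(ler_pM2r (_ : 0 < a))// lt0r an0.
by rewrite -expr2 lerXn2r// nnegrE.
Unshelve. all: by end_near.
Qed.

Let clamp (a : R) : R := Num.min 1 (Num.max 0 a).

Let clamp_lip a b : `|clamp a - clamp b| <= `|a - b|.
Proof.
wlog ab : a b / a <= b.
  by move=> h; have [/h//|/ltW/h] := leP a b; rewrite distrC [leRHS]distrC.
have cm : clamp a <= clamp b.
  by rewrite /clamp le_min2//= le_max2.
rewrite distrC ger0_norm ?subr_ge0// distrC ger0_norm ?subr_ge0//.
move: cm; rewrite /clamp /Num.min /Num.max.
have [ha|ha] := ltP 0 a; have [hb|hb] := ltP 0 b; rewrite ?ltr10 //;
  have [h1|h1] := ltP 1 a; have [h2|h2] := ltP 1 b; lra.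
Qed.

(** Mollify a clamped affine function of the distance to E. The clamped function
    has Lipschitz constant 2 / (t - s), which averaging preserves and which becomes
    a bound on the gradient; it is constant near the two regions where the value
    of chi is prescribed, so that a small mollification does not change it there. *)
Lemma cutoff E (s t : R) : E !=set0 -> bounded_set E -> 0 <= s -> s < t ->
  exists chi : V -> R,
    [/\ smooth chi, forall x, 0 <= chi x <= 1,
        forall x, sdist E x <= s -> chi x = 1,
        forall x, t <= sdist E x -> chi x = 0 &
        forall x, \sum_k partial k chi x ^+ 2 <= (2 / (t - s)) ^+ 2].
Proof.
move=> E0 bE s0 st; pose l := t - s.
have l0 : 0 < l by rewrite subr_gt0.
(* The slope is concentrated in the middle half of [s, t]; the two remaining
   quarters leave room for a mollifier of radius l / 4. *)
pose c x := clamp ((t - l / 4 - sdist E x) / (l / 2)).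
have c1 x : sdist E x <= s + l / 4 -> c x = 1.
  move=> h; rewrite /c /clamp; apply/min_idPl; rewrite le_max; apply/orP; right.
  by rewrite ler_pdivlMr ?divr_gt0// mul1r /l in h *; lra.
have c0 x : t - l / 4 <= sdist E x -> c x = 0.
  move=> h; rewrite /c /clamp (max_idPl _); first by apply/min_idPr.
  by rewrite pmulr_lle0 ?invr_gt0 ?divr_gt0// subr_le0.
have c01 x : 0 <= c x <= 1.
  by rewrite /c /clamp ge_min lexx le_min ler01 le_max lexx.
have clip x y : `|c x - c y| <= (2 / l) * enorm (x - y).
  rewrite /c (le_trans (clamp_lip _ _))// -mulrBl normrM.
  rewrite (ger0_norm (_ : 0 <= (l / 2)^-1)) ?invr_ge0 ?divr_ge0 ?(ltW l0)//.
  rewrite invf_div mulrC ler_wpM2l ?divr_ge0 ?(ltW l0)//.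
  rewrite distrC [X in `|X|](_ : _ = sdist E x - sdist E y); last by ring.
  exact: sdist_lipschitz.
have cc : Cc c.
  split; first exact: lipschitz_continuous clip.
  have [B hB] := sdist_bounded t E0 bE.
  apply: (@bounded_support_enorm _ _ _ B) => x cx; apply: hB.
  rewrite ltNge; apply: contra cx => tx; rewrite c0//; lra.
have l40 : 0 < l / 4 by rewrite divr_gt0.
have [rho [sr br r0 rd rZ]] := @mollifier R N _ l40.
have cr : Cc rho by split => //; exact: smooth_continuous.
have near x (a M : R) : (forall y, enorm (x - y) < l / 4 -> `|c y - a| <= M) ->
    `|convol c rho x - a| <= M.
  move=> h; have := @convol_near R N c rho a M x cc cr r0.
  by rewrite rZ !mulr1; apply => y /rd; exact: h.
have sc : smooth (convol c rho) by exact: smooth_convol.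
exists (convol c rho); split => //.
- move=> x; have := @near x (1/2) (1/2); rewrite ler_norml => h.
  have /andP[] : - (1/2) <= convol c rho x - 1/2 <= 1/2.
    by apply: h => y _; rewrite ler_norml; have /andP[] := c01 y => *; apply/andP; split; lra.
  by move=> *; apply/andP; split; lra.
- move=> x xs; apply/eqP; rewrite -subr_eq0 -normr_le0; apply: near => y xy.
  rewrite c1 ?subrr ?normr0//.
  have := sdist_triangle y x E0; rewrite (enormB y x); lra.
- move=> x xs; apply/eqP; rewrite -normr_le0 -[convol c rho x]subr0; apply: near => y xy.
  rewrite c0 ?subrr ?normr0//.
  have := sdist_triangle x y E0; lra.
- move=> x; apply: gradient_le_lipschitz => [||h].
  + by rewrite divr_ge0// ltW.
  + by move=> y; exact: smooth_differentiable.
  + have := @convol_lipschitz R N c rho (2 / l * enorm h) x h cc cr r0.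
    rewrite rZ mulr1; apply => y; apply: le_trans (clip _ _) _.
    by rewrite [y + h]addrC addrK.
Qed.

End distance.

(** * Distance to the boundary of a domain *)

Section domain.
Context (R : realType) (N : nat).
Local Notation V := 'rV[R]_N.
Implicit Types (x y z h : V) (E Omega : set V).

Lemma line_continuous x h : continuous (fun t : R => x + t *: h).
Proof.
move=> t; apply: cvgD; first exact: cvg_cst.
by apply: cvgZl; exact: cvg_id.
Qed.

(** The infimum of the times that the segment spends outside Omega is reached at
    a boundary point. *)
Lemma segment_boundary Omega x y : open Omega -> Omega x -> ~ Omega y ->
  exists2 z, boundary Omega z & enorm (x - z) <= enorm (x - y).
Proof.
move=> oO Ox nOy; pose g (t : R) := x + t *: (y - x).
pose T := [set t : R | 0 <= t /\ ~ Omega (g t)].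
have T1 : T 1 by split => //; rewrite /g scale1r addrCA subrr addr0.
have hT : has_inf T by split; [exists 1|exists 0 => t []].
pose t0 := inf T.
have t00 : 0 <= t0 by apply: lb_le_inf; [exists 1|move=> t []].
have t01 : t0 <= 1 by apply: ge_inf => //; case: hT.
have cg : continuous g by exact: line_continuous.
have nO : ~ Omega (g t0).
  move=> O0; have : nbhs t0 (g @^-1` Omega) by apply: cg; exact: open_nbhs_nbhs.
  move=> /nbhs_ballP[e /= e0 he].
  have [t [tt nt] te] := inf_lt hT.1 (ltr_pwDr e0 (lexx t0)).
  apply: (nt); apply: he; rewrite -ball_normE /ball_/= distrC ger0_norm ?subr_ge0.
    by rewrite ltrBlDl.
  by apply: ge_inf; [case: hT|split].
have t0p : 0 < t0.
  rewrite lt0r t00 andbT; apply/eqP => t0E; apply: nO.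
  by rewrite t0E /g scale0r addr0.
exists (g t0).
  split; last by move=> /interior_subset.
  move=> B /(cg t0)/nbhs_ballP[e /= e0 he].
  pose s := Num.max 0 (t0 - e / 2).
  have s0 : 0 <= s by rewrite le_max lexx.
  have st : s < t0 by rewrite gt_max t0p/= ltrBlDr ltrDl divr_gt0.
  exists (g s); split.
    apply: contrapT => nOs; have : t0 <= s by apply: ge_inf; [case: hT|split].
    by rewrite leNgt st.
  apply: he; rewrite -ball_normE /ball_/= ger0_norm ?subr_ge0 ?ltW//.
  have : t0 - e / 2 <= s by rewrite le_max lexx orbT.
  lra.
have -> : x - g t0 = t0 *: (x - y).
  by rewrite /g opprD addrA subrr add0r -scalerN opprB.
by rewrite enormZ ger0_norm// ler_piMl ?enorm_ge0.
Qed.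

Lemma boundary_notin Omega z : open Omega -> boundary Omega z -> ~ Omega z.
Proof. by move=> oO [_ nI] Oz; apply: nI; exact: open_nbhs_nbhs. Qed.

Lemma bounded_domain_boundary Omega : (0 < N)%N -> bounded_domain Omega ->
  boundary Omega !=set0.
Proof.
move=> N0 [oO _ [x Ox] bO].
have [B B0 hB] := bounded_enorm bO.
pose y : V := const_mx (B + 1).
have nOy : ~ Omega y.
  move=> /hB; have := coord_le_enorm y (Ordinal N0); rewrite mxE => h1 h2.
  by have := le_trans (le_trans (ler_norm _) h1) h2; lra.
by have [z bz _] := segment_boundary oO Ox nOy; exists z.
Qed.

Lemma relatively_compact_subset E Omega : relatively_compact E Omega -> E `<=` Omega.
Proof. by move=> [_ h]; apply: subset_trans h; exact: subset_closure. Qed.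

Lemma relatively_compact_bounded E Omega : relatively_compact E Omega -> bounded_set E.
Proof.
move=> [cE _]; have [M [Mr hM]] := compact_bounded cE.
by exists M; split => // r Mlr x Ex; apply: hM => //; exact: subset_closure.
Qed.

(** The distance is positive because the distance to the complement of Omega
    attains its minimum on the compact closure of E, and it is finite because a
    bounded nonempty domain has a boundary. A point outside Omega is no closer to E
    than the boundary is, as the segment towards it crosses the boundary. *)
Lemma eucl_dist_boundary E Omega : (0 < N)%N -> bounded_domain Omega -> E !=set0 ->
  relatively_compact E Omega ->
  exists d : R, [/\ 0 < d, eucl_dist E (boundary Omega) = d%:E &
    forall x, sdist E x < d -> Omega x].
Proof.
move=> N0 dO E0 rcE; have [oO cO O0 bO] := dO.
have [z bz] := bounded_domain_boundary N0 dO.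
have EO := relatively_compact_subset rcE.
have nO0 : (~` Omega) !=set0 by exists z; exact: boundary_notin.
have [c c0 hc] : exists2 c : R, 0 < c & forall x y, E x -> ~ Omega y -> c <= enorm (x - y).
  have cE0 : closure E !=set0 by case: E0 => x Ex; exists x; exact: subset_closure.
  have ce : {within closure E, continuous (sdist (~` Omega))}.
    by apply: continuous_subspaceT; exact: sdist_continuous.
  have [w wE hw] := EVT_min_rV cE0 rcE.1 ce.
  exists (sdist (~` Omega) w); last first.
    move=> x y Ex nOy; apply: le_trans (hw x _) (sdist_le _ _) => //.
    by rewrite inE; exact: subset_closure.
  have Ow : Omega w by apply: rcE.2; rewrite inE in wE.
  have /nbhs_ballP[r /= r0 hr] := open_nbhs_nbhs (conj oO Ow).
  apply: (lt_le_trans r0); apply: lb_le_inf; first by have [] := sdist_has_inf w nO0.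
  move=> _ [y nOy <-]; rewrite leNgt; apply/negP => wy; apply: nOy; apply: hr.
  by rewrite -ball_normE /ball_/=; apply: le_lt_trans wy; exact: norm_le_enorm.
have [x Ex] := E0.
pose D := eucl_dist E (boundary Omega).
have cD : (c%:E <= D)%E.
  apply: le_ereal_inf_tmp => _ [a Ea [b bb] <-]; rewrite lee_fin hc//.
  exact: boundary_notin.
have Dx : (D <= (enorm (x - z))%:E)%E by apply: ereal_inf_lbound; exists x => //; exists z.
have fD : D \is a fin_num.
  rewrite fin_numE; apply/andP; split.
    by apply/eqP => DE; rewrite DE in cD.
  by apply/eqP => DE; rewrite DE in Dx.
exists (fine D); split.
- by rewrite -lte_fin fineK//; apply: lt_le_trans cD; rewrite lte_fin.
- by rewrite fineK.
- move=> y /(sdist_lt E0)[a Ea ya]; apply: contrapT => nOy.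
  have [b bb ab] := segment_boundary oO (EO _ Ea) nOy.
  have : (D <= (enorm (a - b))%:E)%E by apply: ereal_inf_lbound; exists a => //; exists b.
  rewrite -(fineK fD) lee_fin => h.
  by have := le_lt_trans (le_trans h ab) (eq_ind _ (fun r => r < _) ya _ (enormB _ _)); rewrite ltxx.
Qed.

Lemma sdist_test_function E Omega (t d : R) (phi : V -> R) :
  E !=set0 -> bounded_set E -> t < d -> (forall x, sdist E x < d -> Omega x) ->
  smooth phi -> (forall x, phi x != 0 -> sdist E x <= t) -> test_function Omega phi.
Proof.
move=> E0 bE td hd sphi hphi.
have cl : closed [set x | sdist E x <= t].
  have -> : [set x | sdist E x <= t] = sdist E @^-1` [set r | r <= t] by [].
  by apply: preimage_closed; [move=> y _; exact: sdist_continuous|exact: closed_le].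
have sub : closure [set x | phi x != 0] `<=` [set x | sdist E x <= t].
  by rewrite closureE; apply: smallest_sub => // x /=; exact: hphi.
have bd : bounded_set [set x | sdist E x <= t].
  have [B hB] := sdist_bounded d E0 bE.
  exists B; split; first exact: num_real.
  move=> M BM x /= xt; rewrite (le_trans (norm_le_enorm x))// ltW//.
  by rewrite (le_lt_trans _ BM)// hB// (le_lt_trans xt).
split => //.
- apply: (@subclosed_compact _ _ [set x | sdist E x <= t]) => //; first exact: closed_closure.
  exact: bounded_closed_compact.
- by move=> x /sub /= xt; apply: hd; exact: le_lt_trans td.
Qed.

End domain.

(** * Integral inequalities *)

Section integral_inequalities.
Context d (T : measurableType d) (R : realType) (mu : {measure set T -> \bar R}).
Variables (D : set T) (mD : measurable D).

Lemma le_integral_lin2 (f g h : T -> R) (a b : R) :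
  0 <= a -> 0 <= b ->
  measurable_fun D f -> measurable_fun D g -> measurable_fun D h ->
  (forall x, 0 <= f x) -> (forall x, 0 <= g x) -> (forall x, 0 <= h x) ->
  (forall x, D x -> f x <= a * g x + b * h x) ->
  (\int[mu]_(x in D) (f x)%:E <=
   a%:E * \int[mu]_(x in D) (g x)%:E + b%:E * \int[mu]_(x in D) (h x)%:E)%E.
Proof.
move=> a0 b0 mf mg mh f0 g0 h0 fgh.
have mEg : measurable_fun D (EFin \o g) by exact/measurable_EFinP.
have mEh : measurable_fun D (EFin \o h) by exact/measurable_EFinP.
rewrite -(ge0_integralZl mu mD mEg) => [|x _|]; [|by rewrite lee_fin|by rewrite lee_fin].
rewrite -(ge0_integralZl mu mD mEh) => [|x _|]; [|by rewrite lee_fin|by rewrite lee_fin].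
rewrite -ge0_integralD//; first last.
- by apply: measurable_funeM.
- by move=> x _; rewrite mule_ge0// lee_fin.
- by apply: measurable_funeM.
- by move=> x _; rewrite mule_ge0// lee_fin.
apply: ge0_le_integral => //.
- by move=> x _; rewrite lee_fin.
- exact/measurable_EFinP.
- by apply: emeasurable_funD; exact: measurable_funeM.
Qed.

(** The passage from a test function to its limit phi: g and k are the squares of
    the test function and of its derivative, f and S those of the limits, and X is
    the squared error, which enters with the total weight 2 + 4 c. *)
Lemma le_integral_transfer (f g k S X : T -> R) (c e : R) :
  0 < c -> 0 < e ->
  measurable_fun D f -> measurable_fun D g -> measurable_fun D k ->
  measurable_fun D S -> measurable_fun D X ->
  (forall x, 0 <= f x) -> (forall x, 0 <= g x) -> (forall x, 0 <= k x) ->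
  (forall x, 0 <= S x) -> (forall x, 0 <= X x) ->
  (forall x, D x -> f x <= 2 * g x + 2 * X x) ->
  (forall x, D x -> k x <= 2 * S x + 2 * X x) ->
  (\int[mu]_(x in D) (g x)%:E <= c%:E * \int[mu]_(x in D) (k x)%:E)%E ->
  (\int[mu]_(x in D) (X x)%:E < (e / (2 + 4 * c))%:E)%E ->
  (\int[mu]_(x in D) (f x)%:E <= (4 * c)%:E * \int[mu]_(x in D) (S x)%:E + e%:E)%E.
Proof.
move=> c0 e0 mf mg mk mS mX f0 g0 k0 S0 X0 fgX kSX h2 hX.
have h1 := le_integral_lin2 (ler0n _ 2) (ler0n _ 2) mf mg mX f0 g0 X0 fgX.
have h3 := le_integral_lin2 (ler0n _ 2) (ler0n _ 2) mk mS mX k0 S0 X0 kSX.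
have IS0 : (0 <= \int[mu]_(x in D) (S x)%:E)%E by apply: integral_ge0 => x _; rewrite lee_fin.
have IX0 : (0 <= \int[mu]_(x in D) (X x)%:E)%E by apply: integral_ge0 => x _; rewrite lee_fin.
move: h1 h2 h3 IS0 IX0 hX.
set IS := (\int[mu]_(x in D) (S x)%:E)%E; set IX := (\int[mu]_(x in D) (X x)%:E)%E.
set K := (\int[mu]_(x in D) (k x)%:E)%E; set P := (\int[mu]_(x in D) (g x)%:E)%E.
set Q := (\int[mu]_(x in D) (f x)%:E)%E; clearbody K P Q IS IX.
case: IS => [s||] //= h1 h2 h3 s0; last by rewrite gt0_muley ?lte_fin ?mulr_gt0// addye// leey.
case: IX h1 h3 => [x||] //= h1 h3; rewrite lee_fin lte_fin => x0 xe.
apply: (le_trans h1).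
have h4 : (P <= (c * (2 * s + 2 * x))%:E)%E.
  apply: (le_trans h2); rewrite [leRHS]EFinM lee_wpmul2l// lee_fin.
  exact: ltW.
have h5 : (2%:E * P <= (2 * (c * (2 * s + 2 * x)))%:E)%E.
  by rewrite [leRHS]EFinM lee_wpmul2l.
apply: (le_trans (leeD h5 (lexx _))).
rewrite -!EFinM -!EFinD lee_fin.
have : (2 + 4 * c) * x <= e.
  rewrite mulrC -ler_pdivlMr; first exact: ltW.
  by rewrite ltr_wpDr// mulr_ge0// ltW.
lra.
Qed.

Lemma integral_sqr_eq0 (f : T -> R) : measurable_fun D f ->
  (\int[mu]_(x in D) (f x ^+ 2)%:E = 0)%E -> {ae mu, forall x, D x -> f x = 0}.
Proof.
move=> mf h.
have mf2 : measurable_fun D (fun x => (f x ^+ 2)%:E).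
  by apply/measurable_EFinP; exact: measurable_funX.
have := (ae_eq_integral_abs mu mD mf2).1; rewrite /ae_eq.
have -> : (\int[mu]_(x in D) `|(f x ^+ 2)%:E| = 0)%E.
  rewrite -h; apply: eq_integral => x _.
  by rewrite gee0_abs// lee_fin sqr_ge0.
move=> /(_ erefl); apply: filterS => x /= hx Dx.
by have := hx Dx => -[] /eqP; rewrite sqrf_eq0 => /eqP.
Qed.

Lemma ae_zero_integral_sqr (f : T -> R) : measurable_fun D f ->
  {ae mu, forall x, D x -> f x = 0} -> (\int[mu]_(x in D) (f x ^+ 2)%:E = 0)%E.
Proof.
move=> mf h.
have mf2 : measurable_fun D (fun x => (f x ^+ 2)%:E).
  by apply/measurable_EFinP; exact: measurable_funX.
have := (ae_eq_integral_abs mu mD mf2).2; rewrite /ae_eq => H.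
have {H} <- : (\int[mu]_(x in D) `|(f x ^+ 2)%:E| = 0)%E.
  by apply: H; apply: filterS h => x /= hx Dx; rewrite hx// expr0n.
by apply: eq_integral => x _; rewrite gee0_abs// lee_fin sqr_ge0.
Qed.

End integral_inequalities.

(** * The first eigenvalue *)

Section first_eigenvalue.
Context (R : realType) (N : nat).
Local Notation V := 'rV[R]_N.
Local Notation lambda := (lebesgue_rV R N).
Implicit Types (phi psi F : V -> R) (Omega : set V).

Lemma integral_off0 Omega F : (forall x, ~ Omega x -> F x = 0) ->
  (\int[lambda]_(x in Omega) (F x)%:E = \int[lambda]_x (F x)%:E)%E.
Proof.
move=> h; rewrite integral_mkcond; apply: eq_integral => x _.
by rewrite patchE; case: ifPn => // /negP xO; rewrite h// => Ox; apply: xO; rewrite inE.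
Qed.

Lemma Cc_integral_in Omega F : Cc F -> (forall x, ~ Omega x -> F x = 0) ->
  (\int[lambda]_(x in Omega) (F x)%:E = (integral_rV F)%:E)%E.
Proof. by move=> cF h; rewrite integral_off0// Cc_integralE. Qed.

Lemma test_function_bounded_support Omega phi : test_function Omega phi -> bounded_support phi.
Proof.
move=> [_ /compact_bounded[M [_ hM]] _]; exists (`|M| + 1) => x hx.
apply: contrapT => px; have : `|x| <= `|M| + 1.
  apply: (hM (`|M| + 1)); first by rewrite (le_lt_trans (ler_norm M))// ltrDl.
  by apply: subset_closure; apply/eqP.
by rewrite leNgt hx.
Qed.

Lemma test_function_C1c Omega phi : test_function Omega phi -> C1c phi.
Proof.
move=> tphi; apply: smooth_C1c; first by case: tphi.
exact: test_function_bounded_support tphi.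
Qed.

Lemma test_function_off Omega phi x : test_function Omega phi -> ~ Omega x -> phi x = 0.
Proof.
move=> [_ _ h] nO; apply: contrapT => px; apply: nO; apply: h.
by apply: subset_closure; apply/eqP.
Qed.

Lemma near_off_test (Omega : set V) (kappa : V -> R) (x : V) :
  test_function Omega kappa -> ~ Omega x -> \forall y \near x, kappa y = 0.
Proof.
move=> [_ _ h] nO; have : nbhs x (~` closure [set x | kappa x != 0]).
  apply: open_nbhs_nbhs; split; last by move=> /h.
  by apply: closed_openC; exact: closed_closure.
by apply: filterS => y /= ny; apply: contrapT => ky; apply: ny;
  apply: subset_closure; apply/eqP.
Qed.

Lemma test_function_partial_off Omega phi k x : test_function Omega phi -> ~ Omega x ->
  partial k phi x = 0.
Proof.
move=> tphi nO; rewrite /partial -[RHS](derive_cst (0 : R) x (delta_mx 0 k)).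
by apply: near_eq_derive; exact: near_off_test tphi nO.
Qed.

Lemma L2_Cc Omega F : open Omega -> Cc F -> L2 Omega F.
Proof.
move=> oO cF; have mO : Lebesgue_measurable Omega.
  by apply: borel_Lebesgue_measurable; exact: open_measurable_rV.
have mF := continuous_Lebesgue_measurable_fun cF.1.
have cF2 : Cc (fun x => F x * F x) by apply: CcMr => //; exact: cF.1.
split; first exact: measurable_funTS mF.
apply: (@le_lt_trans _ _ (\int[lambda]_x (F x * F x)%:E)%E).
  under eq_integral do rewrite expr2.
  have mF2 : measurable_fun [set: lebesgueType R N] (fun x : lebesgueType R N => (F x * F x)%:E).
    by apply/measurable_EFinP; apply: continuous_Lebesgue_measurable_fun; exact: cF2.1.
  apply: (@ge0_subset_integral _ _ _ lambda (Omega : set (lebesgueType R N)) setT mO measurableT _ mF2).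
    by move=> x _; rewrite lee_fin -expr2 sqr_ge0.
  exact: subsetT.
by rewrite Cc_integralE// ltry.
Qed.

(** The classical derivatives are weak ones, by integration by parts. *)
Lemma sobolev12_0_test Omega phi : open Omega -> test_function Omega phi ->
  sobolev12_0 Omega phi (fun k => partial k phi).
Proof.
move=> oO tphi; have c1 := test_function_C1c tphi.
split; last first.
  move=> e e0; exists phi => //.
  rewrite integral0_eq ?lte_fin// => x _; rewrite subrr big1 ?addr0 ?expr0n//= => j _.
  by rewrite subrr expr0n.
split; first by apply: L2_Cc => //; exact: C1c_Cc.
move=> j; split; first by apply: L2_Cc => //; exact: C1c_partial.
move=> psi tpsi; have d1 := test_function_C1c tpsi.
have [dphi cpphi _] := c1; have [dpsi cppsi _] := d1.
have cphi := C1c_Cc c1; have cpsi := C1c_Cc d1.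
have A : Cc (fun x => phi x * partial j psi x) by apply: CcMr => //; exact: cppsi.
have B : Cc (fun x => partial j phi x * psi x) by apply: CcMl => //; exact: cpphi.
rewrite (Cc_integral_in A) => [|x nO]; last by rewrite (test_function_off tphi nO) mul0r.
rewrite (Cc_integral_in B) => [|x nO]; last by rewrite (test_function_off tpsi nO) mulr0.
have c2 : C1c (fun x => phi x * psi x).
  apply: smooth_C1c; first by apply: smoothM; [case: tphi|case: tpsi].
  by apply: bounded_supportM; exact: cphi.2.
have := integral_partial j c2; rewrite partialM// integral_rVD// => /eqP.
by rewrite addrC addr_eq0 => /eqP ->; rewrite EFinN.
Qed.

(** A real lower bound L stands for the eigenvalue, whose values are extended
    reals. *)
Lemma lambda1_test Omega phi (L : R) : open Omega -> (L%:E <= lambda1 Omega)%E ->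
  test_function Omega phi ->
  L * integral_rV (fun x => phi x ^+ 2) <= integral_rV (fun x => \sum_j partial j phi x ^+ 2).
Proof.
move=> oO hL tphi; have c1 := test_function_C1c tphi.
have cphi := C1c_Cc c1.
have c2 : Cc (fun x => phi x ^+ 2).
  by under eq_fun do rewrite expr2; apply: CcMr => //; exact: cphi.1.
have c3 : Cc (fun x => \sum_j partial j phi x ^+ 2).
  apply: Cc_sum => j _; under eq_fun do rewrite expr2.
  have cj := C1c_partial j c1; apply: CcMr => //; exact: cj.1.
have i2 : 0 <= integral_rV (fun x => phi x ^+ 2) by apply: integral_rV_ge0 => x; exact: sqr_ge0.
have i3 : 0 <= integral_rV (fun x => \sum_j partial j phi x ^+ 2).
  by apply: integral_rV_ge0 => x; exact: sum_sqr_ge0.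
have [->|i2n0] := eqVneq (integral_rV (fun x => phi x ^+ 2)) 0; first by rewrite mulr0.
have i20 : 0 < integral_rV (fun x => phi x ^+ 2) by rewrite lt0r i2n0.
rewrite -ler_pdivlMr// -lee_fin; apply: (le_trans hL).
apply: ereal_inf_lbound; exists phi, (fun k => partial k phi); split.
- exact: sobolev12_0_test.
- have mO : measurable (Omega : set (lebesgueType R N)).
    by apply: borel_Lebesgue_measurable; exact: open_measurable_rV.
  move=> /(@ae_zero_integral_sqr _ _ _ lambda (Omega : set (lebesgueType R N)) mO phi
    (measurable_funTS (continuous_Lebesgue_measurable_fun cphi.1))).
  rewrite (Cc_integral_in c2) => [|x nO]; last by rewrite (test_function_off tphi nO) expr0n.
  by move=> [] /eqP; exact/negP.
- rewrite (Cc_integral_in c3) => [|x nO]; last first.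
    by rewrite big1// => j _; rewrite (test_function_partial_off j tphi nO) expr0n.
  rewrite (Cc_integral_in c2) => [|x nO]; last by rewrite (test_function_off tphi nO) expr0n.
  by rewrite inver (negPf i2n0) EFinM.
Qed.

(** The k-th derivative of x_k psi^2 integrates to 0, which bounds the integral of
    psi^2 by that of 2 |x_k psi d_k psi|; absorb half of psi^2 on the left. *)
Lemma poincare_test Omega psi k (B : R) : (forall x, Omega x -> `|x 0 k| <= B) ->
  test_function Omega psi ->
  integral_rV (fun x => psi x ^+ 2) <= 4 * B ^+ 2 * integral_rV (fun x => partial k psi x ^+ 2).
Proof.
move=> hB tpsi; have c1 := test_function_C1c tpsi; have cpsi := C1c_Cc c1.
have spsi : smooth psi by case: tpsi.
have c2 : Cc (fun x => psi x ^+ 2).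
  by under eq_fun do rewrite expr2; apply: CcMr => //; exact: cpsi.1.
have ck := C1c_partial k c1.
have c3 : Cc (fun x => partial k psi x ^+ 2).
  by under eq_fun do rewrite expr2; apply: CcMr => //; exact: ck.1.
have sx : smooth (fun x : V => x 0 k) by apply/smooth_Csm => m; exact: Csm_coord.
have c4 : C1c (fun x => x 0 k * (psi x * psi x)).
  apply: smooth_C1c; first by apply: smoothM => //; exact: smoothM.
  by apply/bounded_supportMr/bounded_supportM; exact: cpsi.2.
have dpsi x : differentiable psi x by exact: smooth_differentiable.
have dx x : differentiable (fun x : V => x 0 k) x by exact: smooth_differentiable.
have E : partial k (fun x => x 0 k * (psi x * psi x)) =
    fun x => psi x ^+ 2 + x 0 k * (2 * (psi x * partial k psi x)).
  rewrite partialM// => [|x]; last exact: differentiableM.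
  apply/funext => x; rewrite partial_coord mxE !eqxx mul1r partialM//; ring.
have c5 : Cc (fun x => x 0 k * (2 * (psi x * partial k psi x))).
  apply: CcMl; first exact: smooth_continuous.
  by apply: CcZ; apply: CcMr => //; exact: ck.1.
have := integral_partial k c4; rewrite E integral_rVD// => h.
have : integral_rV (fun x => - (x 0 k * (2 * (psi x * partial k psi x)))) <=
   integral_rV (fun x => 2^-1 * psi x ^+ 2 + 2 * B ^+ 2 * partial k psi x ^+ 2).
  apply: le_integral_rV => [||x]; first exact: CcN.
    by apply: CcD; exact: CcZ.
  have [Ox|nOx] := pselect (Omega x); last first.
    by rewrite (test_function_off tpsi nOx) (test_function_partial_off k tpsi nOx); lra.
  have xB2 : x 0 k ^+ 2 <= B ^+ 2.
    have := hB _ Ox; rewrite -real_normK ?num_real// => hx.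
    by rewrite lerXn2r// nnegrE (le_trans _ hx).
  have := ler_wpM2r (sqr_ge0 (partial k psi x)) xB2.
  have := sqr_ge0 (psi x + 2 * x 0 k * partial k psi x); nra.
rewrite integral_rVN// integral_rVD; [|exact: CcZ..]; rewrite !integral_rVZ//.
lra.
Qed.

End first_eigenvalue.

(** * Positivity of the first eigenvalue *)

Section first_eigenvalue_positive.
Context (R : realType) (N : nat).
Local Notation V := 'rV[R]_N.
Local Notation lambda := (lebesgue_rV R N).

(** Test functions approximate phi together with its gradient, and both sides of
    the Poincare inequality are controlled by the error of the approximation. *)
Lemma poincare_sobolev12_0 (Omega : set V) (phi : V -> R) (G : 'I_N -> V -> R)
    (k : 'I_N) (B : R) : 0 < B ->
  open Omega -> (forall x, Omega x -> `|x 0 k| <= B) -> sobolev12_0 Omega phi G ->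
  (\int[lambda]_(x in Omega) (phi x ^+ 2)%:E <=
   (16 * B ^+ 2)%:E * \int[lambda]_(x in Omega) (\sum_(j < N) G j x ^+ 2)%:E)%E.
Proof.
move=> B0 oO hB [[[mphi _] hG] happ].
pose T := lebesgueType R N.
pose D : set T := Omega.
have mO : measurable D by apply: borel_Lebesgue_measurable; exact: open_measurable_rV.
have mG j : measurable_fun D (G j : T -> R) by have [[]] := hG j.
have B2 : 0 < B ^+ 2 by rewrite exprn_gt0.
apply/lee_addgt0Pr => e e0.
have C0 : 0 < 4 * B ^+ 2 by rewrite mulr_gt0.
have e'0 : 0 < e / (2 + 4 * (4 * B ^+ 2)) by rewrite divr_gt0// ltr_wpDr// mulr_ge0// ltW.
have [psi tpsi hpsi] := happ _ e'0.
have cpsi := C1c_Cc (test_function_C1c tpsi).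
have cp j := C1c_partial j (test_function_C1c tpsi).
have mpsi : measurable_fun D (psi : T -> R).
  by apply: measurable_funTS; apply: continuous_Lebesgue_measurable_fun; exact: cpsi.1.
have mp j : measurable_fun D (partial j psi : T -> R).
  by apply: measurable_funTS; apply: continuous_Lebesgue_measurable_fun; exact: (cp j).1.
pose X : T -> R := fun x =>
  (psi x - phi x) ^+ 2 + \sum_(j < N) (partial j psi x - G j x) ^+ 2.
pose S : T -> R := fun x => \sum_(j < N) G j x ^+ 2.
have X0 x : 0 <= X x by rewrite addr_ge0 ?sqr_ge0 ?sum_sqr_ge0.
have S0 x : 0 <= S x by exact: sum_sqr_ge0.
have mX : measurable_fun D X.
  apply: measurable_funD; first by apply: measurable_funX; exact: measurable_funB.
  by apply: measurable_sum => j; apply: measurable_funX; exact: measurable_funB.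
have mS : measurable_fun D S.
  by apply: measurable_sum => j; exact: measurable_funX.
have mphi2 : measurable_fun D (fun x : T => phi x ^+ 2) by exact: measurable_funX.
have mpsi2 : measurable_fun D (fun x : T => psi x ^+ 2) by exact: measurable_funX.
have mp2 : measurable_fun D (fun x : T => partial k psi x ^+ 2) by exact: measurable_funX.
have h2 : (\int[lambda]_(x in D) (psi x ^+ 2)%:E <=
    (4 * B ^+ 2)%:E * \int[lambda]_(x in D) (partial k psi x ^+ 2)%:E)%E.
  have c2 : Cc (fun x => psi x ^+ 2).
    by under eq_fun do rewrite expr2; apply: CcMr => //; exact: cpsi.1.
  have c3 : Cc (fun x => partial k psi x ^+ 2).
    by under eq_fun do rewrite expr2; apply: CcMr => //; exact: (cp k).1.
  rewrite (Cc_integral_in c2) => [|x nO]; last by rewrite (test_function_off tpsi nO) expr0n.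
  rewrite (Cc_integral_in c3) => [|x nO]; last first.
    by rewrite (test_function_partial_off k tpsi nO) expr0n.
  by rewrite -EFinM lee_fin; exact: poincare_test tpsi.
have p1 (x : T) : D x -> phi x ^+ 2 <= 2 * psi x ^+ 2 + 2 * X x.
  move=> _; have := sum_sqr_ge0 (fun j => partial j psi x - G j x).
  have := sqr_ge0 (psi x + (psi x - phi x)); rewrite /X; nra.
have p2 (x : T) : D x -> partial k psi x ^+ 2 <= 2 * S x + 2 * X x.
  move=> _; have h (F : 'I_N -> R) : F k ^+ 2 <= \sum_(j < N) F j ^+ 2.
    by rewrite (bigD1 k)//= lerDl sumr_ge0// => i _; exact: sqr_ge0.
  have := h (fun j => G j x); have := h (fun j => partial j psi x - G j x).
  have := sqr_ge0 (psi x - phi x).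
  have := sqr_ge0 (partial k psi x - 2 * (partial k psi x - G k x)); rewrite /X /S /=; nra.
have := @le_integral_transfer _ T R lambda D mO _ _ _ S X (4 * B ^+ 2) e C0 e0
  mphi2 mpsi2 mp2 mS mX (fun x => sqr_ge0 _) (fun x => sqr_ge0 _) (fun x => sqr_ge0 _)
  S0 X0 p1 p2 h2 hpsi.
by rewrite mulrA -natrM.
Qed.

Lemma lambda1_gt0 (Omega : set V) : (0 < N)%N -> open Omega -> bounded_set Omega ->
  exists2 c : R, 0 < c & (c%:E <= lambda1 Omega)%E.
Proof.
move=> N0 oO bO; have [B B0 hB] := bounded_enorm bO.
pose k := Ordinal N0.
have hk x : Omega x -> `|x 0 k| <= B by move=> /hB; apply: le_trans; exact: coord_le_enorm.
have C0 : 0 < 16 * B ^+ 2 by rewrite mulr_gt0 ?exprn_gt0.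
exists (16 * B ^+ 2)^-1; first by rewrite invr_gt0.
apply: le_ereal_inf_tmp => _ [phi [G [sG nz ->]]].
have mO : measurable (Omega : set (lebesgueType R N)).
  by apply: borel_Lebesgue_measurable; exact: open_measurable_rV.
have := poincare_sobolev12_0 B0 oO hk sG.
have [[[mphi phioo] _] _] := sG.
have phi0 : (0 <= \int[lambda]_(x in Omega) (phi x ^+ 2)%:E)%E.
  by apply: integral_ge0 => x _; rewrite lee_fin sqr_ge0.
have phin0 : (\int[lambda]_(x in Omega) (phi x ^+ 2)%:E != 0)%E.
  apply/eqP => E0; apply: nz.
  exact: (@integral_sqr_eq0 _ _ _ lambda (Omega : set (lebesgueType R N)) mO phi mphi E0).
move: phi0 phin0 phioo.
set P := (\int[lambda]_(x in Omega) (phi x ^+ 2)%:E)%E.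
set Q := (\int[lambda]_(x in Omega) (\sum_(j < N) G j x ^+ 2)%:E)%E.
clearbody P Q; case: P => [p||]//=.
rewrite lee_fin eqe => p0 pn0 _ h.
have pp : 0 < p by rewrite lt0r pn0.
by rewrite inver (negPf pn0) lee_pdivlMr// lee_pdivrMl.
Qed.

End first_eigenvalue_positive.

(** * The Caccioppoli estimate *)

Section caccioppoli.
Context (R : realType) (N : nat).
Local Notation V := 'rV[R]_N.
Implicit Types (chi u F G : V -> R).

(** Pointwise, |grad (chi u)|^2 = u^2 |grad chi|^2 + div (chi^2 u grad u)
    - chi^2 u Delta u. The divergence integrates to 0 and the last term has a sign. *)
Lemma caccioppoli chi u : smooth chi -> bounded_support chi -> smooth u ->
  (forall x, chi x != 0 -> 0 <= u x * \sum_k partial k (partial k u) x) ->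
  integral_rV (fun x => \sum_k partial k (fun y => chi y * u y) x ^+ 2) <=
  integral_rV (fun x => u x ^+ 2 * \sum_k partial k chi x ^+ 2).
Proof.
move=> schi bchi su hL.
have su' k : smooth (partial k u) by exact: smooth_partial.
pose W k x := chi x * chi x * (u x * partial k u x).
have sW k : smooth (W k).
  by apply: smoothM; [exact: smoothM|exact: smoothM].
have cW k : C1c (W k).
  by apply: smooth_C1c => //; apply/bounded_supportM/bounded_supportM.
have dchi x : differentiable chi x by exact: smooth_differentiable.
have du x : differentiable u x by exact: smooth_differentiable.
have du' k x : differentiable (partial k u) x by exact: smooth_differentiable.
have cS : Cc (fun x => \sum_k partial k (fun y => chi y * u y) x ^+ 2).
  apply: Cc_sum => k _; under eq_fun do rewrite expr2.
  have ck : Cc (partial k (fun y => chi y * u y)).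
    apply: C1c_partial; apply: smooth_C1c; first exact: smoothM.
    exact: bounded_supportM.
  by apply: CcMr => //; exact: ck.1.
have cT : Cc (fun x => u x ^+ 2 * \sum_k partial k chi x ^+ 2).
  apply: CcMl.
    by under eq_fun do rewrite expr2; apply: continuous_mul; exact: smooth_continuous.
  apply: Cc_sum => k _; under eq_fun do rewrite expr2.
  have ck : Cc (partial k chi) by apply: C1c_partial; exact: smooth_C1c.
  by apply: CcMr => //; exact: ck.1.
have cD : Cc (fun x => \sum_k partial k (W k) x).
  by apply: Cc_sum => k _; exact: C1c_partial.
have I0 : integral_rV (fun x => \sum_k partial k (W k) x) = 0.
  rewrite integral_rV_sum => [|k _]; last exact: C1c_partial.
  by rewrite big1// => k _; exact: integral_partial.
rewrite -[leRHS]addr0 -[X in _ <= _ + X]I0 -integral_rVD//.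
apply: le_integral_rV => //; first exact: CcD.
move=> x.
have -> : \sum_k partial k (fun y => chi y * u y) x ^+ 2 =
    u x ^+ 2 * (\sum_k partial k chi x ^+ 2) + \sum_k partial k (W k) x
    - chi x ^+ 2 * (u x * \sum_k partial k (partial k u) x).
  rewrite !mulr_sumr -big_split/= -sumrB; apply: eq_bigr => k _.
  rewrite /W partialM_pt// partialM_pt; [|exact: differentiableM..].
  rewrite partialM_pt// partialM_pt//; ring.
rewrite gerBl; have [->|cx] := eqVneq (chi x) 0; first by rewrite expr0n mul0r.
by rewrite mulr_ge0 ?sqr_ge0 ?hL.
Qed.

End caccioppoli.

(** * Subharmonicity of powers of the modulus *)

Section log_subharmonic.
Context (R : realType) (n : nat).
Local Notation V := 'rV[R]_(n + n).

(** For a pair of real functions and at a single point, so that it applies to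
    mollifications and cutoffs of f, which are holomorphic only near E. *)
Definition cauchy_riemann (a b : V -> R) (x : V) : Prop := forall j : 'I_n,
  partial (lshift n j) a x = partial (rshift n j) b x /\
  partial (rshift n j) a x = - partial (lshift n j) b x.

Lemma powR_sub1 (v : R) (s : R) : 0 < v -> v `^ (s - 1) = v `^ s / v.
Proof.
move=> v0; rewrite powRB; last by rewrite (gt_eqF v0) implybT.
by rewrite powRr1// ltW.
Qed.

(** The positive e removes the zeros of f, where a power of |f|^2 is not smooth. *)
Definition reg_modulus (a b : V -> R) (e s : R) : V -> R :=
  fun y => (a y ^+ 2 + b y ^+ 2 + e) `^ s.

(** This is the subharmonicity of |f|^p, regularised at the zeros of f. With
    f = a + i b, the Laplacian of (|f|^2 + e)^s is a sum over the complex
    coordinates of 4 s (|f|^2 + e)^(s - 2) |f'|^2 (s |f|^2 + e). *)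
Lemma laplacian_powR_ge0 (a b : V -> R) (e s : R) (x : V) :
  smooth a -> smooth b -> 0 < e -> 0 <= s ->
  cauchy_riemann a b x ->
  (forall j, partial (lshift n j) (partial (lshift n j) a) x +
             partial (rshift n j) (partial (rshift n j) a) x = 0) ->
  (forall j, partial (lshift n j) (partial (lshift n j) b) x +
             partial (rshift n j) (partial (rshift n j) b) x = 0) ->
  0 <= reg_modulus a b e s x * \sum_k partial k (partial k (reg_modulus a b e s)) x.
Proof.
move=> sa sb e0 s0 CR ha hb; set u := reg_modulus a b e s.
pose v y := a y ^+ 2 + b y ^+ 2 + e.
have v0 y : 0 < v y by rewrite ltr_wpDl// addr_ge0 ?sqr_ge0.
have da y : differentiable a y by exact: smooth_differentiable.
have db y : differentiable b y by exact: smooth_differentiable.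
have dpa k y : differentiable (partial k a) y by apply: smooth_differentiable; exact: smooth_partial.
have dpb k y : differentiable (partial k b) y by apply: smooth_differentiable; exact: smooth_partial.
have sv : smooth v.
  rewrite /v; under eq_fun do rewrite !expr2.
  by apply: smoothD; [apply: smoothD; exact: smoothM|exact: smooth_cst].
have dv y : differentiable v y by exact: smooth_differentiable.
have pv k : partial k v = fun y => 2 * (a y * partial k a y + b y * partial k b y).
  rewrite /v; under eq_fun do rewrite !expr2.
  rewrite partialD => [|y|y]; [|by apply: differentiableD; exact: differentiableM|exact: differentiable_cst].
  rewrite partialD => [|y|y]; [|exact: differentiableM..].
  rewrite partial_cst !partialM//; apply/funext => y; ring.
have dpv k y : differentiable (partial k v) y by apply: smooth_differentiable; exact: smooth_partial.
have ppv k y : partial k (partial k v) y = 2 * (partial k a y ^+ 2 + a y * partial k (partial k a) y +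
    (partial k b y ^+ 2 + b y * partial k (partial k b) y)).
  have d1 z : differentiable (fun z => a z * partial k a z) z by exact: differentiableM.
  have d2 z : differentiable (fun z => b z * partial k b z) z by exact: differentiableM.
  have d3 z : differentiable (fun z => a z * partial k a z + b z * partial k b z) z by exact: differentiableD.
  rewrite pv partialM_pt//.
  have E1 : partial k (fun z => a z * partial k a z) y =
    partial k a y * partial k a y + a y * partial k (partial k a) y by exact: partialM_pt.
  have E2 : partial k (fun z => b z * partial k b z) y =
    partial k b y * partial k b y + b y * partial k (partial k b) y by exact: partialM_pt.
  rewrite partial_cst (partialD k d1 d2) E1 E2 mul0r add0r.
  move: (partial k (partial k a) y) (partial k (partial k b) y) => A B.
  by move: (partial k a y) (partial k b y) (a y) (b y) => *; ring.
have dpow (r t : R) : 0 < t -> is_derive t 1 (fun t => t `^ r) (r * t `^ (r - 1)).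
  move=> t0; apply: DeriveDef; first by apply: derivable_powR; rewrite in_itv/= t0.
  by rewrite -derive1E powR_derive1// in_itv/= t0.
have ppow k r y : differentiable (fun y => v y `^ r) y /\
    partial k (fun y => v y `^ r) y = r * v y `^ (r - 1) * partial k v y.
  by apply: (partial_comp k (g := fun t => t `^ r) (dg := fun t => r * t `^ (r - 1)) (dv y)); exact: dpow.
have pu k : partial k u = fun y => s * (v y `^ (s - 1) * partial k v y).
  by apply/funext => y; rewrite /u (ppow k s y).2 mulrA.
have ppu k : partial k (partial k u) x =
    s * v x `^ (s - 2) * ((s - 1) * partial k v x ^+ 2 + v x * partial k (partial k v) x).
  have d1 y : differentiable (fun z => v z `^ (s - 1)) y by exact: (ppow k (s - 1) y).1.
  have d2 y : differentiable (fun z => v z `^ (s - 1) * partial k v z) y by exact: differentiableM.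
  rewrite pu partialM_pt//.
  rewrite partial_cst partialM_pt// (ppow k (s - 1) x).2.
  have -> : s - 1 - 1 = s - 2 by ring.
  have -> : v x `^ (s - 1) = v x `^ (s - 2) * v x.
    have -> : s - 2 = (s - 1) - 1 by ring.
    by rewrite (powR_sub1 (s - 1) (v0 x)) divfK// gt_eqF.
  by ring.
rewrite mulr_ge0 ?powR_ge0//.
rewrite (eq_bigr _ (fun k _ => ppu k)) -mulr_sumr.
rewrite mulr_ge0 ?mulr_ge0 ?powR_ge0//.
rewrite big_split_ord/= -big_split/= sumr_ge0// => j _.
rewrite !ppv !pv.
have [c1 c2] := CR j; have := ha j; have := hb j.
rewrite c1 c2; move: (partial (rshift n j) b x) (partial (lshift n j) b x) => P Q.
move: (partial (lshift n j) (partial (lshift n j) a) x) => A1.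
move: (partial (rshift n j) (partial (rshift n j) a) x) => A2.
move: (partial (lshift n j) (partial (lshift n j) b) x) => B1.
move: (partial (rshift n j) (partial (rshift n j) b) x) => B2.
move=> /eqP; rewrite addr_eq0 => /eqP ->; move=> /eqP; rewrite addr_eq0 => /eqP ->.
(* The harmonicity of a and b cancels the second derivatives. *)
have -> : (s - 1) * (2 * (a x * P + b x * Q)) ^+ 2 +
    v x * (2 * (P ^+ 2 + a x * - A2 + (Q ^+ 2 + b x * - B2))) +
   ((s - 1) * (2 * (a x * - Q + b x * P)) ^+ 2 +
    v x * (2 * ((- Q) ^+ 2 + a x * A2 + (P ^+ 2 + b x * B2)))) =
   4 * (P ^+ 2 + Q ^+ 2) * (s * (a x ^+ 2 + b x ^+ 2) + e).
  by rewrite /v; move: (a x) (b x) => *; ring.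
apply: mulr_ge0; first by rewrite mulr_ge0// addr_ge0 ?sqr_ge0.
by rewrite addr_ge0 ?(ltW e0)// mulr_ge0// addr_ge0 ?sqr_ge0.
Qed.

End log_subharmonic.

(** * Localisation by cutoffs *)

Section localisation.
Context (R : realType) (N : nat).
Local Notation V := 'rV[R]_N.

Lemma near_eq_partial (F G : V -> R) k (x : V) : nbhs x [set y | F y = G y] ->
  partial k F x = partial k G x.
Proof. exact: near_eq_derive. Qed.

Lemma near_eq_near_partial (F G : V -> R) k (x : V) : nbhs x [set y | F y = G y] ->
  nbhs x [set y | partial k F y = partial k G y].
Proof. by move=> /nbhs_interior; apply: filterS => y; exact: near_eq_partial. Qed.

Lemma near_eq_continuous (F G : V -> R) (x : V) : nbhs x [set y | F y = G y] ->
  {for x, continuous F} -> {for x, continuous G}.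
Proof.
move=> FG; have FGx : F x = G x by exact: nbhs_singleton FG.
rewrite /prop_for /continuous_at -FGx => cF.
by move=> A /cF; apply: filterS2 FG => y /= ->.
Qed.

(** Differentials are unique, so it suffices to transport the first-order expansion. *)
Lemma near_eq_differentiable (F G : V -> R) (x : V) : nbhs x [set y | F y = G y] ->
  differentiable F x -> differentiable G x.
Proof.
move=> FG dF; have FGx : F x = G x by exact: nbhs_singleton FG.
have [cdF eF] := (diff_locallyP _ _).1 dF.
have FG0 : nbhs (0 : V) [set h | F (h + x) = G (h + x)].
  move: FG => /nbhs_ballP[r /= r0 hr]; apply/nbhs_ballP; exists r => //= h.
  rewrite -ball_normE /ball_/= sub0r normrN => hlt; apply: hr.
  by rewrite -ball_normE /ball_/= opprD addrCA subrr addr0 normrN.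
have eG : G \o shift x = cst (G x) + 'd F x +o_ (0 : V) id.
  apply/eqaddoP => e e0; have /eqaddoP /(_ e e0) := eF.
  apply: filterS2 FG0 => h /= FGh.
  by rewrite -[G \o _ - _]/(fun h => G (h + x) - (G x + 'd F x h)) /= -FGx -FGh.
by apply/diff_locallyP; rewrite (diff_unique cdF eG).
Qed.

(** Off Omega the product vanishes in a neighbourhood of the point, whatever the
    values of u are there. *)
Lemma C1c_cutoff (Omega : set V) (u kappa : V -> R) : open Omega ->
  (forall x, Omega x -> differentiable u x) ->
  (forall x k, Omega x -> {for x, continuous (partial k u)}) ->
  test_function Omega kappa -> C1c (fun x => u x * kappa x).
Proof.
move=> oO du cu tk.
have sk : smooth kappa by case: tk.
have dk x : differentiable kappa x by exact: smooth_differentiable.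
split.
- move=> x; have [Ox|nOx] := pselect (Omega x).
    by apply: differentiableM => //; exact: du.
  apply: (@near_eq_differentiable (fun=> 0)); last exact: differentiable_cst.
  by have := near_off_test tk nOx; apply: filterS => y /= ->; rewrite mulr0.
- move=> k x; have [Ox|nOx] := pselect (Omega x).
    apply: (@near_eq_continuous (fun y => partial k u y * kappa y + u y * partial k kappa y)).
      have : nbhs x Omega by exact: open_nbhs_nbhs.
      by apply: filterS => y Oy /=; rewrite partialM_pt//; exact: du.
    apply: continuousD; apply: continuousM.
    + exact: cu.
    + exact: smooth_continuous.
    + by apply: differentiable_continuous; exact: du.
    + by apply: smooth_continuous; exact: smooth_partial.
  apply: (@near_eq_continuous (fun=> 0)); last exact: cst_continuous.
  have : nbhs x [set y | (fun=> 0 : R) y = u y * kappa y].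
    by have := near_off_test tk nOx; apply: filterS => y /= ->; rewrite mulr0.
  move=> /(near_eq_near_partial k); apply: filterS => y /= <-.
  by rewrite (partial_cst k (0 : R)).
- by apply: bounded_supportMr; exact: test_function_bounded_support tk.
Qed.

End localisation.

(** * Mollified holomorphic functions *)

Section mollified_holomorphic.
Context (R : realType) (n : nat).
Local Notation V := 'rV[R]_(n + n).
Implicit Types (F G rho : V -> R) (x y : V).

(** One derivative falls on F and the other one on the kernel. This symmetry of
    second derivatives makes mollified holomorphic functions harmonic. *)
Lemma convol_partialC F rho k l : C1c F -> smooth rho -> bounded_support rho ->
  partial k (partial l (convol F rho)) = partial l (partial k (convol F rho)).
Proof.
move=> c1 sr br; have cF := C1c_Cc c1.
have sr' : smooth (partial k rho) by exact: smooth_partial.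
have br' : bounded_support (partial k rho) by exact: bounded_support_partial.
rewrite partial_convoll// partial_convolr//; last exact: C1c_partial.
by rewrite [in RHS]partial_convolr// partial_convoll.
Qed.

Lemma convol_cauchy_riemann F G rho x : C1c F -> C1c G -> smooth rho ->
  bounded_support rho -> (forall y, rho (x - y) != 0 -> cauchy_riemann F G y) ->
  cauchy_riemann (convol F rho) (convol G rho) x.
Proof.
move=> cF cG sr br h j.
have E k H (cH : C1c H) : partial k (convol H rho) = convol (partial k H) rho.
  exact: partial_convoll.
rewrite (E _ _ cF) (E _ _ cG) (E _ _ cF) (E _ _ cG).
have cr : continuous rho by exact: smooth_continuous.
rewrite -[X in _ /\ _ = X]/(- integral_rV (fun y => _)).
rewrite -integral_rVN; last by apply: convol_integrand_Cc => //; exact: C1c_partial.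
split; congr integral_rV; apply/funext => y;
  have [->|r0] := eqVneq (rho (x - y)) 0; rewrite ?mulr0 ?oppr0//.
- by have [-> _] := h y r0 j.
- by have [_ ->] := h y r0 j; rewrite mulNr.
Qed.

Lemma cauchy_riemann_harmonic (a b : V -> R) (U : set V) x : open U -> U x ->
  smooth a -> smooth b ->
  (forall k l, partial k (partial l a) = partial l (partial k a)) ->
  (forall k l, partial k (partial l b) = partial l (partial k b)) ->
  (forall y, U y -> cauchy_riemann a b y) -> forall j,
  partial (lshift n j) (partial (lshift n j) a) x +
    partial (rshift n j) (partial (rshift n j) a) x = 0 /\
  partial (lshift n j) (partial (lshift n j) b) x +
    partial (rshift n j) (partial (rshift n j) b) x = 0.
Proof.
move=> oU Ux sa sb ca cb CR j.
have nU : nbhs x U by exact: open_nbhs_nbhs.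
have da k y : differentiable (partial k a) y by apply: smooth_differentiable; exact: smooth_partial.
have db k y : differentiable (partial k b) y by apply: smooth_differentiable; exact: smooth_partial.
have e1 k : partial k (partial (lshift n j) a) x = partial k (partial (rshift n j) b) x.
  by apply: near_eq_partial; apply: filterS nU => y /CR/(_ j)[].
have e2 k : partial k (partial (rshift n j) a) x = - partial k (partial (lshift n j) b) x.
  rewrite (@near_eq_partial _ _ _ (fun y => - partial (lshift n j) b y)); last first.
    by apply: filterS nU => y /CR/(_ j)[].
  by rewrite partialN.
split; first by rewrite e1 e2 cb subrr.
have := e2 (lshift n j); have := e1 (rshift n j); rewrite ca => <- e.
by rewrite -[X in X + _]opprK -e addNr.
Qed.

Lemma reg_modulus_smooth (a b : V -> R) (e s : R) : smooth a -> smooth b -> 0 < e ->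
  smooth (reg_modulus a b e s).
Proof.
move=> sa sb e0; apply: smooth_powR.
  by move=> x; rewrite ltr_wpDl// addr_ge0 ?sqr_ge0.
under eq_fun do rewrite !expr2.
by apply: smoothD; [apply: smoothD; exact: smoothM|exact: smooth_cst].
Qed.

(** The product of chi and of the regularised modulus u is a test function, and u is
    subharmonic near the support of chi: compare the eigenvalue bound with the
    Caccioppoli estimate. *)
Lemma mollified_inequality (Omega E : set V) (F G chi rho : V -> R) (L e s t d : R) :
  open Omega -> E !=set0 -> (L%:E <= lambda1 Omega)%E -> 0 < e -> 0 <= s ->
  C1c F -> C1c G -> smooth rho -> bounded_support rho ->
  (forall y, rho y != 0 -> enorm y < d) ->
  (forall y, sdist E y < t + d -> cauchy_riemann F G y) ->
  test_function Omega chi -> (forall y, chi y != 0 -> sdist E y < t) ->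
  L * integral_rV (fun y => chi y ^+ 2 * reg_modulus (convol F rho) (convol G rho) e s y ^+ 2) <=
    integral_rV (fun y => reg_modulus (convol F rho) (convol G rho) e s y ^+ 2 *
      \sum_k partial k chi y ^+ 2).
Proof.
move=> oO E0 hL e0 s0 cF cG sr br rd CR tchi hchi.
pose a := convol F rho; pose b := convol G rho.
have sa : smooth a by apply: smooth_convol => //; exact: C1c_Cc.
have sb : smooth b by apply: smooth_convol => //; exact: C1c_Cc.
have schi : smooth chi by case: tchi.
have bchi := test_function_bounded_support tchi.
pose U := [set y | sdist E y < t].
have oU : open U.
  have -> : U = sdist E @^-1` [set r | r < t] by [].
  by apply: open_comp; [move=> y _; exact: sdist_continuous|exact: open_lt].
have CRab y : U y -> cauchy_riemann a b y.
  move=> Uy; apply: convol_cauchy_riemann => // z /rd yz; apply: CR.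
  have := sdist_triangle z y E0; rewrite (enormB z y); move: Uy; rewrite /U /=; lra.
have ha y : U y -> _ := fun Uy => cauchy_riemann_harmonic oU Uy sa sb
  (fun k l => convol_partialC k l cF sr br) (fun k l => convol_partialC k l cG sr br) CRab.
pose u := reg_modulus a b e s.
have su : smooth u by exact: reg_modulus_smooth.
have hu x : chi x != 0 -> 0 <= u x * \sum_k partial k (partial k u) x.
  move=> /hchi Ux; apply: (laplacian_powR_ge0 sa sb e0 s0 (CRab _ Ux)) => j.
  - by have [] := ha _ Ux j.
  - by have [] := ha _ Ux j.
have tphi : test_function Omega (fun y => chi y * u y).
  have [_ cc cO] := tchi.
  have sub : [set x | chi x * u x != 0] `<=` [set x | chi x != 0].
    by move=> x /=; rewrite mulf_eq0 negb_or => /andP[].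
  split; first exact: smoothM.
  - apply: (@subclosed_compact _ _ (closure [set x | chi x != 0])) => //.
      exact: closed_closure.
    exact: closureS.
  - by apply: subset_trans cO; exact: closureS.
have := lambda1_test oO hL tphi; have := caccioppoli schi bchi su hu.
move=> h1 h2; apply: le_trans (le_trans h2 h1).
by under [in leRHS]eq_fun do rewrite exprMn.
Qed.

End mollified_holomorphic.

(** * Continuity of powers *)

Section powers.
Context (R : realType).

(** The absolute value makes this continuous on the whole line, in particular at
    the zeros of |f|^2. *)
Lemma continuous_norm_powR (a : R) : 0 < a -> continuous (fun t : R => `|t| `^ a).
Proof.
move=> a0 t; have [->|t0] := eqVneq t 0; last first.
  apply: (@continuous_comp _ _ _ (fun t : R => `|t|) (fun t : R => t `^ a)).
    exact: norm_continuous.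
  apply: differentiable_continuous; apply/derivable1_diffP.
  by apply: derivable_powR; rewrite in_itv/= andbT normr_gt0.
apply/cvgrPdist_lt => e e0; near=> y.
rewrite normr0 powR0 ?gt_eqF// sub0r normrN ger0_norm ?powR_ge0//.
have -> : e = (e `^ a^-1) `^ a by rewrite -powRrM mulVf ?gt_eqF// powRr1// ltW.
rewrite gt0_ltr_powR// ?nnegrE ?powR_ge0//.
have : `|0 - y| < e `^ a^-1.
  by near: y; apply: cvgr_dist_lt => //; rewrite powR_gt0.
by rewrite sub0r normrN.
Unshelve. all: by end_near.
Qed.

Lemma sqr_powR (v s : R) : (v `^ s) ^+ 2 = v `^ (s * 2).
Proof. by rewrite powRrM powR_mulrn ?powR_ge0. Qed.

End powers.

(** * Removal of the regularisation *)

Section limit.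
Context (R : realType) (n : nat).
Local Notation V := 'rV[R]_(n + n).
Implicit Types (F G rho : V -> R) (x y : V).

Lemma continuous_modulus_powR F G (a : R) : 0 < a -> continuous F -> continuous G ->
  continuous (fun y => `|F y ^+ 2 + G y ^+ 2| `^ a).
Proof.
move=> a0 cF cG.
have c2 : continuous (fun y => F y ^+ 2 + G y ^+ 2).
  under eq_fun do rewrite !expr2.
  by apply: continuous_add; exact: continuous_mul.
move=> y; apply: (@continuous_comp _ _ _ (fun y => F y ^+ 2 + G y ^+ 2)
  (fun t : R => `|t| `^ a)); [exact: c2|exact: continuous_norm_powR].
Qed.

(** Let the mollification radius and the regularisation tend to zero together. *)
Lemma eigenvalue_inequality (Omega E : set V) (F G chi : V -> R) (L s t d : R) :
  open Omega -> E !=set0 -> bounded_set E -> (L%:E <= lambda1 Omega)%E -> 0 < s -> 0 < d ->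
  C1c F -> C1c G ->
  (forall y, sdist E y < t + d -> cauchy_riemann F G y) ->
  test_function Omega chi -> (forall y, chi y != 0 -> sdist E y < t) ->
  L * integral_rV (fun y => chi y ^+ 2 * `|F y ^+ 2 + G y ^+ 2| `^ (s * 2)) <=
    integral_rV (fun y => `|F y ^+ 2 + G y ^+ 2| `^ (s * 2) * \sum_k partial k chi y ^+ 2).
Proof.
move=> oO E0 bE hL s0 d0 cF cG CR tchi hchi.
have s20 : 0 < s * 2 by rewrite mulr_gt0.
pose e m : R := m.+1%:R^-1.
have e0 m : 0 < e m by rewrite invr_gt0.
have e1 m : e m <= 1 by rewrite invf_le1// ler1n.
pose r m : R := d * e m.
have r0 m : 0 < r m by rewrite mulr_gt0.
have rd m : r m <= d by rewrite ler_piMr// ltW.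
pose rho m := projT1 (cid (@mollifier R (n + n) (r m) (r0 m))).
have hrho m : [/\ smooth (rho m), bounded_support (rho m), forall x, 0 <= rho m x,
     forall x, rho m x != 0 -> enorm x < r m &
     forall x, integral_rV (fun y => rho m (x - y)) = 1] by rewrite /rho; case: cid.
have CF := C1c_Cc cF; have CG := C1c_Cc cG.
have crho m : Cc (rho m).
  by have [h1 h2 _ _ _] := hrho m; split => //; exact: smooth_continuous.
have near H (c M : R) m x : Cc H -> (forall y, enorm (x - y) < r m -> `|H y - c| <= M) ->
    `|convol H (rho m) x - c| <= M.
  move=> CH h; have [h1 h2 h3 h4 h5] := hrho m.
  have := @convol_near R (n + n) H (rho m) c M x CH (crho m) h3.
  by rewrite h5 !mulr1; apply => y /h4; exact: h.
have lim H x : Cc H -> (fun m => convol H (rho m) x) @ \oo --> H x.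
  move=> CH; apply/cvgrPdist_le => eps eps0.
  have cH : H y @[y --> x] --> H x by exact: CH.1.
  have /(@cvgr_dist_le _ _ _ _ (nbhs_filter x)) /(_ _ eps0) := cH.
  move=> /nbhs_ballP[q /= q0 hq].
  have : \forall m \near \oo, e m < q / d.
    have := @cvg_harmonic R => /cvgr0_norm_lt /(_ _ (divr_gt0 q0 d0)).
    by apply: filterS => m; rewrite /harmonic/= ger0_norm// ltW.
  apply: filterS => m; rewrite ltr_pdivlMr// mulrC => rq.
  rewrite distrC; apply: near => // y xy; rewrite distrC; apply: hq.
  rewrite -ball_normE /ball_/=; apply: le_lt_trans (norm_le_enorm _) _.
  exact: lt_trans xy rq.
have [MF MF0 hMF] := Cc_bounded CF; have [MG MG0 hMG] := Cc_bounded CG.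
have bound H M m x : Cc H -> (forall y, `|H y| <= M) -> `|convol H (rho m) x| <= M.
  move=> CH hM; rewrite -[convol _ _ _]subr0; apply: near => // y _.
  by rewrite subr0.
pose W m y := reg_modulus (convol F (rho m)) (convol G (rho m)) (e m) s y ^+ 2.
pose w y := `|F y ^+ 2 + G y ^+ 2| `^ (s * 2).
pose M := (MF ^+ 2 + MG ^+ 2 + 1) `^ (s * 2).
have WE m y : W m y =
    `|convol F (rho m) y ^+ 2 + convol G (rho m) y ^+ 2 + e m| `^ (s * 2).
  by rewrite /W /reg_modulus sqr_powR ger0_norm// addr_ge0 ?addr_ge0 ?sqr_ge0// ltW.
have W0 m y : 0 <= W m y by exact: sqr_ge0.
have Wb m y : W m y <= M.
  have sq H K : Cc H -> 0 < K -> (forall y, `|H y| <= K) ->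
      convol H (rho m) y ^+ 2 <= K ^+ 2.
    move=> CH K0 hK; rewrite -[leLHS]real_normK ?num_real//.
    by rewrite lerXn2r ?nnegrE ?(ltW K0)//; exact: bound.
  have v0 : 0 <= convol F (rho m) y ^+ 2 + convol G (rho m) y ^+ 2 + e m.
    by rewrite addr_ge0 ?(ltW (e0 m))// addr_ge0 ?sqr_ge0.
  rewrite WE /M ger0_norm// ge0_ler_powR ?nnegrE ?(ltW s20)//.
    by rewrite addr_ge0// addr_ge0 ?sqr_ge0.
  by rewrite lerD// lerD//; exact: sq.
have sW m : smooth (W m).
  have [h1 h2 _ _ _] := hrho m.
  rewrite /W; under eq_fun do rewrite expr2.
  by apply: smoothM; apply: reg_modulus_smooth => //; exact: smooth_convol.
have cWm m : continuous (W m) by exact: smooth_continuous.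
have cw : continuous w.
  by apply: continuous_modulus_powR => //; [exact: CF.1|exact: CG.1].
have Wlim y : (fun m => W m y) @ \oo --> w y.
  under eq_fun do rewrite WE.
  apply: (@cvg_comp _ _ _ (fun m => convol F (rho m) y ^+ 2 + convol G (rho m) y ^+ 2 + e m)
    (fun t : R => `|t| `^ (s * 2)) _ (nbhs (F y ^+ 2 + G y ^+ 2))).
    rewrite -[F y ^+ 2 + G y ^+ 2]addr0; apply: cvgD; last exact: cvg_harmonic.
    apply: cvgD; rewrite expr2; under eq_fun do rewrite expr2; apply: cvgM; exact: lim.
  exact: continuous_norm_powR.
have schi : smooth chi by case: tchi.
have bchi := test_function_bounded_support tchi.
pose A y := chi y ^+ 2.
pose B y := \sum_k partial k chi y ^+ 2.
have CA : Cc A.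
  rewrite /A; under eq_fun do rewrite expr2.
  by apply: CcMl; [exact: smooth_continuous|split => //; exact: smooth_continuous].
have CB : Cc B.
  apply: Cc_sum => k _; under eq_fun do rewrite expr2.
  have ck : Cc (partial k chi) by apply: C1c_partial; exact: smooth_C1c.
  by apply: CcMr => //; exact: ck.1.
have limI H : Cc H -> (fun m => integral_rV (fun y => H y * W m y)) @ \oo -->
    integral_rV (fun y => H y * w y).
  move=> CH; have [MH MH0 hMH] := Cc_bounded CH; have [K K0 hK] := bounded_supportW CH.2.
  apply: (@integral_rV_cvg _ _ _ _ (MH * M) K) => //.
  - by move=> m; apply: continuous_mul; [exact: CH.1|exact: cWm].
  - by apply: continuous_mul; [exact: CH.1|exact: cw].
  - by move=> m x; rewrite normrM ler_pM// ger0_norm.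
  - by move=> m x /hK ->; rewrite mul0r.
  - by move=> x; apply: cvgM; [exact: cvg_cst|exact: Wlim].
have lA := limI A CA.
have lB := limI B CB.
have -> : integral_rV (fun y => `|F y ^+ 2 + G y ^+ 2| `^ (s * 2) * \sum_k partial k chi y ^+ 2) =
    integral_rV (fun y => B y * w y) by congr integral_rV; apply/funext => y; rewrite mulrC.
have lA' : (fun m => L * integral_rV (fun y => A y * W m y)) @ \oo -->
   L * integral_rV (fun y => A y * w y) by apply: cvgM => //; exact: cvg_cst.
apply: (ler_cvg_to lA' lB); apply: nearW => m.
have [h1 h2 h3 h4 h5] := hrho m.
have := @mollified_inequality R n Omega E F G chi (rho m) L (e m) s t (r m) oO E0 hL (e0 m)
  (ltW s0) cF cG h1 h2 h4 _ tchi hchi.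
have -> : integral_rV (fun y => W m y * B y) = integral_rV (fun y => B y * W m y).
  by congr integral_rV; apply/funext => y; rewrite mulrC.
by apply => y yr; apply: CR; apply: lt_le_trans yr _; rewrite lerD2l.
Qed.

End limit.

(** * Masses on a set and on its complement *)

Section mass_splitting.
Context d (T : measurableType d) (R : realType) (mu : {measure set T -> \bar R}).
Implicit Types (A D E : set T) (h G : T -> R).

(** From here on everything is expressed by two real numbers, the mass on E and
    the mass on its complement. *)
Lemma integral_split D E h : measurable D -> measurable E -> E `<=` D ->
  measurable_fun D h -> (forall x, 0 <= h x) ->
  (\int[mu]_(x in D) (h x)%:E < +oo)%E ->
  exists m r : R, [/\ (0 <= m)%R, (0 <= r)%R, \int[mu]_(x in E) (h x)%:E = m%:E,
    \int[mu]_(x in D `\` E) (h x)%:E = r%:E &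
    \int[mu]_(x in D) (h x)%:E = (m + r)%:E]%E.
Proof.
move=> mD mE ED mh h0 hoo.
have mDE : measurable (D `\` E) by exact: measurableD.
have DE : D = E `|` (D `\` E).
  apply/seteqP; split => [x Dx|x [/ED//|[]//]].
  by have [Ex|nEx] := pselect (E x); [left|right].
have mEh : measurable_fun D (EFin \o h) by exact/measurable_EFinP.
have hU : (\int[mu]_(x in D) (h x)%:E =
    \int[mu]_(x in E) (h x)%:E + \int[mu]_(x in D `\` E) (h x)%:E)%E.
  rewrite [in LHS]DE ge0_integral_setU//.
  - by rewrite -DE.
  - by move=> x _; rewrite lee_fin.
  - by apply/disj_setPRL => x [].
have a0 : (0 <= \int[mu]_(x in E) (h x)%:E)%E by apply: integral_ge0 => x _; rewrite lee_fin.
have b0 : (0 <= \int[mu]_(x in D `\` E) (h x)%:E)%E by apply: integral_ge0 => x _; rewrite lee_fin.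
move: hoo a0 b0; rewrite hU.
set a := (\int[mu]_(x in E) (h x)%:E)%E; set b := (\int[mu]_(x in D `\` E) (h x)%:E)%E.
case: a => [m||]//; case: b => [r||]// _; rewrite !lee_fin => m0 r0.
by exists m, r; rewrite EFinD.
Qed.

Lemma integral_le_on A h G : measurable A -> measurable_fun A h ->
  measurable_fun setT G -> (forall x, 0 <= h x) -> (forall x, 0 <= G x) ->
  (forall x, A x -> h x <= G x) ->
  (\int[mu]_(x in A) (h x)%:E <= \int[mu]_x (G x)%:E)%E.
Proof.
move=> mA mh mG h0 G0 hG.
have mEG : measurable_fun setT (EFin \o G) by exact/measurable_EFinP.
apply: (@le_trans _ _ (\int[mu]_(x in A) (G x)%:E)%E).
  apply: ge0_le_integral => //.
  - by move=> x _; rewrite lee_fin.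
  - exact/measurable_EFinP.
  - exact: measurable_funTS.
by apply: ge0_subset_integral => // x _; rewrite lee_fin.
Qed.

Lemma integral_le_supported A h G (c : R) : measurable A -> 0 <= c ->
  measurable_fun A h ->
  measurable_fun setT G -> (forall x, 0 <= h x) -> (forall x, 0 <= G x) ->
  (forall x, ~ A x -> G x = 0) -> (forall x, A x -> G x <= c * h x) ->
  (\int[mu]_x (G x)%:E <= c%:E * \int[mu]_(x in A) (h x)%:E)%E.
Proof.
move=> mA c0 mh mG h0 G0 GA hG.
have mEh : measurable_fun A (EFin \o h) by exact/measurable_EFinP.
have -> : (\int[mu]_x (G x)%:E = \int[mu]_(x in A) (G x)%:E)%E.
  rewrite [RHS]integral_mkcond; apply: eq_integral => x _.
  by rewrite patchE; case: ifPn => // /negP xA; rewrite GA// => Ax; apply: xA; rewrite inE.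
rewrite -(ge0_integralZl mu mA mEh) => [|x _|]; [|by rewrite lee_fin|by rewrite lee_fin].
apply: ge0_le_integral => //.
- by move=> x _; rewrite lee_fin.
- by apply/measurable_EFinP; exact: measurable_funTS.
- exact: measurable_funeM.
Qed.

End mass_splitting.

Section open_measurable.
Context (R : realType) (N : nat).
Local Notation V := 'rV[R]_N.

Lemma open_continuous_measurable (Omega : set V) (g : V -> R) : open Omega ->
  (forall x, Omega x -> {for x, continuous g}) ->
  measurable_fun (Omega : set (lebesgueType R N)) (g : lebesgueType R N -> R).
Proof.
move=> oO cg mO; apply: (measurability _ (RGenOInfty.measurableE R)) => //.
move=> _ [_ [a ->] <-]; apply: borel_Lebesgue_measurable; apply: open_measurable_rV.
rewrite openE => x [Ox gx]; rewrite /interior.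
have n1 : nbhs x Omega by exact: open_nbhs_nbhs.
have n2 : nbhs x (g @^-1` `]a, +oo[).
  by apply: (cg _ Ox); apply: open_nbhs_nbhs; split => //; exact: interval_open.
by apply: filterS2 n1 n2 => y.
Qed.

End open_measurable.

(** * The eigenvalue estimate for holomorphic functions *)

Section holomorphic_mass.
Context (R : realType) (n : nat).
Local Notation V := 'rV[R]_(n + n).
Implicit Types (f : V -> R[i]) (Omega E : set V).

Lemma holomorphic_cauchy_riemann Omega f x : holomorphic Omega f -> Omega x ->
  cauchy_riemann (fun z => complex.Re (f z)) (fun z => complex.Im (f z)) x.
Proof. by move=> hf /hf[]. Qed.

(** The exponent p / 4 * 2 is the shape in which the square of the p / 4-th power of
    |f|^2 appears in the eigenvalue inequality. *)
Lemma normc_powRE (z : R[i]) (p : R) :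
  normc z `^ p = `|complex.Re z ^+ 2 + complex.Im z ^+ 2| `^ (p / 4 * 2).
Proof.
case: z => a b /=; rewrite ger0_norm ?addr_ge0 ?sqr_ge0//.
rewrite -powR12_sqrt ?addr_ge0 ?sqr_ge0// -powRrM; congr (_ `^ _).
by field.
Qed.

Lemma pmass_measurable Omega f (p : R) : open Omega -> 0 < p -> holomorphic Omega f ->
  measurable_fun (Omega : set (lebesgueType R (n + n)))
    (fun z : lebesgueType R (n + n) => normc (f z) `^ p).
Proof.
move=> oO p0 hf; apply: open_continuous_measurable => // x Ox.
have [du dv _ _] := hf _ Ox.
rewrite (_ : (fun z => normc (f z) `^ p) = fun z : V =>
    `|complex.Re (f z) ^+ 2 + complex.Im (f z) ^+ 2| `^ (p / 4 * 2)); last first.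
  by apply/funext => z; rewrite normc_powRE.
apply: (@continuous_comp _ _ _ (fun z : V => complex.Re (f z) ^+ 2 + complex.Im (f z) ^+ 2)
  (fun t : R => `|t| `^ (p / 4 * 2))).
  have c2 (g : V -> R) : {for x, continuous g} -> {for x, continuous (fun z => g z ^+ 2)}.
    move=> cg; rewrite (_ : (fun z => g z ^+ 2) = (fun z => g z * g z)).
      exact: continuousM.
    by apply/funext => z; rewrite expr2.
  by apply: continuousD; apply: c2; exact: differentiable_continuous.
by apply: continuous_norm_powR; rewrite !mulr_gt0// divr_gt0.
Qed.

Lemma pmass_split Omega E f (p : R) : open Omega -> 0 < p -> holomorphic Omega f ->
  Lebesgue_measurable E -> E `<=` Omega -> (pmass p Omega f < +oo)%E ->
  exists m r : R, [/\ 0 <= m, 0 <= r, pmass p E f = m%:E,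
    pmass p (Omega `\` E) f = r%:E & pmass p Omega f = (m + r)%:E].
Proof.
move=> oO p0 hf mE EO fin.
have mO : Lebesgue_measurable Omega.
  by apply: borel_Lebesgue_measurable; exact: open_measurable_rV.
exact: (@integral_split _ _ R (lebesgue_rV R (n + n)) (Omega : set (lebesgueType R (n + n)))
  (E : set (lebesgueType R (n + n))) (fun z => normc (f z) `^ p) mO mE EO
  (pmass_measurable oO p0 hf) (fun z => powR_ge0 _ _) fin).
Qed.

Lemma pmass_le_integral Omega E f (p : R) (G : V -> R) : open Omega -> 0 < p ->
  holomorphic Omega f -> Lebesgue_measurable E -> E `<=` Omega -> Cc G ->
  (forall x, 0 <= G x) -> (forall x, E x -> normc (f x) `^ p <= G x) ->
  (pmass p E f <= (integral_rV G)%:E)%E.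
Proof.
move=> oO p0 hf mE EO cG G0 hG; rewrite -(Cc_integralE cG).
have mO : Lebesgue_measurable Omega.
  by apply: borel_Lebesgue_measurable; exact: open_measurable_rV.
exact: (@integral_le_on _ _ R (lebesgue_rV R (n + n)) (E : set (lebesgueType R (n + n)))
  (fun z => normc (f z) `^ p) G mE (measurable_funS mO EO (pmass_measurable oO p0 hf))
  (continuous_Lebesgue_measurable_fun cG.1) (fun z => powR_ge0 _ _) G0 hG).
Qed.

Lemma integral_le_pmass Omega E f (p c : R) (G : V -> R) : open Omega -> 0 < p ->
  holomorphic Omega f -> Lebesgue_measurable E -> Cc G -> 0 <= c ->
  (forall x, 0 <= G x) -> (forall x, ~ (Omega `\` E) x -> G x = 0) ->
  (forall x, Omega x -> G x <= c * normc (f x) `^ p) ->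
  ((integral_rV G)%:E <= c%:E * pmass p (Omega `\` E) f)%E.
Proof.
move=> oO p0 hf mE cG c0 G0 hG0 hG; rewrite -(Cc_integralE cG).
have mO : Lebesgue_measurable Omega.
  by apply: borel_Lebesgue_measurable; exact: open_measurable_rV.
have mOE : Lebesgue_measurable (Omega `\` E) by exact: measurableD.
exact: (@integral_le_supported _ _ R (lebesgue_rV R (n + n))
  ((Omega `\` E) : set (lebesgueType R (n + n)))
  (fun z => normc (f z) `^ p) G c mOE c0
  (measurable_funS mO (@subDsetl _ _ _) (pmass_measurable oO p0 hf))
  (continuous_Lebesgue_measurable_fun cG.1) (fun z => powR_ge0 _ _) G0 hG0 (fun x Ox => hG x Ox.1)).
Qed.

(** Mollification needs functions that are defined on the whole space, and f is
    only given on Omega. *)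
Lemma holomorphic_cutoff Omega E f (d0 s t : R) : open Omega -> E !=set0 -> bounded_set E ->
  (forall x, sdist E x < d0 -> Omega x) -> 0 <= s -> s < t -> t < d0 ->
  holomorphic Omega f ->
  exists F G : V -> R, [/\ C1c F, C1c G,
    forall x, sdist E x < s -> cauchy_riemann F G x &
    forall x, sdist E x < s -> F x = complex.Re (f x) /\ G x = complex.Im (f x)].
Proof.
move=> oO E0 bE hd s0 st td hf.
have [kappa [sk _ k1 k0 _]] := cutoff E0 bE s0 st.
have tk : test_function Omega kappa.
  apply: (@sdist_test_function _ _ E Omega t d0) => // x kx.
  by rewrite leNgt; apply: contra kx => /ltW /k0 ->.
pose u z := complex.Re (f z); pose v z := complex.Im (f z).
have near1 x : sdist E x < s -> nbhs x [set y | kappa y = 1].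
  move=> xs; have : nbhs x (sdist E @^-1` [set r | r < s]).
    by apply: (sdist_continuous E0); apply: open_nbhs_nbhs; split => //; exact: open_lt.
  by apply: filterS => y /= ys; apply: k1; exact: ltW.
exists (fun x => u x * kappa x), (fun x => v x * kappa x); split.
- by apply: C1c_cutoff oO _ _ tk => [x /hf[]//|x k /hf[_ _ h _]]; have [] := h k.
- by apply: C1c_cutoff oO _ _ tk => [x /hf[]//|x k /hf[_ _ h _]]; have [] := h k.
- move=> x xs j; have Ox : Omega x by apply: hd; lra.
  have E1 (g : V -> R) k : partial k (fun y => g y * kappa y) x = partial k g x.
    by apply: near_eq_partial; apply: filterS (near1 _ xs) => y /= ->; rewrite mulr1.
  by rewrite !E1; exact: holomorphic_cauchy_riemann hf Ox j.
- by move=> x xs; rewrite k1 ?mulr1//; exact: ltW.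
Qed.

(** The gradient lives where the distance to E is between d0 / 8 and d0 / 2. It is
    bounded by 2 / (d0 / 2 - d0 / 8) = 16 / (3 d0), and a layer of width d0 / 2
    remains between the support and the complement of Omega. *)
Lemma domain_cutoff Omega E (d0 : R) : E !=set0 -> bounded_set E -> 0 < d0 ->
  (forall x, sdist E x < d0 -> Omega x) ->
  exists chi : V -> R, [/\ test_function Omega chi, forall x, E x -> chi x = 1,
    forall x, chi x != 0 -> sdist E x < d0 / 2,
    forall k x, E x \/ d0 / 2 < sdist E x -> partial k chi x = 0 &
    forall x, \sum_k partial k chi x ^+ 2 <= (16 / 3 / d0) ^+ 2].
Proof.
move=> E0 bE d00 hd.
have r1 : 0 <= d0 / 8 by rewrite divr_ge0// ltW.
have r2 : d0 / 8 < d0 / 2 by lra.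
have [chi [schi chi01 chi1 chi0 gchi]] := cutoff E0 bE r1 r2.
have hchi y : chi y != 0 -> sdist E y < d0 / 2.
  by move=> cy; rewrite ltNge; apply: contra cy => /chi0 ->.
exists chi; split => //.
- apply: (@sdist_test_function _ _ E Omega (d0 / 2) d0) => //; first lra.
  by move=> x /hchi /ltW.
- by move=> x Ex; rewrite chi1// sdist_self.
- move=> k x; case=> hx.
    rewrite (@near_eq_partial _ _ _ (fun=> 1)); first by rewrite (partial_cst k (1 : R)).
    have : nbhs x (sdist E @^-1` [set r | r < d0 / 8]).
      apply: (sdist_continuous E0); apply: open_nbhs_nbhs; split; first exact: open_lt.
      by rewrite /= sdist_self// divr_gt0.
    by apply: filterS => y /= ys; apply: chi1; exact: ltW.
  rewrite (@near_eq_partial _ _ _ (fun=> 0)); first by rewrite (partial_cst k (0 : R)).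
  have : nbhs x (sdist E @^-1` [set r | d0 / 2 < r]).
    by apply: (sdist_continuous E0); apply: open_nbhs_nbhs; split; first exact: open_gt.
  by apply: filterS => y /= ys; apply: chi0; exact: ltW.
- move=> x; apply: le_trans (gchi x) _; rewrite le_eqVlt; apply/orP; left; apply/eqP.
  have d0n : d0 != 0 by rewrite gt_eqF.
  by rewrite (_ : d0 / 2 - d0 / 8 = 3 / 8 * d0); [field|field].
Qed.

(** The eigenvalue inequality for s = p / 4: its left side is at least L m because
    chi = 1 on E, and its right side is at most (16 / 3)^2 / d0^2 r because
    grad chi vanishes on E. Finally (16 / 3)^2 = 256 / 9 <= 128. *)
Lemma eigenvalue_mass Omega E f (p d0 L m r : R) : open Omega -> E !=set0 -> bounded_set E ->
  0 < d0 -> (forall x, sdist E x < d0 -> Omega x) -> 0 < p -> holomorphic Omega f ->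
  Lebesgue_measurable E -> (L%:E <= lambda1 Omega)%E -> 0 <= L ->
  pmass p E f = m%:E -> pmass p (Omega `\` E) f = r%:E ->
  L * m * d0 ^+ 2 <= 128 * r.
Proof.
move=> oO E0 bE d00 hd p0 hf mE hL L0 hm hr.
have EO : E `<=` Omega by move=> x Ex; apply: hd; rewrite sdist_self.
have [chi [tchi chi1 hchi pchi gchi]] := domain_cutoff E0 bE d00 hd.
have schi : smooth chi by case: tchi.
have s1 : 0 <= 5 * d0 / 8 by lra.
have s2 : 5 * d0 / 8 < 7 * d0 / 8 by lra.
have s3 : 7 * d0 / 8 < d0 by lra.
have [F [G [cF cG CR FG]]] := holomorphic_cutoff oO E0 bE hd s1 s2 s3 hf.
have s0 : 0 < p / 4 by rewrite divr_gt0.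
(* The support of chi ends at d0 / 2; radii up to d0 / 8 keep the mollifier in the
   region where the cut off function is holomorphic. *)
have d80 : 0 < d0 / 8 by rewrite divr_gt0.
have CR' y : sdist E y < d0 / 2 + d0 / 8 -> cauchy_riemann F G y.
  by move=> h; apply: CR; lra.
have := eigenvalue_inequality oO E0 bE hL s0 d80 cF cG CR' tchi hchi.
set w := fun y => `|F y ^+ 2 + G y ^+ 2| `^ (p / 4 * 2).
have wE y : sdist E y < 5 * d0 / 8 -> w y = normc (f y) `^ p.
  by move=> /FG[h1 h2]; rewrite normc_powRE /w h1 h2.
have w0 y : 0 <= w y by exact: powR_ge0.
have cw : continuous w.
  apply: continuous_modulus_powR; first by rewrite mulr_gt0.
  - exact: (C1c_Cc cF).1.
  - exact: (C1c_Cc cG).1.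
have bchi := test_function_bounded_support tchi.
have CA : Cc (fun y => chi y ^+ 2 * w y).
  under eq_fun do rewrite expr2 -mulrA.
  apply: CcMr; first by apply: continuous_mul => //; exact: smooth_continuous.
  by split => //; exact: smooth_continuous.
have CB : Cc (fun y => w y * \sum_k partial k chi y ^+ 2).
  apply: CcMl => //; apply: Cc_sum => k _; under eq_fun do rewrite expr2.
  have ck : Cc (partial k chi) by apply: C1c_partial; exact: smooth_C1c.
  by apply: CcMr => //; exact: ck.1.
have B0 x : 0 <= w x * \sum_k partial k chi x ^+ 2 by rewrite mulr_ge0// sum_sqr_ge0.
have hA : m <= integral_rV (fun y => chi y ^+ 2 * w y).
  rewrite -lee_fin -hm; apply: (pmass_le_integral oO p0 hf mE EO CA).
    by move=> x; rewrite mulr_ge0 ?sqr_ge0.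
  move=> x Ex; rewrite chi1// expr1n mul1r wE ?sdist_self//; lra.
pose c := (16 / 3 / d0) ^+ 2.
have hB : integral_rV (fun y => w y * \sum_k partial k chi y ^+ 2) <= c * r.
  rewrite -lee_fin EFinM -hr.
  apply: (integral_le_pmass oO p0 hf mE CB) => //; first exact: sqr_ge0.
  - move=> x nx; rewrite big1 ?mulr0// => k _.
    have [Ox|nOx] := pselect (Omega x); last by rewrite (test_function_partial_off k tchi nOx) expr0n.
    rewrite pchi ?expr0n//; left; apply: contrapT => nEx; apply: nx; exact: conj.
  - move=> x Ox; have [xs|xs] := ltP (sdist E x) (5 * d0 / 8).
      by rewrite wE// mulrC ler_wpM2r ?powR_ge0// /c gchi.
    rewrite big1 ?mulr0; first by rewrite mulr_ge0 ?powR_ge0 ?sqr_ge0.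
    by move=> k _; rewrite pchi ?expr0n//; right; lra.
move=> h.
have : L * m <= c * r by apply: le_trans (le_trans h hB); rewrite ler_wpM2l.
have d0n : d0 != 0 by rewrite gt_eqF.
have rr0 : 0 <= r by rewrite -lee_fin -hr; apply: integral_ge0 => x _; rewrite lee_fin powR_ge0.
have -> : c = (256 / 9) / d0 ^+ 2 by rewrite /c; field.
rewrite mulrAC ler_pdivlMr ?exprn_gt0// => h'; apply: le_trans h' _.
by rewrite ler_wpM2r//; lra.
Qed.

End holomorphic_mass.

(** * Integration over rays and circles *)

Section segment_measure.
Context (R : realType).
Local Notation mR := (measurableTypeR R).
Local Notation leb := (@lebesgue_measure R).

Lemma segment_measurable (B : R) : measurable (`[0, B]%classic : set mR).
Proof. exact: measurable_itv. Qed.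

Lemma segment_finite (B : R) : (leb `[0%R, B] < +oo)%E.
Proof. by rewrite lebesgue_measure_itv/=; case: ifP => // _; rewrite ltry. Qed.

(** A finite measure on the whole line, to which Fubini's theorem and Jensen's
    inequality apply as they stand. *)
Definition segment (B : R) : {finite_measure set mR -> \bar R} :=
  mfrestr (segment_measurable B) (segment_finite B).

Lemma segmentT (B : R) : 0 <= B -> segment B setT = B%:E.
Proof.
move=> B0; rewrite /segment /= /mfrestr /mrestr setTI lebesgue_measure_itv /=.
rewrite lte_fin; case: ltgtP B0 => // [B0 _|<- _//].
by rewrite oppr0 adde0.
Qed.

Lemma segment_integral (B : R) (f : mR -> \bar R) : (segment B).-integrable setT f ->
  (\int[segment B]_x f x = \int[leb]_(x in `[0%R, B]) f x)%E.
Proof.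
move=> hf; have mS := segment_measurable B.
have mC : measurable (~` (`[0, B]%classic : set mR)) by exact: measurableC.
rewrite (negligible_integral mC measurableT hf).
  rewrite setTD setCK; apply: eq_measure_integral => A mA AS.
  by rewrite /segment /= /mfrestr /mrestr setIidl.
by rewrite /segment /= /mfrestr /mrestr setICl measure0.
Qed.

Lemma FTC_is_derive (F f : R -> R) (B : R) : 0 < B -> continuous f ->
  (forall x : R, is_derive x 1 F (f x)) ->
  (\int[leb]_(x in `[0%R, B]) (f x)%:E = (F B - F 0)%:E)%E.
Proof.
move=> B0 cf dF.
have cF (x : R) : {for x, continuous F}.
  by apply: differentiable_continuous; apply/derivable1_diffP; case: (dF x).
rewrite (continuous_FTC2 B0 (F := F)) ?EFinB//.
- exact: continuous_subspaceT.
- split.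
  + by move=> x _; case: (dF x).
  + by apply: cvg_at_right_filter; exact: cF.
  + by apply: cvg_at_left_filter; exact: cF.
- by move=> x _; rewrite derive1E; apply: derive_val.
Qed.

Lemma finite_bounded_integrable d (T : measurableType d)
    (mu : {finite_measure set T -> \bar R}) (f : T -> R) (M : R) :
  measurable_fun setT f -> (forall x, `|f x| <= M) -> mu.-integrable setT (EFin \o f).
Proof.
move=> mf fM; apply: measurable_bounded_integrable => //.
  by rewrite -ge0_fin_numE//; exact: fin_num_measure.
exists M; split; first exact: num_real.
by move=> y My x _; apply: le_trans (fM x) (ltW My).
Qed.

Lemma segment_FTC (B M : R) (F f : R -> R) : 0 < B -> continuous f ->
  (forall x, `|f x| <= M) -> (forall x : R, is_derive x 1 F (f x)) ->
  (\int[segment B]_x (f x)%:E = (F B - F 0)%:E)%E.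
Proof.
move=> B0 cf fM dF; rewrite segment_integral; first exact: FTC_is_derive.
exact: (@finite_bounded_integrable _ (measurableTypeR R) (segment B) f M
  (continuous_measurable_fun cf) fM).
Qed.

End segment_measure.

Section polar_measure.
Context (R : realType).
Local Notation mR := (measurableTypeR R).

(** The measure dr dt on [0, A] x [0, 2 pi], without the Jacobian r of polar
    coordinates: the Cauchy kernel is of size 1 / r and cancels it. *)
Definition polar (A : R) : set (mR * mR) -> \bar R :=
  (segment A \x segment (pi *+ 2))%E.

HB.instance Definition _ A := Measure.on (polar A).

Lemma polarT (A : R) : 0 <= A -> polar A setT = (A * (pi *+ 2))%:E.
Proof.
move=> A0; rewrite /polar -setXTT [LHS]product_measure1E//.
by rewrite EFinM; congr (_ * _)%E; apply: segmentT; rewrite // mulrn_wge0// pi_ge0.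
Qed.

Lemma polar_finite (A : R) : fin_num_fun (polar A).
Proof.
apply: lty_fin_num_fun; rewrite /polar -setXTT [ltLHS]product_measure1E//.
by rewrite lte_mul_pinfty// ?fin_num_measure// -ge0_fin_numE// fin_num_measure.
Qed.

HB.instance Definition _ (A : R) := Measure_isFinite.Build _ _ _ (polar A) (polar_finite A).

End polar_measure.

(** * Jensen's inequality for powers *)

Section jensen.
Context d (T : measurableType d) (R : realType) (mu : {finite_measure set T -> \bar R}).

(** The tangent line at a of a convex function, obtained from Young's inequality
    for h and a^(q - 1). *)
Lemma powR_tangent (h a q : R) : 1 < q -> 0 <= h -> 0 <= a ->
  a `^ q + q * a `^ (q - 1) * (h - a) <= h `^ q.
Proof.
move=> q1 h0 a0; have q0 : 0 < q by lra.
have qn0 : q != 0 by rewrite gt_eqF.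
have qm0 : q - 1 != 0 by rewrite gt_eqF// subr_gt0.
have := @conjugate_powR R h (a `^ (q - 1)) q (q / (q - 1)) h0 (powR_ge0 _ _) q0.
rewrite divr_gt0 ?subr_gt0// => /(_ isT).
have -> : q^-1 + (q / (q - 1))^-1 = 1 by field; rewrite qn0 qm0.
move=> /(_ erefl); rewrite -powRrM.
have -> : (q - 1) * (q / (q - 1)) = q by field.
have aE : a * a `^ (q - 1) = a `^ q.
  move: a0; rewrite le_eqVlt => /predU1P[<-|a0]; first by rewrite mul0r powR0.
  by rewrite -{1}(powRr1 (ltW a0)) -powRD ?(gt_eqF a0) ?implybT// addrC subrK.
have -> : q * a `^ (q - 1) * (h - a) = q * (h * a `^ (q - 1)) - q * a `^ q.
  by rewrite -aE; move: (a `^ (q - 1)) => b; ring.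
move: (h * _) (h `^ q) (a `^ q) => x y z.
rewrite -(ler_pM2l q0) (_ : q * (y / q + z / (q / (q - 1))) = y + (q - 1) * z).
  lra.
by field; rewrite qn0 qm0.
Qed.

(** Jensen's inequality: integrate the tangent line at the lower bound a of the mean. *)
Lemma powR_mean_le (h : T -> R) (M a q mT : R) : 1 < q -> measurable_fun setT h ->
  (forall x, 0 <= h x) -> (forall x, h x <= M) -> 0 <= a -> mu setT = mT%:E ->
  ((a * mT)%:E <= \int[mu]_x (h x)%:E)%E ->
  ((a `^ q * mT)%:E <= \int[mu]_x (h x `^ q)%:E)%E.
Proof.
move=> q1 mh h0 hM a0 muT hint.
have hMn x : `|h x| <= M by rewrite ger0_norm.
have ih := finite_bounded_integrable mu mh hMn.
have mhq : measurable_fun setT (fun x => h x `^ q).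
  exact: (measurableT_comp (measurable_powR q) mh).
have ihq : mu.-integrable setT (EFin \o (fun x => h x `^ q)).
  apply: (@finite_bounded_integrable _ _ _ mu _ (M `^ q) mhq) => x.
  rewrite ger0_norm ?powR_ge0// ge0_ler_powR ?nnegrE//; first by lra.
  exact: le_trans (h0 x) (hM x).
pose c := q * a `^ (q - 1).
have c0 : 0 <= c by rewrite mulr_ge0 ?powR_ge0//; lra.
have icst b : mu.-integrable setT (EFin \o (fun _ : T => b)).
  by apply: (@finite_bounded_integrable _ _ _ mu _ `|b|).
have ich : mu.-integrable setT (EFin \o (fun x => c * h x)).
  by rewrite (_ : _ \o _ = (fun x => c%:E * (EFin \o h) x)%E) //; exact: integrableZl.
apply: (@le_trans _ _ (\int[mu]_x ((a `^ q - c * a) + c * h x)%:E)%E).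
  under eq_integral do rewrite EFinD.
  rewrite (integralD measurableT (icst _) ich) /=.
  rewrite (_ : (fun x => (c * h x)%:E) = fun x => (c%:E * (h x)%:E)%E) //.
  rewrite (integralZl measurableT ih).
  have -> : (\int[mu]__ (a `^ q - c * a)%:E = (a `^ q - c * a)%:E * mT%:E)%E.
    by rewrite -muT; exact: integral_cst.
  apply: (@le_trans _ _ ((a `^ q - c * a)%:E * mT%:E + c%:E * (a * mT)%:E)%E).
    by rewrite -!EFinM -EFinD lee_fin le_eqVlt; apply/orP; left; apply/eqP; ring.
  by rewrite leeD2l// lee_wpmul2l.
apply: le_integral => //.
  exact: (integrableD measurableT (icst (a `^ q - c * a)) ich).
move=> x _; rewrite lee_fin; apply: le_trans (powR_tangent q1 (h0 x) a0).
by rewrite /c; lra.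
Qed.

End jensen.

(** * The Cauchy-Pompeiu formula *)

Section cauchy_pompeiu.
Context (R : realType) (N : nat).
Local Notation V := 'rV[R]_N.
Local Notation mR := (measurableTypeR R).
Local Notation lambda := (lebesgue_rV R N).
Implicit Types (F G : V -> R) (i j : 'I_N).

(** The unit circle of the plane spanned by the i-th and the j-th coordinates; for
    the real and imaginary parts of a complex coordinate this is a complex line. *)
Definition circle i j (t : R) : V := cos t *: delta_mx 0 i + sin t *: delta_mx 0 j.

Lemma is_derive_circle F z i j (r t : R) : (forall y, differentiable F y) ->
  is_derive t 1 (fun t => F (z + r *: circle i j t))
    (r * (cos t * partial j F (z + r *: circle i j t)
        - sin t * partial i F (z + r *: circle i j t))).
Proof.
move=> dF.
have dco : differentiable (@cos R) t by apply/derivable1_diffP; case: (is_derive_cos t).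
have dsi : differentiable (@sin R) t by apply/derivable1_diffP; case: (is_derive_sin t).
have dz (k : R -> R) (v : V) : differentiable k t -> is_diff t (fun s => k s *: v) (fun s => 'd k t s *: v).
  by move=> dk; split; [exact: differentiableZl|rewrite diffZl].
have dl : is_diff t (fun s : R => z + r *: circle i j s)
    (fun s : R => 0 + r *: ('d (@cos R) t s *: delta_mx 0 i + 'd (@sin R) t s *: delta_mx 0 j)).
  apply: is_diffD; apply: is_diffZ; apply: is_diffD; exact: dz.
have dc := is_diff_comp dl (differentiableP (dF (z + r *: circle i j t))).
have dd : differentiable (fun s : R => F (z + r *: circle i j s)) t by case: dc.
apply: DeriveDef; first by apply: diff_derivable.
case: (dc) => _ dv; rewrite deriveE// dv /= add0r.
have -> : 'd (@cos R) t 1 = - sin t by rewrite -deriveE//; case: (is_derive_cos t).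
have -> : 'd (@sin R) t 1 = cos t by rewrite -deriveE//; case: (is_derive_sin t).
rewrite linearZ linearD !linearZ /= /partial !deriveE//.
by rewrite /GRing.scale /=; ring.
Qed.

Lemma is_derive_ray F z i j (r t : R) : i != j -> (forall y, differentiable F y) ->
  is_derive r 1 (fun r => F (z + r *: circle i j t))
    (cos t * partial i F (z + r *: circle i j t)
        + sin t * partial j F (z + r *: circle i j t)).
Proof.
move=> ij dF; have := is_derive_line z (circle i j t) r dF.
suff -> : \sum_k circle i j t 0 k * partial k F (z + r *: circle i j t) =
  cos t * partial i F (z + r *: circle i j t) + sin t * partial j F (z + r *: circle i j t) by [].
rewrite (bigD1 i)//= (bigD1 j) 1?eq_sym//= big1 ?addr0 => [|k /andP[ki kj]].
  by rewrite !mxE !eqxx /= (negbTE ij) (eq_sym j) (negbTE ij) !mulr1 !mulr0 addr0 add0r.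
by rewrite !mxE /= (negbTE ki) (negbTE kj) !mulr0 addr0 mul0r.
Qed.

Lemma continuous_circle i j : continuous (circle i j).
Proof.
move=> t; apply: cvgD; apply: cvgZr_tmp; [exact: continuous_cos|exact: continuous_sin].
Qed.

Lemma measurable_polar_curve F z i j : continuous F ->
  measurable_fun setT (fun p : mR * mR => F (z + p.1 *: circle i j p.2)).
Proof.
move=> cF.
have mw : measurable_fun setT (fun p : mR * mR => z + p.1 *: circle i j p.2 : V).
  apply: measurable_to_rV => k.
  under eq_fun do rewrite !mxE.
  apply: measurable_funD => //; apply: measurable_funM => //.
  apply: measurable_funD; apply: measurable_funM => //.
    apply: (measurableT_comp _ measurable_snd); apply: continuous_measurable_fun.
    exact: continuous_cos.
  apply: (measurableT_comp _ measurable_snd); apply: continuous_measurable_fun.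
  exact: continuous_sin.
exact: (measurableT_comp (continuous_measurable_rV cF) mw).
Qed.

Lemma continuous_ray F z v : continuous F -> continuous (fun r : R => F (z + r *: v)).
Proof.
move=> cF r; apply: (@continuous_comp _ _ _ (fun r : R => z + r *: v) F); last exact: cF.
exact: line_continuous.
Qed.

Lemma continuous_arc F z i j r : continuous F ->
  continuous (fun t : R => F (z + r *: circle i j t)).
Proof.
move=> cF t; apply: (@continuous_comp _ _ _ (fun t : R => z + r *: circle i j t) F); last exact: cF.
by apply: cvgD; [exact: cvg_cst|apply: cvgZl_tmp; exact: continuous_circle].
Qed.

Lemma trig_lin_le (c s a b M : R) : `|c| <= 1 -> `|s| <= 1 -> `|a| <= M -> `|b| <= M ->
  `|c * a + s * b| <= 2 * M.
Proof.
move=> c1 s1 aM bM; apply: le_trans (ler_normD _ _) _; rewrite !normrM.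
have := ler_pM (normr_ge0 c) (normr_ge0 a) c1 aM.
by have := ler_pM (normr_ge0 s) (normr_ge0 b) s1 bM; lra.
Qed.

Lemma norm_cos_le1 (t : R) : `|cos t| <= 1.
Proof. by rewrite ler_norml; apply/andP; split; have := cos_max t; have := cos_geN1 t. Qed.

Lemma norm_sin_le1 (t : R) : `|sin t| <= 1.
Proof. by rewrite ler_norml; apply/andP; split; have := sin_max t; have := sin_geN1 t. Qed.

(** The derivative of F along the circle of radius r is r times this function. *)
Definition angular F z i j (r t : R) :=
  cos t * partial j F (z + r *: circle i j t) - sin t * partial i F (z + r *: circle i j t).

(** The derivative of F along a ray. *)
Definition radial F z i j (r t : R) :=
  cos t * partial i F (z + r *: circle i j t) + sin t * partial j F (z + r *: circle i j t).

(** Away from r = 0 the integrand is the derivative of the periodic function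
    F (z + r e^(it)) / r; at r = 0 it is a combination of sin and cos. *)
Lemma integral_angular F z i j (r M : R) : C1c F -> (forall k x, `|partial k F x| <= M) ->
  (\int[segment (pi *+ 2)]_t (angular F z i j r t)%:E = 0)%E.
Proof.
move=> cF FM; have [dF _ _] := cF.
have pi20 : 0 < (pi *+ 2 : R) by rewrite mulrn_wgt0 // pi_gt0.
have cw : continuous (angular F z i j r).
  have cp k : continuous (partial k F) by have [] := C1c_partial k cF.
  apply: continuous_subf; apply: continuous_mul.
  - exact: continuous_cos.
  - exact: (continuous_arc (cp j)).
  - exact: continuous_sin.
  - exact: (continuous_arc (cp i)).
have bw t : `|angular F z i j r t| <= 2 * M.
  rewrite /angular -mulNr; apply: trig_lin_le => //; rewrite ?normrN.
  - exact: norm_cos_le1.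
  - exact: norm_sin_le1.
have [r0|r0] := eqVneq r 0.
  pose P t := sin t * partial j F z + cos t * partial i F z.
  have dP (t : R) : is_derive t 1 P (angular F z i j r t).
    rewrite /angular r0 scale0r addr0.
    have h1 := is_deriveM (is_derive_sin t) (is_derive_cst (partial j F z) t 1).
    have h2 := is_deriveM (is_derive_cos t) (is_derive_cst (partial i F z) t 1).
    apply: (is_derive_eq (f := P) (is_deriveD h1 h2)).
    by rewrite /GRing.scale /= /cst; ring.
  by rewrite (segment_FTC pi20 cw bw dP) /P sin2pi cos2pi sin0 cos0 subrr.
pose P t := r^-1 * F (z + r *: circle i j t).
have dP (t : R) : is_derive t 1 P (angular F z i j r t).
  apply: (is_derive_eq (f := P) (is_deriveZ r^-1 (is_derive_circle z i j r t dF))).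
  by rewrite /GRing.scale /= mulKf.
by rewrite (segment_FTC pi20 cw bw dP) /P /circle sin2pi cos2pi sin0 cos0 subrr.
Qed.

(** The fundamental theorem of calculus on a ray that ends at a zero of F. *)
Lemma integral_radial F z i j (A t M : R) : i != j -> 0 < A -> C1c F ->
  (forall k x, `|partial k F x| <= M) ->
  F (z + A *: circle i j t) = 0 ->
  (\int[segment A]_r (radial F z i j r t)%:E = (- F z)%:E)%E.
Proof.
move=> ij A0 cF FM F0; have [dF _ _] := cF.
have cw : continuous (radial F z i j ^~ t).
  have cp k : continuous (partial k F) by have [] := C1c_partial k cF.
  apply: continuous_add; apply: continuous_mul.
  - by move=> ?; exact: cvg_cst.
  - exact: (continuous_ray (cp i)).
  - by move=> ?; exact: cvg_cst.
  - exact: (continuous_ray (cp j)).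
have bw r : `|radial F z i j r t| <= 2 * M.
  apply: trig_lin_le => //; [exact: norm_cos_le1|exact: norm_sin_le1].
have dP (r : R) : is_derive r 1 (fun r => F (z + r *: circle i j t)) (radial F z i j r t).
  exact: is_derive_ray.
by rewrite (segment_FTC A0 cw bw dP) F0 scale0r addr0 sub0r.
Qed.

Lemma polar_integrable (k : mR * mR -> R) (A M : R) : measurable_fun setT k ->
  (forall x, `|k x| <= M) -> (polar A).-integrable setT (EFin \o k).
Proof. exact: finite_bounded_integrable. Qed.

Lemma measurable_trig_polar F G z i j : continuous F -> continuous G ->
  measurable_fun setT (fun p : mR * mR =>
    cos p.2 * F (z + p.1 *: circle i j p.2) + sin p.2 * G (z + p.1 *: circle i j p.2)).
Proof.
move=> cF cG; apply: measurable_funD; apply: measurable_funM.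
- apply: (measurableT_comp _ measurable_snd); apply: continuous_measurable_fun.
  exact: continuous_cos.
- exact: measurable_polar_curve.
- apply: (measurableT_comp _ measurable_snd); apply: continuous_measurable_fun.
  exact: continuous_sin.
- exact: measurable_polar_curve.
Qed.

(** For g = F + i G, the real and imaginary parts of 2 d-bar g are
    D1 = d_i F - d_j G and D2 = d_i G + d_j F, and cos t D1 + sin t D2 is the radial
    derivative of F minus the angular derivative of G. The latter integrates to 0
    over each circle, the former to - F z over each ray, so that the double integral
    of cos t D1 + sin t D2 is - 2 pi F z. *)
Lemma cauchy_pompeiu F G z i j (A : R) : i != j -> 0 < A -> C1c F -> C1c G ->
  (forall t, F (z + A *: circle i j t) = 0) ->
  ((`|F z| * (pi *+ 2))%:E <= \int[polar A]_p
    (`|(partial i F - partial j G) (z + p.1 *: circle i j p.2)|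
   + `|(partial i G + partial j F) (z + p.1 *: circle i j p.2)|)%:E)%E.
Proof.
move=> ij A0 cF cG F0.
have [MF MF0 FM] := C1c_bound cF; have [MG MG0 GM] := C1c_bound cG.
have pF k : continuous (partial k F) by have [] := C1c_partial k cF.
have pG k : continuous (partial k G) by have [] := C1c_partial k cG.
pose K (p : mR * mR) := radial F z i j p.1 p.2.
pose L (p : mR * mR) := angular G z i j p.1 p.2.
have mK : measurable_fun setT K by exact: measurable_trig_polar.
have mL : measurable_fun setT L.
  rewrite (_ : L = fun p => cos p.2 * partial j G (z + p.1 *: circle i j p.2)
      + sin p.2 * (- partial i G (z + p.1 *: circle i j p.2))).
    by apply: (@measurable_trig_polar _ (fun x => - partial i G x)) => //; exact: continuous_opp.
  by apply/funext => p; rewrite /L /angular mulrN.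
have iK : (polar A).-integrable setT (EFin \o K).
  apply: (@polar_integrable _ _ (2 * MF)) => // p.
  apply: trig_lin_le => //; [exact: norm_cos_le1|exact: norm_sin_le1].
have iL : (polar A).-integrable setT (EFin \o L).
  apply: (@polar_integrable _ _ (2 * MG)) => // p; rewrite /L /angular -mulNr.
  by apply: trig_lin_le => //; rewrite ?normrN; [exact: norm_cos_le1|exact: norm_sin_le1].
have intK : (\int[polar A]_p (K p)%:E = (- F z * (pi *+ 2))%:E)%E.
  rewrite -(integral21_prod_meas1 iK) /fubini_G /=.
  under eq_integral => t _ do rewrite /K /= (integral_radial ij A0 cF FM (F0 t)).
  rewrite integral_cst// EFinM; congr (_ * _)%E; apply: segmentT.
  by rewrite mulrn_wge0// pi_ge0.
have intL : (\int[polar A]_p (L p)%:E = 0)%E.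
  rewrite -(integral12_prod_meas1 iL) /fubini_F /=.
  under eq_integral => r _ do rewrite /L /= (integral_angular z i j r cG GM).
  exact: integral0.
have iKL := integrableB measurableT iK iL.
have -> : ((`|F z| * (pi *+ 2))%:E = `|\int[polar A]_p (EFin (K p) - EFin (L p))|)%E.
  rewrite (integralB measurableT iK iL) intK intL sube0 abse_EFin normrM normrN.
  by rewrite (@ger0_norm _ (pi *+ 2))// mulrn_wge0// pi_ge0.
apply: le_trans (le_abse_integral _ measurableT _) _; first exact: measurable_int iKL.
apply: ge0_le_integral => //.
- exact: measurableT_comp (measurable_int _ iKL).
- apply/measurable_EFinP; apply: measurable_funD.
    apply: measurableT_comp => //; apply: (@measurable_polar_curve (partial i F - partial j G)).
    exact: continuous_subf.
  apply: measurableT_comp => //; apply: (@measurable_polar_curve (partial i G + partial j F)).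
  exact: continuous_add.
move=> p _; rewrite -EFinB abse_EFin lee_fin.
set w := z + p.1 *: circle i j p.2.
have -> : K p - L p = cos p.2 * (partial i F - partial j G) w + sin p.2 * (partial i G + partial j F) w.
  rewrite /K /L /radial /angular -/w /= !fctE.
  move: (partial i F w) (partial j F w) (partial i G w) (partial j G w) => a b c d; ring.
apply: le_trans (ler_normD _ _) _; rewrite !normrM lerD//.
  by rewrite ler_piMl// norm_cos_le1.
by rewrite ler_piMl// norm_sin_le1.
Qed.
End cauchy_pompeiu.

(** * The L^q estimate for the Cauchy transform *)

Section cauchy_transform.
Context (R : realType) (N : nat).
Local Notation V := 'rV[R]_N.
Local Notation mR := (measurableTypeR R).
Implicit Types (F G : V -> R) (i j : 'I_N).

Lemma Cc_powR F (q : R) : 0 < q -> Cc F -> Cc (fun x => `|F x| `^ q).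
Proof.
move=> q0 [cF bF]; split.
  by move=> x; apply: (@continuous_comp _ _ _ F (fun t : R => `|t| `^ q));
    [exact: cF|exact: continuous_norm_powR].
by case: bF => B h; exists B => x /h ->; rewrite normr0 powR0// gt_eqF.
Qed.

Lemma Cc_borel_integral F : Cc F -> (forall x, 0 <= F x) ->
  (\int[borel_lebesgue R N]_x (F x)%:E = (integral_rV F)%:E)%E.
Proof.
move=> cF F0; rewrite -(Cc_integralE cF) -ge0_integral_lebesgue_rVE//.
apply/measurable_EFinP; exact: (continuous_measurable_rV cF.1).
Qed.

(** One of the two coordinates moves by at least (3 B + 1) / sqrt 2 > 2 B. *)
Lemma circle_escape (B : R) (z : V) i j t : i != j -> 0 < B -> `|z| <= B ->
  B < `|z + (3 * B + 1) *: circle i j t|.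
Proof.
move=> ij B0 zB; rewrite ltNge; apply/negP => wB.
have H k : `|(3 * B + 1) * circle i j t 0 k| <= 2 * B.
  have -> : (3 * B + 1) * circle i j t 0 k = (z + (3 * B + 1) *: circle i j t) 0 k - z 0 k.
    by rewrite !mxE; ring.
  apply: le_trans (ler_normB _ _) _.
  have := le_trans (coord_le_norm z k) zB.
  by have := le_trans (coord_le_norm _ k) wB; lra.
have := H j; have := H i.
rewrite !mxE !eqxx /= (negbTE ij) (eq_sym j) (negbTE ij) !mulr1 !mulr0 addr0 add0r.
rewrite !ler_norml => /andP[a1 a2] /andP[b1 b2].
have := cos2Dsin2 t; nra.
Qed.

(** The Cauchy-Pompeiu formula bounds |F z| / A by the mean of H over the
    polar measure, Jensen's inequality does the same for the q-th powers, and each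
    translate of H^q has the same integral over z. *)
Lemma cauchy_transform_powR F G i j (B q : R) : i != j -> 1 < q -> 0 < B ->
  C1c F -> C1c G -> (forall x, F x != 0 -> `|x| <= B) ->
  integral_rV (fun x => `|F x| `^ q) <= (3 * B + 1) `^ q * integral_rV (fun x =>
    `| `|(partial i F - partial j G) x| + `|(partial i G + partial j F) x| | `^ q).
Proof.
move=> ij q1 B0 cF cG FB; set A := 3 * B + 1.
have q0 : 0 < q by lra.
have A0 : 0 < A by rewrite /A; lra.
have pi20 : 0 < (pi *+ 2 : R) by rewrite mulrn_wgt0 // pi_gt0.
set H := fun x => `|(partial i F - partial j G) x| + `|(partial i G + partial j F) x|.
have H0 x : 0 <= H x by rewrite addr_ge0.
have cH : Cc H.
  by apply: CcD; apply: Cc_norm; [apply: CcB|apply: CcD]; exact: C1c_partial.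
have [M M0 HM] := Cc_bounded cH.
pose W x := `|H x| `^ q.
have cW : Cc W by exact: Cc_powR.
have W0 x : 0 <= W x by exact: powR_ge0.
have cFq : Cc (fun x => `|F x| `^ q) by apply: Cc_powR => //; exact: C1c_Cc.
pose c := A^-1 `^ q * (A * (pi *+ 2)).
have c0 : 0 < c by rewrite mulr_gt0 ?powR_gt0 ?invr_gt0// mulr_gt0.
have pw z : ((c * `|F z| `^ q)%:E <= \int[polar A]_p (W (z + p.1 *: circle i j p.2))%:E)%E.
  have [Fz|Fz] := eqVneq (F z) 0.
    rewrite Fz normr0 powR0 ?mulr0; last by rewrite gt_eqF.
    by apply: integral_ge0 => p _; rewrite lee_fin.
  have Fw t : F (z + A *: circle i j t) = 0.
    apply/eqP; apply: contraTT isT => /FB; rewrite leNgt => /negP; case.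
    exact: circle_escape (FB _ Fz).
  have hP := cauchy_pompeiu ij A0 cF cG Fw.
  have -> : c * `|F z| `^ q = (`|F z| / A) `^ q * (A * (pi *+ 2)).
    by rewrite powRM ?invr_ge0 ?(ltW A0)// /c mulrAC -mulrA [_ `^ q * _]mulrC -!mulrA mulrCA.
  have -> : (\int[polar A]_p (W (z + p.1 *: circle i j p.2))%:E =
      \int[polar A]_p (H (z + p.1 *: circle i j p.2) `^ q)%:E)%E.
    by apply: eq_integral => p _; rewrite /W ger0_norm.
  apply: (@powR_mean_le _ _ _ (polar A) (fun p => H (z + p.1 *: circle i j p.2)) M) => //.
  - by apply: measurable_polar_curve; exact: cH.1.
  - by move=> p; apply: le_trans (HM _); exact: ler_norm.
  - by rewrite divr_ge0// ltW.
  - by apply: polarT; exact: ltW.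
  - rewrite (_ : `|F z| / A * (A * (pi *+ 2)) = `|F z| * (pi *+ 2)) //.
    by rewrite mulrA divfK// gt_eqF.
have mW2 : measurable_fun setT
    (fun u : V * (mR * mR) => (W (u.1 + u.2.1 *: circle i j u.2.2))%:E).
  apply/measurable_EFinP.
  have mw : measurable_fun setT (fun u : V * (mR * mR) => u.1 + u.2.1 *: circle i j u.2.2 : V).
    apply: measurable_to_rV => k.
    under eq_fun do rewrite !mxE.
    have m2 : measurable_fun setT (fun u : V * (mR * mR) => u.2.2) by exact: measurableT_comp.
    have mc : measurable_fun setT (fun u : V * (mR * mR) => cos u.2.2).
      by apply: (measurableT_comp _ m2); apply: continuous_measurable_fun; exact: continuous_cos.
    have ms : measurable_fun setT (fun u : V * (mR * mR) => sin u.2.2).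
      by apply: (measurableT_comp _ m2); apply: continuous_measurable_fun; exact: continuous_sin.
    apply: measurable_funD; first exact: (measurableT_comp (measurable_coord k) measurable_fst).
    apply: measurable_funM; first exact: measurableT_comp.
    by apply: measurable_funD; apply: measurable_funM.
  exact: (measurableT_comp (continuous_measurable_rV cW.1) mw).
have W20 (u : V * (mR * mR)) : (0 <= (W (u.1 + u.2.1 *: circle i j u.2.2))%:E)%E.
  by rewrite lee_fin.
have hI : (\int[borel_lebesgue R N]_z (c * `|F z| `^ q)%:E <=
    (integral_rV W * (A * (pi *+ 2)))%:E)%E.
  apply: (@le_trans _ _ (\int[borel_lebesgue R N]_z \int[polar A]_p
      (W (z + p.1 *: circle i j p.2))%:E)%E).
    apply: ge0_le_integral => //.
    - by move=> z _; rewrite lee_fin mulr_ge0 ?powR_ge0// ltW.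
    - apply/measurable_EFinP; apply: measurable_funM => //.
      exact: (continuous_measurable_rV cFq.1).
    - exact: (measurable_fun_fubini_tonelli_F (m2 := polar A) _ mW2 W20).
  rewrite (fubini_tonelli (m1 := borel_lebesgue R N) (m2 := polar A) _ mW2 W20).
  under eq_integral => p _ do rewrite /= (Cc_borel_integral (Cc_shift _ cW) (fun x => W0 _))
    (integral_rV_shift _ cW).
  rewrite EFinM -(polarT (ltW A0)) le_eqVlt; apply/orP; left; apply/eqP.
  exact: (@integral_cst _ _ _ (polar A) setT measurableT (integral_rV W)%:E).
move: hI; rewrite (@Cc_borel_integral (fun z => c * `|F z| `^ q)); last 2 first.
- exact: CcZ.
- by move=> z; rewrite mulr_ge0 ?powR_ge0// ltW.
rewrite lee_fin integral_rVZ// /c mulrAC ler_pM2r ?mulr_gt0// => h.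
have -> : integral_rV (fun x => `|F x| `^ q) =
   A `^ q * (A^-1 `^ q * integral_rV (fun x => `|F x| `^ q)).
  by rewrite mulrA -powRM ?invr_ge0 ?(ltW A0)// divff ?gt_eqF// powR1 mul1r.
by rewrite ler_pM2l ?powR_gt0.
Qed.

End cauchy_transform.

(** * The d-bar estimate for holomorphic functions *)

Section dbar_estimate.
Context (R : realType) (n : nat).
Local Notation V := 'rV[R]_(n + n).
Implicit Types (f : V -> R[i]) (Omega E : set V).

Lemma coord_le_sum_sqr (a : 'I_(n + n) -> R) (c : R) k : 0 <= c ->
  \sum_j a j ^+ 2 <= c ^+ 2 -> `|a k| <= c.
Proof.
move=> c0 h; rewrite -(@ler_pXn2r _ 2)// ?nnegrE// real_normK ?num_real//.
apply: le_trans h; rewrite (bigD1 k)//= lerDl.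
by apply: sumr_ge0 => j _; rewrite sqr_ge0.
Qed.

Lemma normc_ge0 (z : R[i]) : 0 <= normc z.
Proof. by case: z => a b; exact: sqrtr_ge0. Qed.

Lemma normc_ge_Re (z : R[i]) : `|complex.Re z| <= normc z.
Proof.
case: z => a b /=; rewrite -sqrtr_sqr ler_sqrt ?lerDl ?sqr_ge0//.
by rewrite addr_ge0 ?sqr_ge0.
Qed.

Lemma normc_ge_Im (z : R[i]) : `|complex.Im z| <= normc z.
Proof.
case: z => a b /=; rewrite -sqrtr_sqr ler_sqrt ?lerDr ?sqr_ge0//.
by rewrite addr_ge0 ?sqr_ge0.
Qed.

Lemma normc_le_ReIm (z : R[i]) : normc z <= `|complex.Re z| + `|complex.Im z|.
Proof.
case: z => a b /=; rewrite -[leRHS]ger0_norm ?addr_ge0// -sqrtr_sqr ler_sqrt ?sqr_ge0//.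
rewrite sqrrD !real_normK ?num_real// lerD2r lerDl.
by rewrite mulrn_wge0// mulr_ge0.
Qed.

Lemma powR_addl (a b c q : R) : 0 <= q -> 0 <= a -> 0 <= b -> c <= a + b -> 0 <= c ->
  c `^ q <= 2 `^ q * (a `^ q + b `^ q).
Proof.
move=> q0 a0 b0 cab c0; wlog ab : a b a0 b0 cab / a <= b.
  move=> h; have [ab|/ltW ba] := leP a b; first exact: h.
  by rewrite [a `^ q + _]addrC; apply: h => //; rewrite addrC.
apply: (@le_trans _ _ ((2 * b) `^ q)).
  by rewrite ge0_ler_powR ?nnegrE ?mulr_ge0//; lra.
by rewrite powRM// ler_wpM2l ?powR_ge0// lerDr powR_ge0.
Qed.

(** The product g = chi f is f on E, and twice its d-bar derivative is f times
    that of chi. The absolute values of its components add up to at most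
    64 / (3 d0) |f|, and they vanish outside Omega minus E.
    The estimate for the Cauchy transform applies to the real and to the imaginary
    part of g. *)
Lemma dbar_mass Omega E f (q d0 B m r : R) : (0 < n)%N -> open Omega -> E !=set0 -> bounded_set E ->
  0 < d0 -> (forall x, sdist E x < d0 -> Omega x) -> 0 < B -> (forall x, Omega x -> `|x| <= B) ->
  1 < q -> holomorphic Omega f ->
  Lebesgue_measurable E ->
  pmass q E f = m%:E -> pmass q (Omega `\` E) f = r%:E ->
  m * d0 `^ q <= 2 * (128 / 3 * (3 * B + 1)) `^ q * r.
Proof.
move=> n0 oO E0 bE d00 hd B0 OB q1 hf mE hm hr.
have q0 : 0 < q by lra.
have EO : E `<=` Omega by move=> x Ex; apply: hd; rewrite sdist_self.
have [chi [tchi chi1 hchi pchi gchi]] := domain_cutoff E0 bE d00 hd.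
pose i := lshift n (Ordinal n0); pose j := rshift n (Ordinal n0).
have ij : i != j by rewrite eq_lrshift.
pose u z := complex.Re (f z); pose v z := complex.Im (f z).
pose F x := u x * chi x; pose G x := v x * chi x.
have [cF cG] : C1c F /\ C1c G.
  by split; apply: C1c_cutoff oO _ _ tchi => [x /hf[]//|x k /hf[_ _ h _]]; have [] := h k.
have dchi x : differentiable chi x by case: tchi => /smooth_differentiable.
have supB (g : V -> R) x : g x * chi x != 0 -> `|x| <= B.
  move=> gx; apply: OB; apply: contrapT => nO; move/eqP: gx; apply.
  by rewrite (test_function_off tchi nO) mulr0.
have far x k (g : V -> R) : d0 / 2 < sdist E x -> partial k (fun y => g y * chi y) x = 0.
  move=> xs; rewrite (@near_eq_partial _ _ _ (fun=> 0)); first by rewrite (partial_cst k (0 : R)).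
  have : nbhs x (sdist E @^-1` [set r | d0 / 2 < r]).
    by apply: (sdist_continuous E0); apply: open_nbhs_nbhs; split; first exact: open_gt.
  apply: filterS => y /= ys; have [->|/hchi] := eqVneq (chi y) 0; first by rewrite mulr0.
  by move=> h; exfalso; lra.
have D1 x : partial i F x - partial j G x = u x * partial i chi x - v x * partial j chi x.
  have [xs|xs] := ltP (d0 / 2) (sdist E x).
    by rewrite !far// !pchi ?mulr0//; right.
  have Ox : Omega x by apply: hd; lra.
  have [du dv _ CR] := hf _ Ox.
  rewrite /F /G (partialM_pt _ du (dchi x)) (partialM_pt _ dv (dchi x)).
  rewrite (CR (Ordinal n0)).1 -/j -/i.
  move: (partial j (fun z => complex.Im (f z)) x) (chi x) (partial i chi x) (partial j chi x) => *.
  by rewrite -/(u x) -/(v x); ring.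
have D2 x : partial i G x + partial j F x = v x * partial i chi x + u x * partial j chi x.
  have [xs|xs] := ltP (d0 / 2) (sdist E x).
    by rewrite !far// !pchi ?mulr0//; right.
  have Ox : Omega x by apply: hd; lra.
  have [du dv _ CR] := hf _ Ox.
  rewrite /F /G (partialM_pt _ du (dchi x)) (partialM_pt _ dv (dchi x)).
  rewrite (CR (Ordinal n0)).2 -/j -/i.
  move: (partial i (fun z => complex.Im (f z)) x) (chi x) (partial i chi x) (partial j chi x) => *.
  by rewrite -/(u x) -/(v x); ring.
set A := 3 * B + 1.
have A0 : 0 < A by rewrite /A; lra.
pose H x := `|u x * partial i chi x - v x * partial j chi x| +
            `|v x * partial i chi x + u x * partial j chi x|.
pose W x := `|H x| `^ q.
have cH : Cc H.
  rewrite (_ : H = fun x => `|(partial i F - partial j G) x| + `|(partial i G + partial j F) x|).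
    by apply: CcD; apply: Cc_norm; [apply: CcB|apply: CcD]; exact: C1c_partial.
  by apply/funext => x; rewrite /= !fctE D1 D2.
have cW : Cc W by exact: Cc_powR.
have hF := cauchy_transform_powR ij q1 B0 cF cG (supB u).
have hG := cauchy_transform_powR ij q1 B0 cG (C1cN cF) (supB v).
have WF : (fun x => `| `|(partial i F - partial j G) x| + `|(partial i G + partial j F) x| | `^ q) = W.
  by apply/funext => x; rewrite !fctE D1 D2.
have WG : (fun x => `| `|(partial i G - partial j (fun x => - F x)) x| +
    `|(partial i (fun x => - F x) + partial j G) x| | `^ q) = W.
  have [dF _ _] := cF.
  rewrite (partialN i dF) (partialN j dF); apply/funext => x.
  by rewrite !fctE opprK D2 [- _ + _]addrC -opprB normrN D1 addrC.
rewrite WF in hF; rewrite WG in hG.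
have r0 : 0 <= r.
  by rewrite -lee_fin -hr; apply: integral_ge0 => x _; rewrite lee_fin powR_ge0.
have d0n : d0 != 0 by rewrite gt_eqF.
pose c := 64 / 3 / d0.
have c0 : 0 <= c by rewrite !divr_ge0// ltW.
have gk k x : `|partial k chi x| <= 16 / 3 / d0.
  by apply: (coord_le_sum_sqr (a := fun k => partial k chi x)) => //; rewrite !divr_ge0// ltW.
have HW x : W x <= c `^ q * normc (f x) `^ q.
  rewrite /W -powRM//; last exact: normc_ge0.
  rewrite ge0_ler_powR ?nnegrE ?(ltW q0) ?(mulr_ge0 c0 (normc_ge0 _))//.
  rewrite ger0_norm ?addr_ge0//.
  have P a b k l : `|a| <= normc (f x) -> `|b| <= normc (f x) ->
      `|a * partial k chi x| + `|b * partial l chi x| <= 2 * (16 / 3 / d0) * normc (f x).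
    move=> ha hb; rewrite !normrM.
    rewrite -mulrA mulr_natl mulr2n [_ / d0 * _]mulrC.
    by apply: lerD; apply: ler_pM.
  have uf : `|u x| <= normc (f x) by exact: normc_ge_Re.
  have vf : `|v x| <= normc (f x) by exact: normc_ge_Im.
  have h1 := le_trans (ler_normB _ _) (P _ _ i j uf vf).
  have h2 := le_trans (ler_normD _ _) (P _ _ i j vf uf).
  apply: le_trans (lerD h1 h2) _.
  by rewrite -mulrDl le_eqVlt; apply/orP; left; apply/eqP; rewrite /c; field.
have hW : integral_rV W <= c `^ q * r.
  rewrite -lee_fin EFinM -hr; apply: (integral_le_pmass oO q0 hf mE cW) => //.
  - exact: powR_ge0.
  - by move=> x; exact: powR_ge0.
  - move=> x nx; have pz k : partial k chi x = 0.
      have [Ox|nOx] := pselect (Omega x); last exact: test_function_partial_off tchi nOx.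
      apply: pchi; left; apply: contrapT => nE; apply: nx; split => //.
    by rewrite /W /H !pz !mulr0 subr0 addr0 !normr0 addr0 normr0 powR0// gt_eqF.
have cFq : Cc (fun x => `|F x| `^ q) by apply: Cc_powR => //; exact: C1c_Cc.
have cGq : Cc (fun x => `|G x| `^ q) by apply: Cc_powR => //; exact: C1c_Cc.
have hE : m <= 2 `^ q * (integral_rV (fun x => `|F x| `^ q) + integral_rV (fun x => `|G x| `^ q)).
  rewrite -integral_rVD// -integral_rVZ; last exact: CcD.
  rewrite -lee_fin -hm; apply: (pmass_le_integral oO q0 hf mE EO).
  - by apply: CcZ; exact: CcD.
  - by move=> x; rewrite mulr_ge0 ?addr_ge0 ?powR_ge0.
  - move=> x Ex; apply: powR_addl => //; rewrite ?normc_ge0 ?(ltW q0)//.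
    by rewrite /F /G chi1// !mulr1; exact: normc_le_ReIm.
have step : m <= 2 `^ q * (2 * (A `^ q * (c `^ q * r))).
  apply: le_trans hE _; rewrite ler_wpM2l ?powR_ge0//.
  have hA : A `^ q * integral_rV W <= A `^ q * (c `^ q * r) by rewrite ler_wpM2l ?powR_ge0.
  by rewrite mulr_natl mulr2n; exact: lerD (le_trans hF hA) (le_trans hG hA).
apply: le_trans (ler_wpM2r (powR_ge0 d0 q) step) _.
have -> : 128 / 3 * A = 2 * A * c * d0 by rewrite /c; field.
have A0' := ltW A0; have d0' := ltW d00.
rewrite !powRM ?mulr_ge0 ?invr_ge0//.
by rewrite le_eqVlt; apply/orP; left; apply/eqP; ring.
Qed.

End dbar_estimate.

(** * Powers of holomorphic functions *)

Section holomorphic_powers.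
Context (R : realType) (n : nat).
Local Notation V := 'rV[R]_(n + n).
Implicit Types (f g : V -> R[i]) (u v : V -> R) (Omega E : set V).

Definition C1on Omega u := forall x, Omega x -> differentiable u x /\
  forall k, {for x, continuous (partial k u)}.

Lemma C1onD Omega u v : open Omega -> C1on Omega u -> C1on Omega v ->
  C1on Omega (fun x => u x + v x).
Proof.
move=> oO hu hv x Ox; have [du cu] := hu x Ox; have [dv cv] := hv x Ox.
split=> [|k]; first exact: differentiableD.
apply: (@near_eq_continuous _ _ (fun y => partial k u y + partial k v y)); last first.
  by apply: continuousD; [exact: cu|exact: cv].
have : nbhs x Omega by exact: open_nbhs_nbhs.
apply: filterS => y Oy /=; have [duy _] := hu y Oy; have [dvy _] := hv y Oy.
by rewrite /partial deriveD//; exact: diff_derivable.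
Qed.

Lemma C1onM Omega u v : open Omega -> C1on Omega u -> C1on Omega v ->
  C1on Omega (fun x => u x * v x).
Proof.
move=> oO hu hv x Ox; have [du cu] := hu x Ox; have [dv cv] := hv x Ox.
split=> [|k]; first exact: differentiableM.
apply: (@near_eq_continuous _ _ (fun y => partial k u y * v y + u y * partial k v y)); last first.
  apply: continuousD; apply: continuousM.
  - exact: cu.
  - exact: differentiable_continuous.
  - exact: differentiable_continuous.
  - exact: cv.
have : nbhs x Omega by exact: open_nbhs_nbhs.
apply: filterS => y Oy /=; have [duy _] := hu y Oy; have [dvy _] := hv y Oy.
by rewrite partialM_pt.
Qed.

Lemma C1onN Omega u : open Omega -> C1on Omega u -> C1on Omega (fun x => - u x).
Proof.
move=> oO hu x Ox; have [du cu] := hu x Ox.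
split=> [|k]; first exact: differentiableN.
apply: (@near_eq_continuous _ _ (fun y => - partial k u y)); last first.
  by apply: continuousN; exact: cu.
have : nbhs x Omega by exact: open_nbhs_nbhs.
apply: filterS => y Oy /=; have [duy _] := hu y Oy.
by rewrite /partial deriveN//; exact: diff_derivable.
Qed.

Lemma holomorphic_C1on Omega f : holomorphic Omega f ->
  C1on Omega (fun z => complex.Re (f z)) /\ C1on Omega (fun z => complex.Im (f z)).
Proof. by move=> hf; split=> x /hf[du dv h _]; split => // k; case: (h k). Qed.

Lemma holomorphicM Omega f g : open Omega -> holomorphic Omega f -> holomorphic Omega g ->
  holomorphic Omega (fun z => f z * g z).
Proof.
move=> oO hf hg.
pose a z := complex.Re (f z); pose b z := complex.Im (f z).
pose c z := complex.Re (g z); pose e z := complex.Im (g z).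
have ReE : (fun z => complex.Re (f z * g z)) = (fun z => a z * c z + - (b z * e z)).
  by apply/funext => z; rewrite /a /b /c /e; case: (f z) (g z) => [? ?] [? ?].
have ImE : (fun z => complex.Im (f z * g z)) = (fun z => a z * e z + b z * c z).
  by apply/funext => z; rewrite /a /b /c /e; case: (f z) (g z) => [? ?] [? ?].
have [[Ca Cb] [Cc Ce]] := (holomorphic_C1on hf, holomorphic_C1on hg).
have Cre := C1onD oO (C1onM oO Ca Cc) (C1onN oO (C1onM oO Cb Ce)).
have Cim := C1onD oO (C1onM oO Ca Ce) (C1onM oO Cb Cc).
move=> z Oz; rewrite ReE ImE; have [d1 c1] := Cre z Oz; have [d2 c2] := Cim z Oz.
split => // j.
have [da _] := Ca z Oz; have [db _] := Cb z Oz.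
have [dc _] := Cc z Oz; have [de _] := Ce z Oz.
have pre k : partial k (fun z => a z * c z + - (b z * e z)) z =
    partial k a z * c z + a z * partial k c z - (partial k b z * e z + b z * partial k e z).
  rewrite -!partialM_pt// /partial deriveD ?deriveN//; apply: diff_derivable => //.
  - exact: differentiableM.
  - exact: differentiableM.
  - by apply: differentiableN; exact: differentiableM.
have pim k : partial k (fun z => a z * e z + b z * c z) z =
    partial k a z * e z + a z * partial k e z + (partial k b z * c z + b z * partial k c z).
  by rewrite -!partialM_pt// /partial deriveD//; apply: diff_derivable => //; exact: differentiableM.
rewrite !pre !pim.
have [_ _ _ /(_ j)[f1 f2]] := hf z Oz; have [_ _ _ /(_ j)[g1 g2]] := hg z Oz.
rewrite /a /b /c /e f1 f2 g1 g2.
move: (partial _ _ z) (partial _ _ z) (partial _ _ z) (partial _ _ z)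
  (complex.Re (f z)) (complex.Im (f z)) (complex.Re (g z)) (complex.Im (g z)) => *.
by split; ring.
Qed.

Lemma holomorphicX Omega f m : open Omega -> holomorphic Omega f ->
  holomorphic Omega (fun z => f z ^+ m.+1).
Proof.
move=> oO hf; elim: m => [|m IH]; first exact: hf.
rewrite (_ : (fun z => f z ^+ m.+2) = fun z => f z * f z ^+ m.+1); first exact: holomorphicM.
by apply/funext => z; rewrite exprS.
Qed.

Lemma normcX (z : R[i]) m : normc (z ^+ m) = normc z ^+ m.
Proof.
elim: m => [|m IH]; last by rewrite !exprS normcM IH.
by rewrite !expr0 /= expr1n expr0n addr0 sqrtr1.
Qed.

(** An integer power of f trades the exponent p for a smaller one. *)
Lemma pmass_powR Omega f (p : R) m :
  pmass p Omega f = pmass (p / m.+1%:R) Omega (fun z => f z ^+ m.+1).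
Proof.
apply: eq_integral => z _; rewrite normcX -powR_mulrn ?normc_ge0// -powRrM.
by rewrite mulrC divfK// pnatr_eq0.
Qed.

End holomorphic_powers.

(** * The Schwarz content *)

Section schwarz_ratio.
Context (R : realType).

(** If both masses vanish, the left side is 0 times +oo, which is 0. *)
Lemma ratio_le (m r k D : R) : 0 <= m -> 0 <= r -> 0 <= k -> 0 < D -> m * D <= k * r ->
  (m%:E / (m + r)%:E <= k%:E / (k%:E + D%:E))%E.
Proof.
move=> m0 r0 k0 D0 h; have kD : 0 < k + D by lra.
rewrite -EFinD !inver (gt_eqF kD); case: eqP => [mr|/eqP mr].
  have -> : m = 0 by lra.
  by rewrite mul0e -EFinM lee_fin divr_ge0// ltW.
have mr0 : 0 < m + r by rewrite lt_neqAle eq_sym mr addr_ge0.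
rewrite -!EFinM lee_fin ler_pdivrMr// mulrAC ler_pdivlMr//.
lra.
Qed.

Lemma schwarz_content_le n (p : R) (E Omega : set 'rV[R]_(n + n)) (c : \bar R) :
  (forall f, bergman p Omega f -> (pmass p E f / pmass p Omega f <= c)%E) ->
  (schwarz_content p E Omega <= c)%E.
Proof. by move=> h; apply: ge_ereal_sup => _ [f [bf _] <-]; exact: h. Qed.

Lemma schwarz_content_set0 n (p : R) (Omega : set 'rV[R]_(n + n)) :
  (schwarz_content p set0 Omega <= 0)%E.
Proof.
by apply: schwarz_content_le => f _; rewrite /pmass integral_set0 mul0e.
Qed.

Lemma eucl_dist_set0 N (A : set 'rV[R]_N) : eucl_dist set0 A = +oo%E.
Proof.
rewrite /eucl_dist (_ : [set _ | x in _ & y in _] = set0) ?ereal_inf0//.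
by apply/seteqP; split => // z [x []].
Qed.

End schwarz_ratio.

Theorem proposition1p10 (R : realType) (n : nat) (n_gt0 : (0 < n)%N)
    (Omega : set 'rV[R]_(n + n)) (domOmega : bounded_domain Omega) :
  (forall (E : set 'rV[R]_(n + n)) (p : R),
     Lebesgue_measurable E -> relatively_compact E Omega -> 0 < p ->
     let d := eucl_dist E (boundary Omega) in
     let K := (128%:E / lambda1 Omega)%E in
     (schwarz_content p E Omega <= K / (K + d ^+ 2))%E)
  /\
  (forall (p : R) (ptilde : int), 1 < p -> largest_int_below p ptilde ->
     exists2 C : R, 0 < C &
       forall E : set 'rV[R]_(n + n),
         Lebesgue_measurable E -> relatively_compact E Omega ->
         let d := eucl_dist E (boundary Omega) in
         (schwarz_content p E Omega <=
            C%:E / (C%:E + d `^ (p / ptilde%:~R)))%E).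
Proof.
have [oO _ _ bO] := domOmega.
have N0 : (0 < n + n)%N by rewrite addn_gt0 n_gt0.
have [c0 c0_gt0 c0_le] := lambda1_gt0 N0 oO bO.
split.
  move=> E p mE rE p0 /=.
  have [k k0 [KE Kle]] : exists2 k : R, 0 <= k & (128%:E / lambda1 Omega)%E = k%:E /\
      forall m r D : R, 0 < D -> 0 <= r ->
      (forall L : R, 0 <= L -> (L%:E <= lambda1 Omega)%E -> L * m * D <= 128 * r) ->
      m * D <= k * r.
    (* For lambda1 = +oo the constant K is 0; all the real numbers L are then lower
       bounds of lambda1, and this forces m = 0. *)
    case: (lambda1 Omega) c0_le => [L||].
    - rewrite lee_fin => cL; have L0 : 0 < L by exact: lt_le_trans cL.
      exists (128 / L); first by rewrite divr_ge0// ltW.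
      split; first by rewrite inver (gt_eqF L0) EFinM.
      move=> m r D D0 r0 /(_ L (ltW L0) (lexx _)) h.
      by rewrite mulrAC ler_pdivlMr// mulrC mulrA.
    - move=> _; exists 0 => //; split; first by rewrite invey mule0.
      move=> m r D D0 r0 h; rewrite mul0r leNgt; apply/negP => mD.
      have := h ((128 * r + 1) / (m * D)).
      rewrite divr_ge0 ?(ltW mD) ?addr_ge0 ?mulr_ge0// leey => /(_ isT isT).
      by rewrite -mulrA divfK ?gt_eqF//; lra.
    - by rewrite leeNy_eq.
  rewrite KE; have [->|/set0P E0] := eqVneq E set0.
    (* The distance from the empty set is +oo, so that the right side is 0. *)
    apply: le_trans (schwarz_content_set0 _ _) _.
    by rewrite eucl_dist_set0 mulyy addey// invey mule0.
  have [D [D0 dE hd]] := eucl_dist_boundary N0 domOmega E0 rE.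
  have bE := relatively_compact_bounded rE.
  rewrite dE -EFinM -expr2; apply: schwarz_content_le => f [hf fin].
  have [m [r [m0 r0 mE' rE' ->]]] :=
    pmass_split oO p0 hf mE (relatively_compact_subset rE) fin.
  rewrite mE'; apply: ratio_le => //; first exact: exprn_gt0.
  apply: Kle => // [|L L0 hL]; first exact: exprn_gt0.
  exact: (eigenvalue_mass oO E0 bE D0 hd p0 hf mE hL L0 mE' rE').
move=> p ptilde p1 [pl pmax].
have : (1 <= ptilde)%R by apply: pmax.
case: ptilde pl {pmax} => // -[//|k] kp _.
have q1 : 1 < p / k.+1%:R by rewrite ltr_pdivlMr ?mul1r// ltr0n.
have p0 : 0 < p by lra.
have [B B0 OB] := bounded_enorm bO.
exists (2 * (128 / 3 * (3 * B + 1)) `^ (p / k.+1%:R)).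
  by rewrite mulr_gt0// powR_gt0//; lra.
move=> E mE rE /=.
have [->|/set0P E0] := eqVneq E set0.
  apply: le_trans (schwarz_content_set0 _ _) _.
  by rewrite eucl_dist_set0 poweRyr ?gt_eqF ?(lt_trans ltr01 q1)// addey// invey mule0.
have [D [D0 dE hd]] := eucl_dist_boundary N0 domOmega E0 rE.
have bE := relatively_compact_bounded rE.
rewrite dE poweR_EFin; apply: schwarz_content_le => f [hf fin].
have hfk := holomorphicX k oO hf.
rewrite (pmass_powR E f p k) (pmass_powR Omega f p k).
rewrite (pmass_powR Omega f p k) in fin.
have q0 : 0 < p / k.+1%:R by exact: lt_trans ltr01 q1.
have [m [r [m0 r0 mE' rE' ->]]] :=
  pmass_split oO q0 hfk mE (relatively_compact_subset rE) fin.
rewrite mE'; apply: ratio_le => //.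
- by rewrite mulr_ge0 ?powR_ge0.
- exact: powR_gt0.
apply: (dbar_mass n_gt0 oO E0 bE D0 hd B0 _ q1 hfk mE mE' rE').
by move=> x /OB; apply: le_trans; exact: norm_le_enorm.
Qed.
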